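(* Let $\mathcal{I}$ be any one of the following stratified institutions: modal propositional logic $\mathcal{MPL}$, first order modal logic $\mathcal{MFOL}$, hybrid propositional logic $\mathcal{HPL}$, hybrid first order logic $\mathcal{HFOL}$, their multi-modal (polyadic) versions $\mathcal{MMPL}$, $\mathcal{MHPL}$, $\mathcal{MMFOL}$, $\mathcal{MHFOL}$, double hybrid propositional logic $\mathcal{HHPL}$, open first order logic $\mathcal{OFOL}$, and its extensions $\mathcal{MOFOL}$, $\mathcal{HOFOL}$, $\mathcal{HMOFOL}$. Then in $\mathcal{I}$ each sentence is preserved by all ultraproducts and by all ultrafactors. Consequently the local institution $\mathcal{I}^\sharp$ and the global institution $\mathcal{I}^*$ are m-compact, and in addition $\mathcal{I}^\sharp$ is compact.
   Context: General notions. For each signature $\Sigma$, each of the logics below has a set $\mathrm{Sen}(\Sigma)$ of sentences, a category $\mathrm{Mod}(\Sigma)$ of models, a functor $[\![\_]\!]_\Sigma\colon\mathrm{Mod}(\Sigma)\to\mathbf{Set}$ (states) and a satisfaction relation $M\models^w\rho$ ($w\in[\![M]\!]_\Sigma$). (Signature morphisms are symbol-to-symbol maps with the evident sentence translations and model reducts.) Local institution $\mathcal{I}^\sharp$: $\Sigma$-models are pairs $(M,w)$ with $w\in[\![M]\!]_\Sigma$, and $(M,w)\models^\sharp\rho$ iff $M\models^w\rho$. Global institution $\mathcal{I}^*$: $\Sigma$-models are those of $\mathcal{I}$, and $M\models^*\rho$ iff $M\models^w\rho$ for all $w\in[\![M]\!]_\Sigma$. In an institution, a model satisfies a set of sentences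 if it satisfies all its members, and $E\models\rho$ means that every model of $E$ satisfies $\rho$. An institution is m-compact when for each signature a set $E$ of sentences has a model iff each finite subset of $E$ has a model; it is compact when $E\models\rho$ implies $E_0\models\rho$ for some finite $E_0\subseteq E$. Ultraproducts. For an ultrafilter $F$ over a non-empty set $I$ and a family $(M_i)_{i\in I}$ of $\Sigma$-models, an $F$-product (ultraproduct) consists, in the category $\mathrm{Mod}(\Sigma)$, of direct products $\{p_{J,i}\colon M_J\to M_i\mid i\in J\}$ of $(M_i)_{i\in J}$ for each $J\in F$, and a colimit $\{\mu_J\colon M_J\to M_F\mid J\in F\}$ of the directed diagram of canonical projections $M_J\to M_{J'}$ ($J'\subseteq J$ in $F$). A $\Sigma$-sentence $\rho$ is preserved by all ultraproducts (respectively by all ultrafactors) when for each ultrafilter $F$ over a set $I$, each family $(M_j)_{j\in I}$ of $\Sigma$-models, each $F$-product of it and each $w\in[\![M_F]\!]_\Sigma$, the condition ''there exist $J\in F$ and $k\in[\![M_J]\!]$ with $[\![\mu_J]\!](k)=w$ and $M_j\models^{k_j}\rho$ for all $j\in J$, where $k_j=[\![p_{J,j}]\!](k)$'' implies (respectively is implied by) $M_F\models^w\rho$. First order logic $\mathcal{FOL}$ is single-sorted, without equality: signatures are pairs $(F,P)$ with $F=(F_n)_{n\in\omega}$ function symbols and $P=(P_n)_{n\in\omega}$ relation symbols by arity; sentences are generated by relational atoms $\pi(t_1,\dots,t_n)$, $\wedge$, $\neg$, and $(\exists x)\rho'$ with $\rho'$ an $(F+x,P)$-sentence, where $F+x$ adds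 the variable $x$ to $F_0$ as a new constant; models and satisfaction are the usual ones; homomorphisms are functions commuting with the operations and preserving the relations. $\mathcal{MPL}$: a signature is a set $P$. Sentences: $S::=P\mid S\wedge S\mid\neg S\mid\Diamond S$. Models are $(W,M)$ with $W=(|W|,W_\lambda)$, $|W|$ a set, $W_\lambda\subseteq|W|\times|W|$, and $M\colon|W|\to 2^P$, $w\mapsto M^w$. A homomorphism $(W,M)\to(V,N)$ is a function $h\colon|W|\to|V|$ with $h(W_\lambda)\subseteq V_\lambda$ and $M^w\subseteq N^{h(w)}$ for all $w$. $[\![(W,M)]\!]=|W|$. Satisfaction: $(W,M)\models^w\pi$ iff $\pi\in M^w$; Boolean connectives as usual at $w$; $(W,M)\models^w\Diamond\rho$ iff $(W,M)\models^{w'}\rho$ for some $(w,w')\in W_\lambda$. $\mathcal{MFOL}$: signatures of $\mathcal{FOL}$; sentences: add $S::=\Diamond S$ to the $\mathcal{FOL}$ grammar. Models $(W,M)$ with $W$ as in $\mathcal{MPL}$ and $M$ assigning to each $w\in|W|$ an $(F,P)$-model $M^w$ of $\mathcal{FOL}$ such that all $M^w$ have the same carrier $|M|$ and the same interpretations $M_x$ of the constants $x\in F_0$ (this common carrier and these common interpretations are part of the data). A homomorphism $(W,M)\to(V,N)$ is a pair $(h_0,h_1)$ with $h_0\colon W\to V$ a homomorphism of binary relations and $h_1\colon|M|\to|N|$ a function (preserving the common constants) that is an $(F,P)$-homomorphism $M^w\to N^{h_0(w)}$ for each $w$. $[\![(W,M)]\!]=|W|$. Satisfaction at $w$: atoms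 as in $\mathcal{FOL}$ in $M^w$; $\wedge,\neg,\Diamond$ as in $\mathcal{MPL}$; $(W,M)\models^w(\exists x)\rho$ iff $(W,M')\models^w\rho$ for some expansion $(W,M')$ of $(W,M)$ interpreting $x$ by an element of $|M|$ (the same in all worlds). $\mathcal{HPL}$, $\mathcal{HFOL}$: signatures of $\mathcal{MPL}$, respectively $\mathcal{MFOL}$, with an additional set $\mathrm{Nom}$ of nominals; sentences: add $S::=i\text{-}\mathrm{sen}\mid @_iS\mid(\exists i)S'$, where in the first two cases $i\in\mathrm{Nom}$, and in the last $S'$ are the sentences of the signature with the nominal variable $i$ added to $\mathrm{Nom}$. Models additionally interpret each $i\in\mathrm{Nom}$ as $W_i\in|W|$, and homomorphisms preserve these. Satisfaction: $(W,M)\models^w i\text{-}\mathrm{sen}$ iff $W_i=w$; $(W,M)\models^w@_i\rho$ iff $(W,M)\models^{W_i}\rho$; $(W,M)\models^w(\exists i)\rho$ iff $(W',M)\models^w\rho$ for some expansion $W'$ of $W$ with an interpretation of $i$. $[\![(W,M)]\!]=|W|$. $\mathcal{MMPL}$, $\mathcal{MHPL}$, $\mathcal{MMFOL}$, $\mathcal{MHFOL}$: obtained from $\mathcal{MPL}$, $\mathcal{HPL}$, $\mathcal{MFOL}$, $\mathcal{HFOL}$, respectively, by adding to signatures a family $\Lambda=(\Lambda_n)_{n\in\omega}$ of modality symbols, replacing $\Diamond S$ by $\langle\lambda\rangle(S,\dots,S)$ ($n$ arguments) for $\lambda\in\Lambda_{n+1}$, $n\in\omega$, and replacing the binary relation in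 models by relations $W_\lambda\subseteq|W|^n$ for $\lambda\in\Lambda_n$ (preserved by homomorphisms). Satisfaction: $(W,M)\models^w\langle\lambda\rangle(\rho_1,\dots,\rho_n)$ iff there is $(w,w_1,\dots,w_n)\in W_\lambda$ with $(W,M)\models^{w_i}\rho_i$ for all $i$. $\mathcal{HHPL}$ (hybridization of $\mathcal{HPL}$): signatures $(\mathrm{Nom}^0,\mathrm{Nom}^1,P)$. Sentences are built from the $\mathcal{HPL}$-sentences over $(\mathrm{Nom}^0,P)$ and $i\text{-}\mathrm{sen}$ for $i\in\mathrm{Nom}^1$ by $\wedge$, $\neg$, $\Diamond$, $@_i$ ($i\in\mathrm{Nom}^1$), and existential quantification over nominal variables of either layer. A model $(W^1,M^1)$ consists of $W^1=(|W^1|,W^1_\lambda,(W^1_i)_{i\in\mathrm{Nom}^1})$ with $W^1_\lambda$ binary, and for each $w\in|W^1|$ an $\mathcal{HPL}$-model $(M^1)^w=((W^0)^w,(M^0)^w)$ over $(\mathrm{Nom}^0,P)$, such that all $(W^0)^w$ have the same set of worlds and the same interpretations of the nominals in $\mathrm{Nom}^0$ (this common set and these interpretations are part of the data). Homomorphisms are pairs $(h_0,h_1)$ with $h_0$ a homomorphism of the upper frames preserving $\mathrm{Nom}^1$ and $h_1$ a function between the common lower sets of worlds (preserving $\mathrm{Nom}^0$) that is an $\mathcal{HPL}$-homomorphism $(M^1)^w\to(N^1)^{h_0(w)}$ for each $w$. $[\![(W^1,M^1)]\!]=|W^1|$. Satisfaction at $w\in|W^1|$: an $\mathcal{HPL}$-sentence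 $\rho$ over $(\mathrm{Nom}^0,P)$ holds at $w$ iff $(M^1)^w\models^v\rho$ in $\mathcal{HPL}$ for all worlds $v$ of $(W^0)^w$; the upper layer connectives are interpreted as in $\mathcal{HPL}$ over $W^1$; quantification over a $\mathrm{Nom}^0$-variable ranges over the common lower set of worlds. $\mathcal{OFOL}$: signatures $((F,P),X)$ with $(F,P)$ a $\mathcal{FOL}$-signature and $X$ a finite set of variables. $\mathrm{Sen}((F,P),X)=\mathrm{Sen}^{\mathcal{FOL}}(F+X,P)$, where $F+X$ adds $X$ to $F_0$; $\mathrm{Mod}((F,P),X)=\mathrm{Mod}^{\mathcal{FOL}}(F,P)$; $[\![M]\!]=|M|^X$; $M\models^w\rho$ iff $M^w\models^{\mathcal{FOL}}\rho$, where $M^w$ is the expansion of $M$ interpreting $X$ by $w$. (Thus $M\models^w(\exists x)\rho$ iff $M\models^{w'}\rho$ for some $w'\in|M|^{X\cup\{x\}}$ extending $w$, with $\rho$ an $((F,P),X\cup\{x\})$-sentence.) $\mathcal{MOFOL}$: add to the grammar of $\mathcal{OFOL}$ sentences $\langle\pi\rangle(S,\dots,S)$ ($n$ arguments) for $\pi\in P_{n+1}$, with $M\models^w\langle\pi\rangle(\rho_1,\dots,\rho_n)$ iff there is $(w,w_1,\dots,w_n)\in(M^X)_\pi$ with $M\models^{w_i}\rho_i$ for all $i$, where $M^X$ is the $X$-power of $M$ in $\mathrm{Mod}^{\mathcal{FOL}}(F,P)$ (operations and relations componentwise). $\mathcal{HOFOL}$: add to the grammar of $\mathcal{OFOL}$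 sentences $i\text{-}\mathrm{sen}$, $@_i\rho$ for $i\in F_0$, and $(\exists i)\rho$ with $\rho$ an $((F+i,P),X)$-sentence; satisfaction: $M\models^w i\text{-}\mathrm{sen}$ iff $(M^X)_i=w$; $M\models^w@_i\rho$ iff $M\models^{(M^X)_i}\rho$; $M\models^w(\exists i)\rho$ iff $M'\models^w\rho$ for some expansion $M'$ of $M$ to $(F+i,P)$. $\mathcal{HMOFOL}$ has both additions. The other clauses, including the one for $(\exists x)$, are as in $\mathcal{OFOL}$. *)

(* Defs.v *)
From mathcomp Require Import all_boot.
From mathcomp Require Import boolp classical_sets cardinality filter.

Set Implicit Arguments.
Unset Strict Implicit.
Unset Printing Implicit Defensive.

Local Open Scope classical_set_scope.

Record category := Category {
  object :> Type;
  hom : object -> object -> Type;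
  idm : forall A, hom A A;
  cmp : forall A B C, hom A B -> hom B C -> hom A C; (* diagrammatic order *)
  cmp1m : forall A B (f : hom A B), cmp (idm A) f = f;
  cmpm1 : forall A B (f : hom A B), cmp f (idm B) = f;
  cmpA : forall A B C D (f : hom A B) (g : hom B C) (h : hom C D),
    cmp f (cmp g h) = cmp (cmp f g) h
}.
Arguments hom {c}.
Arguments idm {c}.
Arguments cmp {c A B C}.

Record functor (C D : category) := Functor {
  fobj :> C -> D;
  fmap : forall A B : C, hom A B -> hom (fobj A) (fobj B);
  fmap1 : forall A, fmap (idm A) = idm (fobj A);
  fmapM : forall A B E (f : hom A B) (g : hom B E),
    fmap (cmp f g) = cmp (fmap f) (fmap g)
}.
Arguments fmap {C D} f0 {A B}.

Definition Sets : category :=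
  @Category Type (fun A B => A -> B) (fun _ => id) (fun _ _ _ f g => g \o f)
    (fun _ _ _ => erefl) (fun _ _ _ => erefl) (fun _ _ _ _ _ _ _ => erefl).

Lemma functor_comp1 (C D E : category) (G : functor D E) (H : functor C D) A :
  fmap G (fmap H (idm A)) = idm (G (H A)).
Proof. by rewrite !fmap1. Qed.

Lemma functor_compM (C D E : category) (G : functor D E) (H : functor C D)
    A B B' (f : hom A B) (g : hom B B') :
  fmap G (fmap H (cmp f g)) = cmp (fmap G (fmap H f)) (fmap G (fmap H g)).
Proof. by rewrite !fmapM. Qed.

Definition functor_comp (C D E : category) (G : functor D E) (H : functor C D) :
  functor C E :=
  @Functor C E (fun A => G (H A)) (fun A B f => fmap G (fmap H f))
    (functor_comp1 G H) (@functor_compM C D E G H).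

Section ProdCat.
Context (C D : category).
Let pobj := (C * D)%type.
Let phom (A B : pobj) := (hom A.1 B.1 * hom A.2 B.2)%type.
Let pid (A : pobj) : phom A A := (idm A.1, idm A.2).
Let pcmp (A B E : pobj) (f : phom A B) (g : phom B E) : phom A E :=
  (cmp f.1 g.1, cmp f.2 g.2).

Lemma prod_cmp1m A B (f : phom A B) : pcmp (pid A) f = f.
Proof. by case: f => f g; rewrite /pcmp /= !cmp1m. Qed.

Lemma prod_cmpm1 A B (f : phom A B) : pcmp f (pid B) = f.
Proof. by case: f => f g; rewrite /pcmp /= !cmpm1. Qed.

Lemma prod_cmpA A B E G (f : phom A B) (g : phom B E) (h : phom E G) :
  pcmp f (pcmp g h) = pcmp (pcmp f g) h.
Proof. by rewrite /pcmp /= !cmpA. Qed.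

Definition prod_cat : category := Category prod_cmp1m prod_cmpm1 prod_cmpA.

End ProdCat.

Definition fst_functor (C D : category) : functor (prod_cat C D) C :=
  @Functor (prod_cat C D) C fst (fun _ _ f => f.1)
    (fun _ => erefl) (fun _ _ _ _ _ => erefl).

(* The category of objects of C carrying additional structure: u is the       *)
(* underlying object, and the arrows are the arrows of C that satisfy P.      *)
Section Structured.
Context (C : category) (O : Type) (u : O -> C).
Context (P : forall A B, hom (u A) (u B) -> Prop).
Hypothesis P1 : forall A, P (idm (u A)).
Hypothesis PM : forall A B D (f : hom (u A) (u B)) (g : hom (u B) (u D)),
  P f -> P g -> P (cmp f g).

Let shom A B := {f : hom (u A) (u B) | P f}.
Let sid A : shom A A := exist _ _ (P1 A).
Let scmp A B D (f : shom A B) (g : shom B D) : shom A D :=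
  exist _ _ (PM (svalP f) (svalP g)).

Lemma structured_cmp1m A B (f : shom A B) : scmp (sid A) f = f.
Proof. by case: f => f Pf; apply: eq_exist; exact: cmp1m. Qed.

Lemma structured_cmpm1 A B (f : shom A B) : scmp f (sid B) = f.
Proof. by case: f => f Pf; apply: eq_exist; exact: cmpm1. Qed.

Lemma structured_cmpA A B D E (f : shom A B) (g : shom B D) (h : shom D E) :
  scmp f (scmp g h) = scmp (scmp f g) h.
Proof. by apply: eq_exist; exact: cmpA. Qed.

Definition structured : category :=
  Category structured_cmp1m structured_cmpm1 structured_cmpA.

Definition forget : functor structured C :=
  @Functor structured C u (fun _ _ f => sval f)
    (fun _ => erefl) (fun _ _ _ _ _ => erefl).

End Structured.

Record stratified_category := StratifiedCategory {
  cat_of :> category;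
  states : functor cat_of Sets
}.

Definition state (K : stratified_category) (A : K) : Type := states K A.

Definition smap (K : stratified_category) (A B : K) (h : hom A B) :
  state A -> state B := fmap (states K) h.

(* Institutions are recorded over each single signature only: no notion       *)
(* below involves signature morphisms.                                        *)

Record stratified_institution := StratifiedInstitution {
  ssig : Type;
  ssen : ssig -> Type;
  smod : ssig -> stratified_category;
  ssat : forall S (M : smod S), state M -> ssen S -> Prop
}.
Arguments ssat {s S}.

Record institution := Institution {
  isig : Type;
  isen : isig -> Type;
  imod : isig -> category;
  isat : forall S, imod S -> isen S -> Prop
}.
Arguments isat {i S}.

Definition pointed_model (K : stratified_category) := {M : K & state M}.

Definition pointed_hom (K : stratified_category) (A B : pointed_model K)
    (h : hom (tag A) (tag B)) : Prop := smap h (tagged A) = tagged B.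

Lemma pointed_hom1 (K : stratified_category) (A : pointed_model K) :
  pointed_hom (A := A) (B := A) (idm (tag A)).
Proof. by rewrite /pointed_hom /smap fmap1. Qed.

Lemma pointed_homM (K : stratified_category) (A B C : pointed_model K)
    (f : hom (tag A) (tag B)) (g : hom (tag B) (tag C)) :
  pointed_hom f -> pointed_hom g ->
  pointed_hom (A := A) (B := C) (cmp f g).
Proof. by rewrite /pointed_hom /smap fmapM /= => -> ->. Qed.

Definition local_institution (I : stratified_institution) : institution :=
  @Institution (ssig I) (@ssen I)
    (fun S => structured (@pointed_hom1 (smod S)) (@pointed_homM (smod S)))
    (fun S (Mw : pointed_model (smod S)) rho => ssat (tag Mw) (tagged Mw) rho).

Definition global_institution (I : stratified_institution) : institution :=
  @Institution (ssig I) (@ssen I) (fun S => smod S)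
    (fun S (M : smod S) rho => forall w, ssat M w rho).

Definition satisfies (I : institution) (S : isig I) (M : imod S)
    (E : set (isen S)) : Prop := forall rho, E rho -> isat M rho.

Definition entails (I : institution) (S : isig I) (E : set (isen S))
    (rho : isen S) : Prop := forall M : imod S, satisfies M E -> isat M rho.

Definition m_compact (I : institution) : Prop :=
  forall (S : isig I) (E : set (isen S)),
    (exists M : imod S, satisfies M E) <->
    (forall E0, finite_set E0 -> E0 `<=` E ->
       exists M : imod S, satisfies M E0).

Definition compact (I : institution) : Prop :=
  forall (S : isig I) (E : set (isen S)) (rho : isen S),
    entails E rho ->
    exists E0, [/\ finite_set E0, E0 `<=` E & entails E0 rho].

Definition is_product (C : category) (I : Type) (J : set I) (M : I -> C)
    (N : C) (p : forall i, J i -> hom N (M i)) : Prop :=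
  forall (X : C) (q : forall i, J i -> hom X (M i)),
    exists! h : hom X N, forall i (Ji : J i), cmp h (p i Ji) = q i Ji.

Section FProduct.
Context (C : category) (I : Type) (F : set_system I) (M : I -> C).

Section Cocone.
Context (MJ : forall J : set I, F J -> C).
Context (p : forall (J : set I) (FJ : F J) i, J i -> hom (MJ FJ) (M i)).

(* For products MJ there is exactly one such arrow whenever K `<=` J. *)
Definition canonical_projection (J K : set I) (FJ : F J) (FK : F K)
    (KJ : K `<=` J) (h : hom (MJ FJ) (MJ FK)) : Prop :=
  forall i (Ki : K i), cmp h (p FK Ki) = p FJ (KJ i Ki).

Definition is_cocone (N : C) (nu : forall J (FJ : F J), hom (MJ FJ) N) : Prop :=
  forall (J K : set I) (FJ : F J) (FK : F K) (KJ : K `<=` J)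
         (h : hom (MJ FJ) (MJ FK)),
    canonical_projection KJ h -> cmp h (nu K FK) = nu J FJ.

Definition is_colimit (N : C) (mu : forall J (FJ : F J), hom (MJ FJ) N) :
    Prop :=
  is_cocone mu /\
  forall (X : C) (nu : forall J (FJ : F J), hom (MJ FJ) X), is_cocone nu ->
    exists! h : hom N X, forall J (FJ : F J), cmp (mu J FJ) h = nu J FJ.

End Cocone.

Record fproduct := FProduct {
  fp_prod : forall J : set I, F J -> C;
  fp_proj : forall (J : set I) (FJ : F J) i, J i -> hom (fp_prod FJ) (M i);
  fp_prodP : forall (J : set I) (FJ : F J), is_product (fp_proj FJ);
  fp_obj :> C;
  fp_in : forall (J : set I) (FJ : F J), hom (fp_prod FJ) fp_obj;
  fp_colimP : is_colimit fp_proj fp_in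
}.

End FProduct.

Section Preservation.
Context (I : stratified_institution) (S : ssig I) (rho : ssen S).

Definition satisfied_by_factors (T : Type) (F : set_system T)
    (M : T -> smod S) (U : fproduct F M) (w : state (fp_obj U)) : Prop :=
  exists (J : set T) (FJ : F J) (k : state (fp_prod U FJ)),
    smap (fp_in U FJ) k = w /\
    forall j (Jj : J j), ssat (M j) (smap (fp_proj U FJ Jj) k) rho.

(* The index set T is non-empty, as ultrafilters are proper. *)
Definition preserved_by_ultraproducts : Prop :=
  forall (T : Type) (F : set_system T), UltraFilter F ->
  forall (M : T -> smod S) (U : fproduct F M) (w : state (fp_obj U)),
    satisfied_by_factors w -> ssat (fp_obj U) w rho.

Definition preserved_by_ultrafactors : Prop :=
  forall (T : Type) (F : set_system T), UltraFilter F ->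
  forall (M : T -> smod S) (U : fproduct F M) (w : state (fp_obj U)),
    ssat (fp_obj U) w rho -> satisfied_by_factors w.

End Preservation.

(* n-tuples over T are functions 'I_n -> T.  Carriers, and sets of worlds,    *)
(* may be empty.                                                              *)

Definition tup0 (T : Type) (i : 'I_0) : T := False_rect T (notF (ltn_ord i)).

Definition tcons (T : Type) n (x : T) (t : 'I_n -> T) (i : 'I_n.+1) : T :=
  if unlift ord0 i is Some j then t j else x.

(* F + X: the elements of X are added to F 0 as new constants; F + x, for a   *)
(* single variable x, is the case of a one-element X.                         *)
Definition add_consts (F : nat -> Type) (X : Type) (n : nat) : Type :=
  match n with 0 => (F 0 + X)%type | m.+1 => F m.+1 end.

Definition add_var (F : nat -> Type) : nat -> Type := add_consts F unit.

Inductive term (F : nat -> Type) : Type :=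
| App n (f : F n) (args : 'I_n -> term F).

Record fo_str (F P : nat -> Type) (D : Type) := FoStr {
  fn : forall n, F n -> ('I_n -> D) -> D;
  rl : forall n, P n -> set ('I_n -> D)
}.

Definition fo_hom (F P : nat -> Type) (D D' : Type)
    (M : fo_str F P D) (N : fo_str F P D') (h : D -> D') : Prop :=
  (forall n (f : F n) a, h (fn M f a) = fn N f (h \o a)) /\
  (forall n (pi : P n) a, rl M pi a -> rl N pi (h \o a)).

Lemma fo_hom1 (F P : nat -> Type) (D : Type)
    (M : fo_str F P D) : fo_hom M M id.
Proof. by []. Qed.

Lemma fo_homM (F P : nat -> Type) (D1 D2 D3 : Type)
    (M1 : fo_str F P D1) (M2 : fo_str F P D2)
    (M3 : fo_str F P D3) (f : D1 -> D2) (g : D2 -> D3) :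
  fo_hom M1 M2 f -> fo_hom M2 M3 g -> fo_hom M1 M3 (g \o f).
Proof.
move=> [f1 f2] [g1 g2]; split=> [n s a /=|n pi a /f2/g2//].
by rewrite f1 g1.
Qed.

Definition expand_fn (F : nat -> Type) (X D : Type)
    (op : forall n, F n -> ('I_n -> D) -> D) (v : X -> D) n :
  add_consts F X n -> ('I_n -> D) -> D :=
  match n with
  | 0 => fun s a => match s with inl c => op 0 c a | inr x => v x end
  | m.+1 => op m.+1
  end.

Definition fo_expand (F P : nat -> Type) (D X : Type) (M : fo_str F P D)
    (v : X -> D) : fo_str (add_consts F X) P D :=
  {| fn := expand_fn (@fn _ _ _ M) v; rl := @rl _ _ _ M |}.

Definition fo_power (F P : nat -> Type) (D : Type) (M : fo_str F P D)
    (X : Type) : fo_str F P (X -> D) :=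
  {| fn := fun n f a x => fn M f (fun i => a i x);
     rl := fun n pi a => forall x, rl M pi (fun i => a i x) |}.

Fixpoint eval (F P : nat -> Type) (D : Type) (M : fo_str F P D)
    (t : term F) : D :=
  match t with App n f args => fn M f (fun i => eval M (args i)) end.

Definition sat_atom (F P : nat -> Type) (D : Type) (M : fo_str F P D)
    n (pi : P n) (t : 'I_n -> term F) : Prop :=
  rl M pi (fun i => eval M (t i)).

Definition expand_var (F P : nat -> Type) (D : Type) (M : fo_str F P D)
    (d : D) : fo_str (add_var F) P D := fo_expand M (fun=> d).

Record kframe := KFrame {
  kworld : Type;
  kacc : kworld -> kworld -> Prop
}.
Arguments kacc : clear implicits.

Definition kframe_hom (W V : kframe) (h : kworld W -> kworld V) : Prop :=
  forall w w', kacc W w w' -> kacc V (h w) (h w').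

Lemma kframe_hom1 W : @kframe_hom W W id.
Proof. by []. Qed.

Lemma kframe_homM A B C (f : kworld A -> kworld B) (g : kworld B -> kworld C) :
  kframe_hom f -> kframe_hom g -> kframe_hom (g \o f).
Proof. by move=> Pf Pg w w' /Pf/Pg. Qed.

Definition kframes : stratified_category :=
  @StratifiedCategory (@structured Sets _ kworld _ kframe_hom1 kframe_homM)
    (forget _ _).

Record pframe (L : nat -> Type) := PFrame {
  pworld : Type;
  prel : forall n, L n -> set ('I_n -> pworld)
}.
Arguments prel {L} p {n}.

Definition pframe_hom (L : nat -> Type)
    (W V : pframe L) (h : pworld W -> pworld V) : Prop :=
  forall n (lam : L n) a, prel W lam a -> prel V lam (h \o a).

Lemma pframe_hom1 (L : nat -> Type)
    (W : pframe L) : @pframe_hom L W W id.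
Proof. by []. Qed.

Lemma pframe_homM (L : nat -> Type)
    (A B C : pframe L)
    (f : pworld A -> pworld B) (g : pworld B -> pworld C) :
  pframe_hom f -> pframe_hom g -> pframe_hom (g \o f).
Proof. by move=> Pf Pg n lam a /Pf/Pg. Qed.

Definition pframes (L : nat -> Type) : stratified_category :=
  @StratifiedCategory
    (@structured Sets _ (@pworld L) _ (@pframe_hom1 L) (@pframe_homM L))
    (forget _ _).

Record nominated (K : stratified_category) (Nom : Type) := Nominated {
  nframe : K;
  nomi : Nom -> state nframe
}.

Definition nominated_hom (K : stratified_category) (Nom : Type)
    (W V : nominated K Nom) (h : hom (nframe W) (nframe V)) : Prop :=
  forall i, smap h (nomi W i) = nomi V i.

Lemma nominated_hom1 (K : stratified_category) (Nom : Type)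
    (W : nominated K Nom) :
  nominated_hom (W := W) (V := W) (idm (nframe W)).
Proof. by move=> i; rewrite /smap fmap1. Qed.

Lemma nominated_homM (K : stratified_category) (Nom : Type)
    (A B C : nominated K Nom)
    (f : hom (nframe A) (nframe B)) (g : hom (nframe B) (nframe C)) :
  nominated_hom f -> nominated_hom g ->
  nominated_hom (W := A) (V := C) (cmp f g).
Proof.
by move=> Pf Pg i; move: (Pf i) (Pg i); rewrite /smap fmapM /= => -> ->.
Qed.

Definition nominateds (K : stratified_category) (Nom : Type) :
  stratified_category :=
  @StratifiedCategory
    (structured (@nominated_hom1 K Nom) (@nominated_homM K Nom))
    (functor_comp (states K) (forget _ _)).

Definition extend (X T : Type) (v : X -> T) (y : T) (o : option X) : T :=
  if o is Some x then v x else y.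

(* Nom with a new nominal variable is option Nom, and X with a new first      *)
(* order variable is option X.                                                *)
Definition nom_expand (K : stratified_category) (Nom : Type)
    (W : nominated K Nom) (w : state (nframe W)) : nominated K (option Nom) :=
  @Nominated K (option Nom) (nframe W) (extend (@nomi K Nom W) w).

Record prop_model (K : stratified_category) (P : Type) := PropModel {
  pm_frame : K;
  pm_val : state pm_frame -> set P
}.
Arguments pm_val {K P} p w.

Definition prop_hom (K : stratified_category) (P : Type) (M N : prop_model K P)
    (h : hom (pm_frame M) (pm_frame N)) : Prop :=
  forall w, pm_val M w `<=` pm_val N (smap h w).

Lemma prop_hom1 (K : stratified_category) (P : Type) (M : prop_model K P) :
  prop_hom (M := M) (N := M) (idm (pm_frame M)).
Proof. by move=> w; rewrite /smap fmap1. Qed.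

Lemma prop_homM (K : stratified_category) (P : Type) (A B C : prop_model K P)
    (f : hom (pm_frame A) (pm_frame B)) (g : hom (pm_frame B) (pm_frame C)) :
  prop_hom f -> prop_hom g -> prop_hom (M := A) (N := C) (cmp f g).
Proof. by move=> Pf Pg w x /Pf/Pg; rewrite /smap fmapM. Qed.

Definition prop_models (K : stratified_category) (P : Type) :
  stratified_category :=
  @StratifiedCategory (structured (@prop_hom1 K P) (@prop_homM K P))
    (functor_comp (states K) (forget _ _)).

Definition prop_nom_expand (K : stratified_category) (Nom P : Type)
    (M : prop_model (nominateds K Nom) P)
    (w : state (pm_frame M)) : prop_model (nominateds K (option Nom)) P :=
  @PropModel (nominateds K (option Nom)) P
    (nom_expand (W := pm_frame M) w) (pm_val M).

Record fo_model (K : stratified_category) (F P : nat -> Type) := FoModel {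
  fm_frame : K;
  fm_dom : Type;
  fm_cst : F 0 -> fm_dom;
  fm_str : state fm_frame -> fo_str F P fm_dom;
  fm_cstP : forall w c a, fn (fm_str w) c a = fm_cst c
}.
Arguments fm_cst {K F P} f c.
Arguments fm_str {K F P} f w.

Definition fm_base (K : stratified_category) (F P : nat -> Type)
    (M : fo_model K F P) : prod_cat K Sets :=
  (fm_frame M, fm_dom M).

Definition fm_hom (K : stratified_category) (F P : nat -> Type)
    (M N : fo_model K F P)
    (h : hom (fm_base M) (fm_base N)) : Prop :=
  (forall c, h.2 (fm_cst M c) = fm_cst N c) /\
  (forall w, fo_hom (fm_str M w) (fm_str N (smap h.1 w)) h.2).

Lemma fm_hom1 (K : stratified_category) (F P : nat -> Type)
    (M : fo_model K F P) :
  fm_hom (M := M) (N := M) (idm (fm_base M)).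
Proof. by split=> // w; rewrite /smap fmap1; exact: fo_hom1. Qed.

Lemma fm_homM (K : stratified_category) (F P : nat -> Type)
    (A B C : fo_model K F P)
    (f : hom (fm_base A) (fm_base B)) (g : hom (fm_base B) (fm_base C)) :
  fm_hom f -> fm_hom g -> fm_hom (M := A) (N := C) (cmp f g).
Proof.
move=> [f1 f2] [g1 g2]; split=> [c|w] /=; first by rewrite f1 g1.
by rewrite /smap fmapM; apply: fo_homM (f2 w) (g2 _).
Qed.

Definition fo_models (K : stratified_category) (F P : nat -> Type) :
  stratified_category :=
  @StratifiedCategory (structured (@fm_hom1 K F P) (@fm_homM K F P))
    (functor_comp (states K) (functor_comp (fst_functor _ _) (forget _ _))).

Lemma fm_expand_cstP (K : stratified_category) (F P : nat -> Type)
    (M : fo_model K F P) (d : fm_dom M) w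
    (c : add_var F 0) a :
  fn (expand_var (fm_str M w) d) c a =
  match c with inl c' => fm_cst M c' | inr _ => d end.
Proof. by case: c => //= c; rewrite fm_cstP. Qed.

Definition fm_expand (K : stratified_category) (F P : nat -> Type)
    (M : fo_model K F P) (d : fm_dom M) :
  fo_model K (add_var F) P :=
  FoModel (@fm_expand_cstP K F P M d).

Definition fm_nom_expand (K : stratified_category) (Nom : Type)
    (F P : nat -> Type)
    (M : fo_model (nominateds K Nom) F P)
    (w : state (fm_frame M)) : fo_model (nominateds K (option Nom)) F P :=
  @FoModel (nominateds K (option Nom)) F P
    (nom_expand (W := fm_frame M) w) (fm_dom M) (fm_cst M)
    (fm_str M) (@fm_cstP _ _ _ M).

Inductive mpl_sen (P : Type) : Type :=
| mpl_atom (pi : P)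
| mpl_and (r s : mpl_sen P)
| mpl_not (r : mpl_sen P)
| mpl_dia (r : mpl_sen P).

Fixpoint mpl_sat (P : Type) (M : prop_model kframes P) (w : state (pm_frame M))
    (rho : mpl_sen P) : Prop :=
  match rho with
  | mpl_atom pi => pm_val M w pi
  | mpl_and r s => mpl_sat w r /\ mpl_sat w s
  | mpl_not r => ~ mpl_sat w r
  | mpl_dia r => exists w' : state (pm_frame M),
      kacc (pm_frame M) w w' /\ mpl_sat w' r
  end.

Definition MPL : stratified_institution :=
  @StratifiedInstitution Type mpl_sen (prop_models kframes) mpl_sat.

Record hpl_signature := HPLSignature { hpl_Nom : Type; hpl_P : Type }.

Inductive hpl_sen (Nom P : Type) : Type :=
| hpl_atom (pi : P)
| hpl_and (r s : hpl_sen Nom P)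
| hpl_not (r : hpl_sen Nom P)
| hpl_dia (r : hpl_sen Nom P)
| hpl_nom (i : Nom)
| hpl_at (i : Nom) (r : hpl_sen Nom P)
| hpl_ex (r : hpl_sen (option Nom) P).

Fixpoint hpl_sat (Nom P : Type)
    (M : prop_model (nominateds kframes Nom) P)
    (w : state (pm_frame M)) (rho : hpl_sen Nom P) {struct rho} : Prop :=
  match rho with
  | hpl_atom pi => pm_val M w pi
  | hpl_and r s => hpl_sat w r /\ hpl_sat w s
  | hpl_not r => ~ hpl_sat w r
  | hpl_dia r => exists w' : state (pm_frame M),
      kacc (nframe (pm_frame M)) w w' /\ hpl_sat w' r
  | hpl_nom i => nomi (pm_frame M) i = w
  | hpl_at i r => @hpl_sat _ _ M (nomi (pm_frame M) i) r
  | hpl_ex r => exists v : state (pm_frame M),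
      @hpl_sat _ _ (prop_nom_expand v) w r
  end.

Definition HPL : stratified_institution :=
  @StratifiedInstitution hpl_signature
    (fun S => hpl_sen (hpl_Nom S) (hpl_P S))
    (fun S => prop_models (nominateds kframes (hpl_Nom S)) (hpl_P S))
    (fun S => @hpl_sat (hpl_Nom S) (hpl_P S)).

Record mmpl_signature := MMPLSignature {
  mmpl_L : nat -> Type;
  mmpl_P : Type
}.

Inductive mmpl_sen (L : nat -> Type) (P : Type) : Type :=
| mmpl_atom (pi : P)
| mmpl_and (r s : mmpl_sen L P)
| mmpl_not (r : mmpl_sen L P)
| mmpl_mod n (lam : L n.+1) (r : 'I_n -> mmpl_sen L P).

Fixpoint mmpl_sat (L : nat -> Type) (P : Type)
    (M : prop_model (pframes L) P) (w : state (pm_frame M))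
    (rho : mmpl_sen L P) : Prop :=
  match rho with
  | mmpl_atom pi => pm_val M w pi
  | mmpl_and r s => mmpl_sat w r /\ mmpl_sat w s
  | mmpl_not r => ~ mmpl_sat w r
  | mmpl_mod n lam r => exists ws : 'I_n -> state (pm_frame M),
      prel (L := L) (pm_frame M) lam (tcons w ws) /\
      forall i, mmpl_sat (ws i) (r i)
  end.

Definition MMPL : stratified_institution :=
  @StratifiedInstitution mmpl_signature
    (fun S => mmpl_sen (mmpl_L S) (mmpl_P S))
    (fun S => prop_models (pframes (mmpl_L S)) (mmpl_P S))
    (fun S => @mmpl_sat (mmpl_L S) (mmpl_P S)).

Record mhpl_signature := MHPLSignature {
  mhpl_L : nat -> Type;
  mhpl_Nom : Type;
  mhpl_P : Type
}.

Inductive mhpl_sen (L : nat -> Type) (Nom P : Type) : Type :=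
| mhpl_atom (pi : P)
| mhpl_and (r s : mhpl_sen L Nom P)
| mhpl_not (r : mhpl_sen L Nom P)
| mhpl_mod n (lam : L n.+1) (r : 'I_n -> mhpl_sen L Nom P)
| mhpl_nom (i : Nom)
| mhpl_at (i : Nom) (r : mhpl_sen L Nom P)
| mhpl_ex (r : mhpl_sen L (option Nom) P).

Fixpoint mhpl_sat (L : nat -> Type) (Nom P : Type)
    (M : prop_model (nominateds (pframes L) Nom) P)
    (w : state (pm_frame M)) (rho : mhpl_sen L Nom P) {struct rho} : Prop :=
  match rho with
  | mhpl_atom pi => pm_val M w pi
  | mhpl_and r s => mhpl_sat w r /\ mhpl_sat w s
  | mhpl_not r => ~ mhpl_sat w r
  | mhpl_mod n lam r => exists ws : 'I_n -> state (pm_frame M),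
      prel (L := L) (nframe (pm_frame M)) lam (tcons w ws) /\
      forall i, mhpl_sat (ws i) (r i)
  | mhpl_nom i => nomi (pm_frame M) i = w
  | mhpl_at i r => @mhpl_sat _ _ _ M (nomi (pm_frame M) i) r
  | mhpl_ex r => exists v : state (pm_frame M),
      @mhpl_sat _ _ _ (prop_nom_expand v) w r
  end.

Definition MHPL : stratified_institution :=
  @StratifiedInstitution mhpl_signature
    (fun S => mhpl_sen (mhpl_L S) (mhpl_Nom S) (mhpl_P S))
    (fun S => prop_models (nominateds (pframes (mhpl_L S)) (mhpl_Nom S))
                (mhpl_P S))
    (fun S => @mhpl_sat (mhpl_L S) (mhpl_Nom S) (mhpl_P S)).

Record fol_signature := FOLSignature {
  fol_F : nat -> Type;
  fol_P : nat -> Type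
}.

Inductive mfol_sen (F P : nat -> Type) : Type :=
| mfol_atom n (pi : P n) (t : 'I_n -> term F)
| mfol_and (r s : mfol_sen F P)
| mfol_not (r : mfol_sen F P)
| mfol_ex (r : mfol_sen (add_var F) P)
| mfol_dia (r : mfol_sen F P).

Fixpoint mfol_sat (F P : nat -> Type)
    (M : fo_model kframes F P) (w : state (fm_frame M))
    (rho : mfol_sen F P) {struct rho} : Prop :=
  match rho with
  | mfol_atom n pi t => sat_atom (fm_str M w) pi t
  | mfol_and r s => mfol_sat w r /\ mfol_sat w s
  | mfol_not r => ~ mfol_sat w r
  | mfol_ex r => exists d : fm_dom M, @mfol_sat _ _ (fm_expand d) w r
  | mfol_dia r => exists w' : state (fm_frame M),
      kacc (fm_frame M) w w' /\ mfol_sat w' r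
  end.

Definition MFOL : stratified_institution :=
  @StratifiedInstitution fol_signature
    (fun S => mfol_sen (fol_F S) (fol_P S))
    (fun S => fo_models kframes (fol_F S) (fol_P S))
    (fun S => @mfol_sat (fol_F S) (fol_P S)).

Record hfol_signature := HFOLSignature {
  hfol_Nom : Type;
  hfol_F : nat -> Type;
  hfol_P : nat -> Type
}.

Inductive hfol_sen (Nom : Type) (F P : nat -> Type) : Type :=
| hfol_atom n (pi : P n) (t : 'I_n -> term F)
| hfol_and (r s : hfol_sen Nom F P)
| hfol_not (r : hfol_sen Nom F P)
| hfol_ex (r : hfol_sen Nom (add_var F) P)
| hfol_dia (r : hfol_sen Nom F P)
| hfol_nom (i : Nom)
| hfol_at (i : Nom) (r : hfol_sen Nom F P)
| hfol_nex (r : hfol_sen (option Nom) F P).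

Fixpoint hfol_sat (Nom : Type) (F P : nat -> Type)
    (M : fo_model (nominateds kframes Nom) F P)
    (w : state (fm_frame M)) (rho : hfol_sen Nom F P) {struct rho} : Prop :=
  match rho with
  | hfol_atom n pi t => sat_atom (fm_str M w) pi t
  | hfol_and r s => hfol_sat w r /\ hfol_sat w s
  | hfol_not r => ~ hfol_sat w r
  | hfol_ex r => exists d : fm_dom M, @hfol_sat _ _ _ (fm_expand d) w r
  | hfol_dia r => exists w' : state (fm_frame M),
      kacc (nframe (fm_frame M)) w w' /\ hfol_sat w' r
  | hfol_nom i => nomi (fm_frame M) i = w
  | hfol_at i r => @hfol_sat _ _ _ M (nomi (fm_frame M) i) r
  | hfol_nex r => exists v : state (fm_frame M),
      @hfol_sat _ _ _ (fm_nom_expand v) w r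
  end.

Definition HFOL : stratified_institution :=
  @StratifiedInstitution hfol_signature
    (fun S => hfol_sen (hfol_Nom S) (hfol_F S) (hfol_P S))
    (fun S => fo_models (nominateds kframes (hfol_Nom S))
                (hfol_F S) (hfol_P S))
    (fun S => @hfol_sat (hfol_Nom S) (hfol_F S) (hfol_P S)).

Record mmfol_signature := MMFOLSignature {
  mmfol_L : nat -> Type;
  mmfol_F : nat -> Type;
  mmfol_P : nat -> Type
}.

Inductive mmfol_sen (L F P : nat -> Type) : Type :=
| mmfol_atom n (pi : P n) (t : 'I_n -> term F)
| mmfol_and (r s : mmfol_sen L F P)
| mmfol_not (r : mmfol_sen L F P)
| mmfol_ex (r : mmfol_sen L (add_var F) P)
| mmfol_mod n (lam : L n.+1) (r : 'I_n -> mmfol_sen L F P).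

Fixpoint mmfol_sat (L F P : nat -> Type)
    (M : fo_model (pframes L) F P) (w : state (fm_frame M))
    (rho : mmfol_sen L F P) {struct rho} : Prop :=
  match rho with
  | mmfol_atom n pi t => sat_atom (fm_str M w) pi t
  | mmfol_and r s => mmfol_sat w r /\ mmfol_sat w s
  | mmfol_not r => ~ mmfol_sat w r
  | mmfol_ex r => exists d : fm_dom M, @mmfol_sat _ _ _ (fm_expand d) w r
  | mmfol_mod n lam r => exists ws : 'I_n -> state (fm_frame M),
      prel (L := L) (fm_frame M) lam (tcons w ws) /\
      forall i, mmfol_sat (ws i) (r i)
  end.

Definition MMFOL : stratified_institution :=
  @StratifiedInstitution mmfol_signature
    (fun S => mmfol_sen (mmfol_L S) (mmfol_F S) (mmfol_P S))
    (fun S => fo_models (pframes (mmfol_L S)) (mmfol_F S) (mmfol_P S))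
    (fun S => @mmfol_sat (mmfol_L S) (mmfol_F S) (mmfol_P S)).

Record mhfol_signature := MHFOLSignature {
  mhfol_L : nat -> Type;
  mhfol_Nom : Type;
  mhfol_F : nat -> Type;
  mhfol_P : nat -> Type
}.

Inductive mhfol_sen (L : nat -> Type) (Nom : Type) (F P : nat -> Type) : Type :=
| mhfol_atom n (pi : P n) (t : 'I_n -> term F)
| mhfol_and (r s : mhfol_sen L Nom F P)
| mhfol_not (r : mhfol_sen L Nom F P)
| mhfol_ex (r : mhfol_sen L Nom (add_var F) P)
| mhfol_mod n (lam : L n.+1) (r : 'I_n -> mhfol_sen L Nom F P)
| mhfol_nom (i : Nom)
| mhfol_at (i : Nom) (r : mhfol_sen L Nom F P)
| mhfol_nex (r : mhfol_sen L (option Nom) F P).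

Fixpoint mhfol_sat (L : nat -> Type) (Nom : Type) (F P : nat -> Type)
    (M : fo_model (nominateds (pframes L) Nom) F P)
    (w : state (fm_frame M)) (rho : mhfol_sen L Nom F P) {struct rho} : Prop :=
  match rho with
  | mhfol_atom n pi t => sat_atom (fm_str M w) pi t
  | mhfol_and r s => mhfol_sat w r /\ mhfol_sat w s
  | mhfol_not r => ~ mhfol_sat w r
  | mhfol_ex r => exists d : fm_dom M,
      @mhfol_sat L Nom (add_var F) P (fm_expand d) w r
  | mhfol_mod n lam r => exists ws : 'I_n -> state (fm_frame M),
      prel (L := L) (nframe (fm_frame M)) lam (tcons w ws) /\
      forall i, mhfol_sat (ws i) (r i)
  | mhfol_nom i => nomi (fm_frame M) i = w
  | mhfol_at i r => @mhfol_sat L Nom F P M (nomi (fm_frame M) i) r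
  | mhfol_nex r => exists v : state (fm_frame M),
      @mhfol_sat L (option Nom) F P (fm_nom_expand v) w r
  end.

Definition MHFOL : stratified_institution :=
  @StratifiedInstitution mhfol_signature
    (fun S => mhfol_sen (mhfol_L S) (mhfol_Nom S) (mhfol_F S) (mhfol_P S))
    (fun S => fo_models (nominateds (pframes (mhfol_L S)) (mhfol_Nom S))
                (mhfol_F S) (mhfol_P S))
    (fun S => @mhfol_sat (mhfol_L S) (mhfol_Nom S) (mhfol_F S) (mhfol_P S)).

Record hhpl_signature := HHPLSignature {
  hhpl_Nom0 : Type;
  hhpl_Nom1 : Type;
  hhpl_P : Type
}.

Inductive hhpl_sen (Nom0 Nom1 P : Type) : Type :=
| hhpl_base (r : hpl_sen Nom0 P)
| hhpl_nom (i : Nom1)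
| hhpl_and (r s : hhpl_sen Nom0 Nom1 P)
| hhpl_not (r : hhpl_sen Nom0 Nom1 P)
| hhpl_dia (r : hhpl_sen Nom0 Nom1 P)
| hhpl_at (i : Nom1) (r : hhpl_sen Nom0 Nom1 P)
| hhpl_ex0 (r : hhpl_sen (option Nom0) Nom1 P)
| hhpl_ex1 (r : hhpl_sen Nom0 (option Nom1) P).

Record hhpl_model (Nom0 Nom1 P : Type) := HHPLModel {
  hh_frame : nominateds kframes Nom1;
  hh_low : Type;
  hh_nom0 : Nom0 -> hh_low;
  hh_acc : state hh_frame -> hh_low -> hh_low -> Prop;
  hh_val : state hh_frame -> hh_low -> set P
}.
Arguments hh_nom0 {Nom0 Nom1 P} h i.
Arguments hh_acc {Nom0 Nom1 P} h w v v'.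
Arguments hh_val {Nom0 Nom1 P} h w v.

Definition hh_at (Nom0 Nom1 P : Type)
    (M : hhpl_model Nom0 Nom1 P)
    (w : state (hh_frame M)) : prop_models (nominateds kframes Nom0) P :=
  @PropModel (nominateds kframes Nom0) P
    (@Nominated kframes Nom0 (@KFrame (hh_low M) (hh_acc M w)) (hh_nom0 M))
    (hh_val M w).

Definition hh_base (Nom0 Nom1 P : Type)
    (M : hhpl_model Nom0 Nom1 P) :
  prod_cat (nominateds kframes Nom1) Sets := (hh_frame M, hh_low M).

(* h is the underlying function of some arrow of HPL-models. *)
Definition is_hpl_hom (Nom P : Type)
    (M N : prop_models (nominateds kframes Nom) P)
    (h : state M -> state N) : Prop :=
  exists f : hom M N, smap f = h.

Lemma is_hpl_hom1 (Nom P : Type)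
    (M : prop_models (nominateds kframes Nom) P) :
  @is_hpl_hom Nom P M M id.
Proof. by exists (idm M). Qed.

Lemma is_hpl_homM (Nom P : Type)
    (A B C : prop_models (nominateds kframes Nom) P)
    (f : state A -> state B) (g : state B -> state C) :
  is_hpl_hom f -> is_hpl_hom g -> is_hpl_hom (g \o f).
Proof. by move=> [f' <-] [g' <-]; exists (cmp f' g'). Qed.

Definition hh_hom (Nom0 Nom1 P : Type)
    (M N : hhpl_model Nom0 Nom1 P)
    (h : hom (hh_base M) (hh_base N)) : Prop :=
  (forall i, h.2 (hh_nom0 M i) = hh_nom0 N i) /\
  (forall w, @is_hpl_hom Nom0 P (hh_at w) (hh_at (smap h.1 w)) h.2).

Lemma hh_hom1 (Nom0 Nom1 P : Type)
    (M : hhpl_model Nom0 Nom1 P) :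
  hh_hom (M := M) (N := M) (idm (hh_base M)).
Proof. by split=> // w; exact: is_hpl_hom1. Qed.

Lemma hh_homM (Nom0 Nom1 P : Type)
    (A B C : hhpl_model Nom0 Nom1 P)
    (f : hom (hh_base A) (hh_base B)) (g : hom (hh_base B) (hh_base C)) :
  hh_hom f -> hh_hom g -> hh_hom (M := A) (N := C) (cmp f g).
Proof.
move=> [f1 f2] [g1 g2]; split=> [c|w] /=; first by rewrite f1 g1.
exact: (is_hpl_homM (f2 w) (g2 _)).
Qed.

Definition hhpl_models (Nom0 Nom1 P : Type) : stratified_category :=
  @StratifiedCategory
    (structured (@hh_hom1 Nom0 Nom1 P) (@hh_homM Nom0 Nom1 P))
    (functor_comp (states (nominateds kframes Nom1))
      (functor_comp (fst_functor _ _) (forget _ _))).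

Definition hh_expand0 (Nom0 Nom1 P : Type)
    (M : hhpl_model Nom0 Nom1 P)
    (v : hh_low M) : hhpl_model (option Nom0) Nom1 P :=
  @HHPLModel (option Nom0) Nom1 P (hh_frame M) (hh_low M)
    (extend (hh_nom0 M) v) (hh_acc M) (hh_val M).

Definition hh_expand1 (Nom0 Nom1 P : Type)
    (M : hhpl_model Nom0 Nom1 P)
    (w : state (hh_frame M)) : hhpl_model Nom0 (option Nom1) P :=
  @HHPLModel Nom0 (option Nom1) P (nom_expand (W := hh_frame M) w) (hh_low M)
    (hh_nom0 M) (hh_acc M) (hh_val M).

Fixpoint hhpl_sat (Nom0 Nom1 P : Type)
    (M : hhpl_model Nom0 Nom1 P) (w : state (hh_frame M))
    (rho : hhpl_sen Nom0 Nom1 P) {struct rho} : Prop :=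
  match rho with
  | hhpl_base r => forall v : hh_low M, @hpl_sat Nom0 P (hh_at w) v r
  | hhpl_nom i => nomi (hh_frame M) i = w
  | hhpl_and r s => hhpl_sat w r /\ hhpl_sat w s
  | hhpl_not r => ~ hhpl_sat w r
  | hhpl_dia r => exists w' : state (hh_frame M),
      kacc (nframe (hh_frame M)) w w' /\ hhpl_sat w' r
  | hhpl_at i r => @hhpl_sat _ _ _ M (nomi (hh_frame M) i) r
  | hhpl_ex0 r => exists v : hh_low M, @hhpl_sat _ _ _ (hh_expand0 v) w r
  | hhpl_ex1 r => exists v : state (hh_frame M),
      @hhpl_sat _ _ _ (hh_expand1 v) w r
  end.

Definition HHPL : stratified_institution :=
  @StratifiedInstitution hhpl_signature
    (fun S => hhpl_sen (hhpl_Nom0 S) (hhpl_Nom1 S) (hhpl_P S))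
    (fun S => hhpl_models (hhpl_Nom0 S) (hhpl_Nom1 S) (hhpl_P S))
    (fun S => @hhpl_sat (hhpl_Nom0 S) (hhpl_Nom1 S) (hhpl_P S)).

Record fol_model (F P : nat -> Type) := FOLModel {
  fol_dom : Type;
  fol_str : fo_str F P fol_dom
}.
Arguments fol_str {F P} f.

Definition fol_hom (F P : nat -> Type)
    (M N : fol_model F P) (h : fol_dom M -> fol_dom N) :=
  fo_hom (fol_str M) (fol_str N) h.

Definition fol_cat (F P : nat -> Type) : category :=
  @structured Sets (fol_model F P) (@fol_dom F P) (@fol_hom F P)
    (fun M => fo_hom1 (fol_str M))
    (fun _ _ _ _ _ => @fo_homM _ _ _ _ _ _ _ _ _ _).

Inductive fol_sen (F P : nat -> Type) : Type :=
| fol_atom n (pi : P n) (t : 'I_n -> term F)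
| fol_and (r s : fol_sen F P)
| fol_not (r : fol_sen F P)
| fol_ex (r : fol_sen (add_var F) P).

Fixpoint fol_sat (F P : nat -> Type) (D : Type)
    (M : fo_str F P D) (rho : fol_sen F P) {struct rho} :
    Prop :=
  match rho with
  | fol_atom n pi t => sat_atom M pi t
  | fol_and r s => fol_sat M r /\ fol_sat M s
  | fol_not r => ~ fol_sat M r
  | fol_ex r => exists d : D, fol_sat (expand_var M d) r
  end.

Definition valuations (F P : nat -> Type) (X : Type) :
  functor (fol_cat F P) Sets :=
  @Functor (fol_cat F P) Sets (fun M => X -> fol_dom M)
    (fun M N h w => sval h \o w) (fun _ => erefl) (fun _ _ _ _ _ => erefl).

Definition open_models (F P : nat -> Type) (X : Type) : stratified_category :=
  StratifiedCategory (valuations F P X).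

Record ofol_signature := OFOLSignature {
  ofol_F : nat -> Type;
  ofol_P : nat -> Type;
  ofol_X : finType
}.

Definition ofol_sen (F P : nat -> Type) (X : Type) : Type :=
  fol_sen (add_consts F X) P.

Definition ofol_sat (F P : nat -> Type) (X : Type)
    (M : open_models F P X) (w : state M)
    (rho : ofol_sen F P X) : Prop :=
  fol_sat (fo_expand (fol_str M) w) rho.

Definition OFOL : stratified_institution :=
  @StratifiedInstitution ofol_signature
    (fun S => ofol_sen (ofol_F S) (ofol_P S) (ofol_X S))
    (fun S => open_models (ofol_F S) (ofol_P S) (ofol_X S))
    (fun S => @ofol_sat (ofol_F S) (ofol_P S) (ofol_X S)).

Definition power_const (F P : nat -> Type) (D : Type)
    (M : fo_str F P D) (X : Type) (i : F 0) : X -> D :=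
  fn (fo_power M X) i (@tup0 _).

Inductive mofol_sen (F P : nat -> Type) (X : Type) : Type :=
| mofol_atom n (pi : P n) (t : 'I_n -> term (add_consts F X))
| mofol_and (r s : mofol_sen F P X)
| mofol_not (r : mofol_sen F P X)
| mofol_ex (r : mofol_sen F P (option X))
| mofol_mod n (pi : P n.+1) (r : 'I_n -> mofol_sen F P X).

Fixpoint mofol_sat (F P : nat -> Type) (X D : Type)
    (M : fo_str F P D) (w : X -> D)
    (rho : mofol_sen F P X) {struct rho} : Prop :=
  match rho with
  | mofol_atom n pi t => sat_atom (fo_expand M w) pi t
  | mofol_and r s => mofol_sat M w r /\ mofol_sat M w s
  | mofol_not r => ~ mofol_sat M w r
  | mofol_ex r => exists w' : option X -> D,
      (forall x, w' (Some x) = w x) /\ mofol_sat M w' r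
  | mofol_mod n pi r => exists ws : 'I_n -> (X -> D),
      rl (fo_power M X) pi (tcons w ws) /\
      forall i, mofol_sat M (ws i) (r i)
  end.

Definition MOFOL : stratified_institution :=
  @StratifiedInstitution ofol_signature
    (fun S => mofol_sen (ofol_F S) (ofol_P S) (ofol_X S))
    (fun S => open_models (ofol_F S) (ofol_P S) (ofol_X S))
    (fun S M w rho => mofol_sat (fol_str M) w rho).

Inductive hofol_sen (F P : nat -> Type) (X : Type) : Type :=
| hofol_atom n (pi : P n) (t : 'I_n -> term (add_consts F X))
| hofol_and (r s : hofol_sen F P X)
| hofol_not (r : hofol_sen F P X)
| hofol_ex (r : hofol_sen F P (option X))
| hofol_nom (i : F 0)
| hofol_at (i : F 0) (r : hofol_sen F P X)
| hofol_nex (r : hofol_sen (add_var F) P X).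

Fixpoint hofol_sat (F P : nat -> Type) (X D : Type)
    (M : fo_str F P D) (w : X -> D)
    (rho : hofol_sen F P X) {struct rho} : Prop :=
  match rho with
  | hofol_atom n pi t => sat_atom (fo_expand M w) pi t
  | hofol_and r s => hofol_sat M w r /\ hofol_sat M w s
  | hofol_not r => ~ hofol_sat M w r
  | hofol_ex r => exists w' : option X -> D,
      (forall x, w' (Some x) = w x) /\ hofol_sat M w' r
  | hofol_nom i => power_const M (X := X) i = w
  | hofol_at i r => hofol_sat M (power_const M i) r
  | hofol_nex r => exists d : D, hofol_sat (expand_var M d) w r
  end.

Definition HOFOL : stratified_institution :=
  @StratifiedInstitution ofol_signature
    (fun S => hofol_sen (ofol_F S) (ofol_P S) (ofol_X S))
    (fun S => open_models (ofol_F S) (ofol_P S) (ofol_X S))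
    (fun S M w rho => hofol_sat (fol_str M) w rho).

Inductive hmofol_sen (F P : nat -> Type) (X : Type) : Type :=
| hmofol_atom n (pi : P n) (t : 'I_n -> term (add_consts F X))
| hmofol_and (r s : hmofol_sen F P X)
| hmofol_not (r : hmofol_sen F P X)
| hmofol_ex (r : hmofol_sen F P (option X))
| hmofol_mod n (pi : P n.+1) (r : 'I_n -> hmofol_sen F P X)
| hmofol_nom (i : F 0)
| hmofol_at (i : F 0) (r : hmofol_sen F P X)
| hmofol_nex (r : hmofol_sen (add_var F) P X).

Fixpoint hmofol_sat (F P : nat -> Type) (X D : Type)
    (M : fo_str F P D) (w : X -> D)
    (rho : hmofol_sen F P X) {struct rho} : Prop :=
  match rho with
  | hmofol_atom n pi t => sat_atom (fo_expand M w) pi t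
  | hmofol_and r s => hmofol_sat M w r /\ hmofol_sat M w s
  | hmofol_not r => ~ hmofol_sat M w r
  | hmofol_ex r => exists w' : option X -> D,
      (forall x, w' (Some x) = w x) /\ hmofol_sat M w' r
  | hmofol_mod n pi r => exists ws : 'I_n -> (X -> D),
      rl (fo_power M X) pi (tcons w ws) /\
      forall i, hmofol_sat M (ws i) (r i)
  | hmofol_nom i => power_const M (X := X) i = w
  | hmofol_at i r => hmofol_sat M (power_const M i) r
  | hmofol_nex r => exists d : D, hmofol_sat (expand_var M d) w r
  end.

Definition HMOFOL : stratified_institution :=
  @StratifiedInstitution ofol_signature
    (fun S => hmofol_sen (ofol_F S) (ofol_P S) (ofol_X S))
    (fun S => open_models (ofol_F S) (ofol_P S) (ofol_X S))
    (fun S M w rho => hmofol_sat (fol_str M) w rho).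

Variant logic : Set :=
| mpl | mfol | hpl | hfol | mmpl | mhpl | mmfol | mhfol | hhpl
| ofol | mofol | hofol | hmofol.

Definition institution_of (l : logic) : stratified_institution :=
  match l with
  | mpl => MPL | mfol => MFOL | hpl => HPL | hfol => HFOL
  | mmpl => MMPL | mhpl => MHPL | mmfol => MMFOL | mhfol => MHFOL
  | hhpl => HHPL
  | ofol => OFOL | mofol => MOFOL | hofol => HOFOL | hmofol => HMOFOL
  end.

(* Main.v *)
From mathcomp Require Import all_boot.
From mathcomp Require Import boolp classical_sets cardinality filter.
Require Import Defs.

Set Implicit Arguments.
Unset Strict Implicit.
Unset Printing Implicit Defensive.

Local Open Scope classical_set_scope.

(* Each model category is a category of structured sets, so an arbitrary
   F-product is isomorphic to a concrete one: its carriers are the sets of germs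
   modulo F of sections over members of F, its operations act on germs, and a
   relation holds of germs iff it holds of representing sections on a member
   of F.  For an ultrafilter each carrier is F-almost everywhere inhabited or
   F-almost everywhere empty; over a member J0 of F on which one alternative
   holds for every carrier, germs are represented by sections defined on all
   of J0.  With total representatives an expansion of the ultraproduct is
   represented by expansions of the factors, and Los's theorem goes through by
   induction on sentences.  The model categories have all F-products, so the
   compactness properties follow by taking an ultraproduct over the finite
   subsets of the given set of sentences; the local compactness of I uses
   preservation by ultrafactors in place of negation. *)

(** * F-products in a category *)

(** The obstacle is that sets of worlds and carriers may be empty. One empty factor empties the
    product over all indices, while the ultraproduct may still have states; so a state need not be
    the germ of a section over the whole index set, and where there are two carriers either may be
    empty without the other. Hence the passage to a member of [F] and to the ultrafilter that [F]
    leaves on it. Atoms are decided by the factors because arrows preserve relations without having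
    to reflect them: the colimit property forces the least relations on germs, and a tuple is
    related there only if it is related already in some product. Quantifiers change the signature,
    and showing that an expanded ultraproduct is an ultraproduct of expanded factors would need a
    new universal property for each quantifier. The induction therefore forgets the universal
    property: it relates a model [N] to a family of models through a choice of representatives
    alone, compatible with the atomic structure almost everywhere, and the same choice serves all
    expansions. *)

Definition is_fproduct (C : category) (T : Type) (F : set_system T)
    (M : T -> C) (MJ : forall J : set T, F J -> C)
    (p : forall (J : set T) (FJ : F J) i, J i -> hom (MJ J FJ) (M i))
    (N : C) (mu : forall (J : set T) (FJ : F J), hom (MJ J FJ) N) : Prop :=
  (forall (J : set T) (FJ : F J), is_product (p J FJ)) /\ is_colimit p mu.

Definition preserves_fproducts (C D : category) (G : functor C D) : Prop :=
  forall (T : Type) (F : set_system T), Filter F ->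
  forall (M : T -> C) (U : fproduct F M),
    is_fproduct (fun J FJ i Ji => fmap G (@fp_proj _ _ _ _ U J FJ i Ji))
                (fun J FJ => fmap G (fp_in U FJ)).

Definition has_fproducts (C : category) : Prop :=
  forall (T : Type) (F : set_system T), Filter F ->
  forall M : T -> C, inhabited (fproduct F M).

Definition fproduct_image (C D : category) (G : functor C D) T
    (F : set_system T) (M : T -> C) (U : fproduct F M)
    (GU : is_fproduct (fun J FJ i Ji => fmap G (@fp_proj _ _ _ _ U J FJ i Ji))
                      (fun J FJ => fmap G (fp_in U FJ))) :
  fproduct F (fun i => G (M i)) :=
  @FProduct D T F (fun i => G (M i)) _ _ (proj1 GU) _ _ (proj2 GU).

Lemma product_hom_eq (C : category) (T : Type) (J : set T) (M : T -> C) (N : C)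
    (p : forall i, J i -> hom N (M i)) (X : C) (f g : hom X N) :
  is_product p -> (forall i Ji, cmp f (p i Ji) = cmp g (p i Ji)) -> f = g.
Proof.
move=> pP fg; have [h [_ hu]] := pP X (fun i Ji => cmp g (p i Ji)).
by rewrite -(hu f) // -(hu g).
Qed.

Lemma colimit_hom_eq (C : category) (T : Type) (F : set_system T) (M : T -> C)
    (MJ : forall J : set T, F J -> C)
    (p : forall (J : set T) (FJ : F J) i, J i -> hom (MJ J FJ) (M i))
    (N : C) (mu : forall (J : set T) (FJ : F J), hom (MJ J FJ) N)
    (X : C) (f g : hom N X) :
  is_colimit p mu -> (forall J FJ, cmp (mu J FJ) f = cmp (mu J FJ) g) -> f = g.
Proof.
move=> [muc muP] fg.
have nuc : is_cocone p (fun J FJ => cmp (mu J FJ) g).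
  by move=> J K FJ FK KJ h hc; rewrite cmpA (muc _ _ _ _ _ _ hc).
have [h [_ hu]] := muP X _ nuc.
by rewrite -(hu f) // -(hu g).
Qed.

(** The comparison maps between products commute with canonical projections, so composing them with
    the injections of [V] gives a cocone, which factors through the colimit of [U]. *)
Lemma fproduct_hom (C : category) (T : Type) (F : set_system T) (M : T -> C)
    (U V : fproduct F M) :
  exists (phiJ : forall J (FJ : F J), hom (fp_prod U FJ) (fp_prod V FJ))
         (phi : hom (fp_obj U) (fp_obj V)),
    (forall J (FJ : F J) i (Ji : J i),
       cmp (phiJ J FJ) (fp_proj V FJ Ji) = fp_proj U FJ Ji) /\
    (forall J (FJ : F J), cmp (fp_in U FJ) phi = cmp (phiJ J FJ) (fp_in V FJ)).
Proof.
have ex J (FJ : F J) : exists h : hom (fp_prod U FJ) (fp_prod V FJ),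
    forall i (Ji : J i), cmp h (fp_proj V FJ Ji) = fp_proj U FJ Ji.
  by have [h [hP _]] := fp_prodP V FJ (fun i Ji => fp_proj U FJ Ji); exists h.
pose fJ J (FJ : F J) := projT1 (cid (ex J FJ)).
have fJP J (FJ : F J) i (Ji : J i) :
  cmp (fJ J FJ) (fp_proj V FJ Ji) = fp_proj U FJ Ji by exact:
    (projT2 (cid (ex J FJ))).
have nuc : is_cocone (fp_proj U) (fun J FJ => cmp (fJ J FJ) (fp_in V FJ)).
  move=> J K FJ FK KJ h hc.
  (* The cocone law of [V] needs a canonical projection between the products of [V]; the given [h]
     lives between those of [U]. *)
  have [h' [h'c _]] := fp_prodP V FK (fun i Ki => fp_proj V FJ (KJ i Ki)).
  have -> : fp_in V FJ = cmp h' (fp_in V FK).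
    by rewrite ((fp_colimP V).1 J K FJ FK KJ h').
  rewrite !cmpA; congr (cmp _ _); apply: (product_hom_eq (fp_prodP V FK)).
  by move=> i Ki; rewrite -!cmpA fJP h'c fJP hc.
have [phi [phiP _]] := (fp_colimP U).2 _ _ nuc.
by exists fJ, phi.
Qed.

Lemma fproduct_iso (C : category) (T : Type) (F : set_system T) (M : T -> C)
    (U V : fproduct F M) :
  exists (phiJ : forall J (FJ : F J), hom (fp_prod U FJ) (fp_prod V FJ))
         (phi : hom (fp_obj U) (fp_obj V))
         (psiJ : forall J (FJ : F J), hom (fp_prod V FJ) (fp_prod U FJ))
         (psi : hom (fp_obj V) (fp_obj U)),
    [/\ forall J (FJ : F J) i (Ji : J i),
          cmp (phiJ J FJ) (fp_proj V FJ Ji) = fp_proj U FJ Ji,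
        forall J (FJ : F J), cmp (fp_in U FJ) phi = cmp (phiJ J FJ)
          (fp_in V FJ),
        forall J (FJ : F J), cmp (phiJ J FJ) (psiJ J FJ) = idm _ /\
                             cmp (psiJ J FJ) (phiJ J FJ) = idm _,
        cmp phi psi = idm _ & cmp psi phi = idm _].
Proof.
have [fJ [f [fJP fP]]] := fproduct_hom U V.
have [gJ [g [gJP gP]]] := fproduct_hom V U.
have fgJ J (FJ : F J) : cmp (fJ J FJ) (gJ J FJ) = idm _.
  apply: (product_hom_eq (fp_prodP U FJ)) => i Ji.
  by rewrite -cmpA gJP fJP cmp1m.
have gfJ J (FJ : F J) : cmp (gJ J FJ) (fJ J FJ) = idm _.
  apply: (product_hom_eq (fp_prodP V FJ)) => i Ji.
  by rewrite -cmpA fJP gJP cmp1m.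
exists fJ, f, gJ, g; split=> //.
- apply: (colimit_hom_eq (fp_colimP U)) => J FJ.
  by rewrite cmpA fP -cmpA gP cmpA fgJ cmp1m cmpm1.
- apply: (colimit_hom_eq (fp_colimP V)) => J FJ.
  by rewrite cmpA gP -cmpA fP cmpA gfJ cmp1m cmpm1.
Qed.

(** Compatible isomorphisms carry both universal properties from [V] to the candidate. The candidate
    is unbundled because it will be the image of an F-product under a functor, not yet known to be
    an F-product itself. *)
Lemma is_fproduct_iso (C : category) (T : Type) (F : set_system T) (M : T -> C)
    (V : fproduct F M) (MJ : forall J : set T, F J -> C)
    (p : forall (J : set T) (FJ : F J) i, J i -> hom (MJ J FJ) (M i))
    (N : C) (mu : forall (J : set T) (FJ : F J), hom (MJ J FJ) N)
    (phiJ : forall J (FJ : F J), hom (MJ J FJ) (fp_prod V FJ))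
    (phi : hom N (fp_obj V))
    (psiJ : forall J (FJ : F J), hom (fp_prod V FJ) (MJ J FJ))
    (psi : hom (fp_obj V) N) :
  (forall J (FJ : F J) i (Ji : J i),
     cmp (phiJ J FJ) (fp_proj V FJ Ji) = p J FJ i Ji) ->
  (forall J (FJ : F J), cmp (mu J FJ) phi = cmp (phiJ J FJ) (fp_in V FJ)) ->
  (forall J (FJ : F J), cmp (phiJ J FJ) (psiJ J FJ) = idm _ /\
                        cmp (psiJ J FJ) (phiJ J FJ) = idm _) ->
  cmp phi psi = idm _ -> cmp psi phi = idm _ ->
  is_fproduct p mu.
Proof.
move=> fJP fP fgJ fg gf.
have gJP J (FJ : F J) i (Ji : J i) :
    cmp (psiJ J FJ) (p J FJ i Ji) = fp_proj V FJ Ji.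
  by rewrite -fJP cmpA (fgJ J FJ).2 cmp1m.
have gP J (FJ : F J) : cmp (fp_in V FJ) psi = cmp (psiJ J FJ) (mu J FJ).
  by rewrite -[mu J FJ]cmpm1 -fg [cmp (mu J FJ) _]cmpA fP !cmpA (fgJ J FJ).2
    cmp1m.
have pP J (FJ : F J) : is_product (p J FJ).
  move=> X q; have [h [hP hu]] := fp_prodP V FJ q.
  exists (cmp h (psiJ J FJ)); split=> [i Ji|h' h'P].
    by rewrite -cmpA gJP hP.
  rewrite (hu (cmp h' (phiJ J FJ))); last by move=> i Ji; rewrite -cmpA fJP h'P.
  by rewrite -cmpA (fgJ J FJ).1 cmpm1.
split=> //; split=> [J K FJ FK KJ h hc|X nu nuc].
  (* Conjugating [h] by the isomorphisms yields a canonical projection between the products of [V],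
     to which the cocone law of [V] applies. *)
  have E : cmp (cmp (psiJ J FJ) (cmp h (phiJ K FK))) (fp_in V FK) = fp_in V FJ.
    apply: ((fp_colimP V).1 J K FJ FK KJ) => i Ki.
    by rewrite -!cmpA fJP hc gJP.
  rewrite -[mu K FK]cmpm1 -fg [cmp (mu K FK) _]cmpA fP.
  rewrite -[mu J FJ]cmpm1 -fg [cmp (mu J FJ) _]cmpA fP -E.
  by rewrite !cmpA (fgJ J FJ).1 cmp1m.
have nuc' : is_cocone (fp_proj V) (fun J FJ => cmp (psiJ J FJ) (nu J FJ)).
  move=> J K FJ FK KJ h hc.
  rewrite -(nuc J K FJ FK KJ (cmp (phiJ J FJ) (cmp h (psiJ K FK)))).
    by rewrite !cmpA (fgJ J FJ).2 cmp1m.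
  by move=> i Ki; rewrite -!cmpA gJP hc fJP.
have [h [hP hu]] := (fp_colimP V).2 _ _ nuc'.
exists (cmp phi h); split=> [J FJ|h' h'P].
  by rewrite cmpA fP -cmpA hP cmpA (fgJ J FJ).1 cmp1m.
rewrite (hu (cmp psi h')); first by rewrite cmpA fg cmp1m.
by move=> J FJ; rewrite cmpA gP -cmpA h'P.
Qed.

(** Functors preserve isomorphisms and any two F-products of a family are isomorphic, so
    preservation need only be checked on one conveniently chosen F-product per family. *)
Lemma preserves_of_some_fproduct (C D : category) (G : functor C D) :
  (forall T (F : set_system T), Filter F -> forall M : T -> C,
     exists U : fproduct F M,
       is_fproduct (fun J FJ i Ji => fmap G (@fp_proj _ _ _ _ U J FJ i Ji))
                   (fun J FJ => fmap G (fp_in U FJ))) ->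
  preserves_fproducts G.
Proof.
move=> H T F FF M U; have [V GV] := H T F FF M.
have [fJ [f [gJ [g [fJP fP fgJ fg gf]]]]] := fproduct_iso U V.
apply: (@is_fproduct_iso D T F (fun i => G (M i)) (fproduct_image GV) _ _ _ _
  (fun J FJ => fmap G (fJ J FJ)) (fmap G f)
  (fun J FJ => fmap G (gJ J FJ)) (fmap G g)) => /=.
- by move=> J FJ i Ji; rewrite -fmapM fJP.
- by move=> J FJ; rewrite -!fmapM fP.
- by move=> J FJ; rewrite -!fmapM (fgJ J FJ).1 (fgJ J FJ).2 !fmap1.
- by rewrite -fmapM fg fmap1.
- by rewrite -fmapM gf fmap1.
Qed.

Lemma preserves_fproducts_comp (C D E : category) (G : functor D E)
    (H : functor C D) :
  preserves_fproducts G -> preserves_fproducts H ->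
  preserves_fproducts (functor_comp G H).
Proof.
move=> Gp Hp T F FF M U.
exact: (Gp T F FF _ (fproduct_image (Hp T F FF M U))).
Qed.

(** * Lifting F-products along a forgetful functor *)

Section StructuredLift.
Context (C : category) (O : Type) (u : O -> C).
Context (P : forall A B, hom (u A) (u B) -> Prop).
Context (P1 : forall A, @P A A (idm (u A))).
Context (PM : forall A B D (f : hom (u A) (u B)) (g : hom (u B) (u D)),
  P f -> P g -> @P A D (cmp f g)).
Context (T : Type) (F : set_system T) (M : T -> O).
Context (A : forall J : set T, F J -> O).
Context (p : forall (J : set T) (FJ : F J) i, J i -> hom (u (A FJ)) (u (M i))).
Context (N : O) (mu : forall (J : set T) (FJ : F J), hom (u (A FJ)) (u N)).
Hypothesis H : @is_fproduct C T F (fun i => u (M i)) _ (@p) _ (@mu).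
Hypothesis Pp : forall J FJ i Ji, P (@p J FJ i Ji).
(** The structure on each product is initial for the projections, and by [mu_final] the structure on
    [N] is final for the injections. For relations these are the componentwise relation and the
    union of the images. *)
Hypothesis p_initial : forall J FJ X (h : hom (u X) (u (@A J FJ))),
  (forall i Ji, @P X (M i) (cmp h (@p J FJ i Ji))) -> P h.
Hypothesis Pmu : forall J FJ, P (@mu J FJ).
Hypothesis mu_final : forall X (h : hom (u N) (u X)),
  (forall J FJ, @P (A FJ) X (cmp (@mu J FJ) h)) -> P h.

Let sp J (FJ : F J) i (Ji : J i) :
  hom (A FJ : structured P1 PM) (M i : structured P1 PM) :=
  exist _ _ (Pp FJ Ji).
Let smu J (FJ : F J) : hom (A FJ : structured P1 PM) (N : structured P1 PM) :=
  exist _ _ (Pmu FJ).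

Lemma structured_prodP J (FJ : F J) :
  @is_product (structured P1 PM) T J M _ (@sp J FJ).
Proof.
move=> X q; have [h [hP hu]] := H.1 J FJ _ (fun i Ji => sval (q i Ji)).
have Ph : P h by apply: p_initial => i Ji; rewrite hP; exact: svalP.
exists (exist _ h Ph); split=> [i Ji|[h' Ph'] h'P].
  by case E: (q i Ji) => [f Pf]; apply: eq_exist => /=; rewrite hP E.
apply: eq_exist; apply: hu => i Ji.
by rewrite -(h'P i Ji).
Qed.

Lemma structured_colimP :
  @is_colimit (structured P1 PM) T F M _ (@sp) _ (@smu).
Proof.
split=> [J K FJ FK KJ [h Ph] hc|X nu nuc].
  apply: eq_exist; apply: (H.2.1 J K FJ FK KJ) => i Ki.
  exact: (congr1 sval (hc i Ki)).
have nuc' : is_cocone (@p) (fun J FJ => sval (nu J FJ)).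
  move=> J K FJ FK KJ h hc.
  (* A cocone of structured arrows is constrained only at structured canonical projections;
     initiality makes every underlying canonical projection one of these. *)
  have Ph : P h by apply: p_initial => i Ki; rewrite hc.
  rewrite -(nuc J K FJ FK KJ (exist _ h Ph)) // => i Ki.
  by apply: eq_exist; exact: hc.
have [h [hP hu]] := H.2.2 _ _ nuc'.
have Ph : P h by apply: mu_final => J FJ; rewrite hP; exact: svalP.
exists (exist _ h Ph); split=> [J FJ|[h' Ph'] h'P].
  by case E: (nu J FJ) => [f Pf]; apply: eq_exist => /=; rewrite hP E.
apply: eq_exist; apply: hu => J FJ.
by rewrite -(h'P J FJ).
Qed.

Definition structured_fproduct : @fproduct (structured P1 PM) T F M :=
  FProduct structured_prodP structured_colimP.

End StructuredLift.

(** * Componentwise F-products in a product of two categories *)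

Section ProdCat.
Context (C D : category) (T : Type) (F : set_system T).
Context (M : T -> prod_cat C D).
Context (U : fproduct F (fun i => (M i).1)) (V : fproduct F (fun i => (M i).2)).

Lemma prod_cat_is_fproduct :
  @is_fproduct (prod_cat C D) T F M (fun J FJ => (fp_prod U FJ, fp_prod V FJ))
    (fun J FJ i Ji => (fp_proj U FJ Ji, fp_proj V FJ Ji)) (fp_obj U, fp_obj V)
    (fun J FJ => (fp_in U FJ, fp_in V FJ)).
Proof.
have pP J (FJ : F J) : @is_product (prod_cat C D) T J M
    (fp_prod U FJ, fp_prod V FJ)
    (fun i Ji => (fp_proj U FJ Ji, fp_proj V FJ Ji)).
  move=> [X Y] q.
  have [f [fP fu]] := fp_prodP U FJ (fun i Ji => (q i Ji).1).
  have [g [gP gu]] := fp_prodP V FJ (fun i Ji => (q i Ji).2).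
  exists (f, g); split=> [i Ji|[f' g'] fgP].
    by rewrite [RHS]surjective_pairing -fP -gP.
  by congr pair; [apply: fu|apply: gu] => i Ji; rewrite -fgP.
split=> //; split=> [J K FJ FK KJ [f g] hc|[X Y] nu nuc].
  congr pair.
    by apply: ((fp_colimP U).1 J K FJ FK KJ) => i Ki; exact:
      (congr1 fst (hc i Ki)).
  by apply: ((fp_colimP V).1 J K FJ FK KJ) => i Ki; exact:
    (congr1 snd (hc i Ki)).
(* A cocone in the product category is constrained only at pairs of canonical projections, so a
   canonical projection in one coordinate needs a partner in the other, which the product property
   supplies. *)
have canon (J K : set T) (FJ : F J) (FK : F K) (KJ : K `<=` J) :
    exists f g, canonical_projection (fp_proj U) (FJ := FJ) (FK := FK) KJ f /\
      canonical_projection (fp_proj V) (FJ := FJ) (FK := FK) KJ g.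
  have [f [fP _]] := fp_prodP U FK (fun i Ki => fp_proj U FJ (KJ i Ki)).
  by have [g [gP _]] := fp_prodP V FK (fun i Ki => fp_proj V FJ (KJ i Ki));
    exists f, g.
have nuc1 : is_cocone (fp_proj U) (fun J FJ => (nu J FJ).1).
  move=> J K FJ FK KJ f fc; have [_ [g [_ gc]]] := canon J K FJ FK KJ.
  rewrite -(nuc J K FJ FK KJ (f, g)) // => i Ki.
  by congr pair; [exact: fc|exact: gc].
have nuc2 : is_cocone (fp_proj V) (fun J FJ => (nu J FJ).2).
  move=> J K FJ FK KJ g gc; have [f [_ [fc _]]] := canon J K FJ FK KJ.
  rewrite -(nuc J K FJ FK KJ (f, g)) // => i Ki.
  by congr pair; [exact: fc|exact: gc].
have [f [fP fu]] := (fp_colimP U).2 _ _ nuc1.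
have [g [gP gu]] := (fp_colimP V).2 _ _ nuc2.
exists (f, g); split=> [J FJ|[f' g'] fgP].
  by rewrite [RHS]surjective_pairing -fP -gP.
by congr pair; [apply: fu|apply: gu] => J FJ; rewrite -fgP.
Qed.

End ProdCat.

Definition snd_functor (C D : category) : functor (prod_cat C D) D :=
  @Functor (prod_cat C D) D snd (fun _ _ f => f.2)
    (fun _ => erefl) (fun _ _ _ _ _ => erefl).

(** F-products in both categories enter because the check is made on the componentwise F-product,
    whose first coordinate is an F-product by construction. *)
Lemma fst_preserves_fproducts (C D : category) :
  has_fproducts C -> has_fproducts D -> preserves_fproducts (fst_functor C D).
Proof.
move=> hC hD; apply: preserves_of_some_fproduct => T F FF M.
have [U] := hC T F FF (fun i => (M i).1); have [V] := hD T F FF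
  (fun i => (M i).2).
have UV := prod_cat_is_fproduct U V.
by exists (FProduct UV.1 UV.2); split; [exact: fp_prodP|exact: fp_colimP].
Qed.

Lemma snd_preserves_fproducts (C D : category) :
  has_fproducts C -> has_fproducts D -> preserves_fproducts (snd_functor C D).
Proof.
move=> hC hD; apply: preserves_of_some_fproduct => T F FF M.
have [U] := hC T F FF (fun i => (M i).1); have [V] := hD T F FF
  (fun i => (M i).2).
have UV := prod_cat_is_fproduct U V.
by exists (FProduct UV.1 UV.2); split; [exact: fp_prodP|exact: fp_colimP].
Qed.

(** * F-products of sets *)

Section ReducedProducts.
Context (T : Type) (F : set_system T).

(* Elementwise description of F-products of sets: MJ consists of the sections
   of X over J, and N of the germs of such sections. *)
Record reduced_product (X : T -> Type) (XJ : forall J : set T, F J -> Type)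
    (p : forall (J : set T) (FJ : F J) i, J i -> XJ J FJ -> X i)
    (N : Type) (mu : forall (J : set T) (FJ : F J), XJ J FJ -> N) : Prop :=
  ReducedProduct {
    rp_inj : forall J (FJ : F J) k l,
      (forall i (Ji : J i), p J FJ i Ji k = p J FJ i Ji l) -> k = l;
    rp_section : forall J (FJ : F J) (s : forall i, J i -> X i),
      exists k, forall i (Ji : J i), p J FJ i Ji k = s i Ji;
    rp_surj : forall y, exists J (FJ : F J) k, mu J FJ k = y;
    rp_eq : forall J (FJ : F J) k K (FK : F K) l,
      mu J FJ k = mu K FK l <->
      F [set i | exists (Ji : J i) (Ki : K i), p J FJ i Ji k = p K FK i Ki l]
  }.

(** A closure property in place of a [finType] structure: quantification over an object variable
    turns the type [X] of variables into [option X], and the induction on sentences meets plain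
    types only. *)
Definition filter_finite (A : Type) : Prop :=
  forall B : A -> set T, (forall a, F (B a)) -> F [set i | forall a, B a i].

Lemma filter_finite_finType {FF : Filter F} (A : finType) : filter_finite A.
Proof.
by move=> B FB; exact: filter_forall.
Qed.

Lemma filter_finite_option {FF : Filter F} (A : Type) :
  filter_finite A -> filter_finite (option A).
Proof.
move=> fA B FB; apply: filterS (filterI (FB None) (fA _ (fun a => FB
  (Some a)))).
by move=> i [B0 B1] [a|].
Qed.

Section Restriction.
Context (FF : Filter F).
Context (X : T -> Type) (XJ : forall J : set T, F J -> Type).
Context (p : forall (J : set T) (FJ : F J) i, J i -> XJ FJ -> X i).
Context (N : Type) (mu : forall (J : set T) (FJ : F J), XJ FJ -> N).
Hypothesis H : reduced_product (@p) (@mu).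

Lemma rp_restrict J K (FJ : F J) (FK : F K) (k : XJ FJ) : K `<=` J ->
  exists2 l : XJ FK, mu l = mu k &
    forall i (Ki : K i) (Ji : J i), p Ki l = p Ji k.
Proof.
move=> KJ; have [l lP] := rp_section H FK (fun i Ki => p (KJ i Ki) k).
exists l; last by move=> i Ki Ji; rewrite lP; congr p; exact: Prop_irrelevance.
by apply/(rp_eq H); apply: (filterS _ FK) => i Ki; exists Ki, (KJ i Ki).
Qed.

End Restriction.

Section OpLift.
Context (FF : Filter F).
Context (X : T -> Type) (XJ : forall J : set T, F J -> Type).
Context (p : forall (J : set T) (FJ : F J) i, J i -> XJ FJ -> X i).
Context (N : Type) (mu : forall (J : set T) (FJ : F J), XJ FJ -> N).
Hypothesis H : reduced_product (@p) (@mu).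
Context (Y : T -> Type) (YJ : forall J : set T, F J -> Type).
Context (q : forall (J : set T) (FJ : F J) i, J i -> YJ FJ -> Y i).
Context (E : Type) (nu : forall (J : set T) (FJ : F J), YJ FJ -> E).
Hypothesis H' : reduced_product (@q) (@nu).

(** Applying [o] pointwise to sections respects agreement on a member of [F], hence descends to
    germs. With tuples for [X] this yields the function symbols of an F-product, and with [unit] for
    [X] its constants and nominals. *)
Lemma rp_op (o : forall i, X i -> Y i) :
  exists (oJ : forall J (FJ : F J), XJ FJ -> YJ FJ) (oN : N -> E),
    (forall J (FJ : F J) k i (Ji : J i), q Ji (oJ J FJ k) = o i (p Ji k)) /\
    (forall J (FJ : F J) k, nu (oJ J FJ k) = oN (mu k)).
Proof.
have exJ J (FJ : F J) (k : XJ FJ) :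
    exists y : YJ FJ, forall i (Ji : J i), q Ji y = o i (p Ji k).
  exact: (rp_section H' FJ (fun i Ji => o i (p Ji k))).
pose oJ J (FJ : F J) k := projT1 (cid (exJ J FJ k)).
have oJP J (FJ : F J) k i (Ji : J i) : q Ji (oJ J FJ k) = o i (p Ji k).
  exact: (projT2 (cid (exJ J FJ k))).
have exN (y : N) : exists z, forall J (FJ : F J) k, mu k = y -> nu (oJ J FJ k) =
  z.
  have [J [FJ [k <-]]] := rp_surj H y.
  exists (nu (oJ J FJ k)) => K FK l /(rp_eq H) kl; apply/(rp_eq H').
  apply: filterS kl => i [Ki [Ji e]]; exists Ki, Ji.
  by rewrite !oJP e.
have [oN oNP] := choice exN.
by exists oJ, oN; split=> // J FJ k; exact: oNP.
Qed.

Lemma rp_pair : reduced_product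
  (fun J (FJ : F J) i (Ji : J i) k => (p Ji k.1, q Ji k.2))
  (fun J (FJ : F J) k => (mu (FJ := FJ) k.1, nu (FJ := FJ) k.2)).
Proof.
split.
- move=> J FJ [k1 k2] [l1 l2] /= kl; congr pair.
    by apply: (rp_inj H) => i Ji; case: (kl i Ji).
  by apply: (rp_inj H') => i Ji; case: (kl i Ji).
- move=> J FJ s; have [k kP] := rp_section H FJ (fun i Ji => (s i Ji).1).
  have [l lP] := rp_section H' FJ (fun i Ji => (s i Ji).2).
  by exists (k, l) => i Ji /=; rewrite kP lP -surjective_pairing.
- move=> [y z]; have [J [FJ [k <-]]] := rp_surj H y.
  have [K [FK [l <-]]] := rp_surj H' z.
  have FJK : F (J `&` K) by exact: filterI.
  have [k' k'P _] := rp_restrict FF H FJK k (@subIsetl _ J K).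
  have [l' l'P _] := rp_restrict FF H' FJK l (@subIsetr _ J K).
  by exists _, FJK, (k', l'); rewrite /= k'P l'P.
- move=> J FJ [k1 k2] K FK [l1 l2] /=; split.
    move=> [/(rp_eq H) kl1 /(rp_eq H') kl2].
    apply: filterS (filterI kl1 kl2) => i [[Ji [Ki e]] [Ji' [Ki' e']]].
    exists Ji, Ki; congr pair => //.
    by rewrite (Prop_irrelevance Ji Ji') (Prop_irrelevance Ki Ki').
  move=> kl; congr pair; [apply/(rp_eq H)|apply/(rp_eq H')];
    by apply: filterS kl => i [Ji [Ki []]]; exists Ji, Ki.
Qed.

(** Finiteness gives the germs of a tuple a common domain, and turns coordinatewise agreement of two
    tuples into agreement on one member of [F]. *)
Lemma rp_power (A : Type) : filter_finite A -> reduced_product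
  (fun J (FJ : F J) i (Ji : J i) (k : A -> XJ FJ) => p Ji \o k)
  (fun J (FJ : F J) k => mu (FJ := FJ) \o k).
Proof.
move=> fA; split.
- move=> J FJ k l kl; apply/funext => a; apply: (rp_inj H) => i Ji.
  exact: (congr1 (@^~ a) (kl i Ji)).
- move=> J FJ s.
  have [k kP] := choice (fun a => rp_section H FJ (fun i Ji => s i Ji a)).
  by exists k => i Ji; apply/funext => a /=; rewrite kP.
- move=> y.
  pose J a := projT1 (cid (rp_surj H (y a))).
  have JP a : exists (FJ : F (J a)) k, mu (FJ := FJ) k = y a.
    exact: (projT2 (cid (rp_surj H (y a)))).
  have FI : F [set i | forall a, J a i].
    by apply: fA => a; have [FJ _] := JP a.
  have /choice [k kP] : forall a, exists k, mu (FJ := FI) k = y a.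
    move=> a; have [FJ [k <-]] := JP a.
    have JI : [set i | forall a, J a i] `<=` J a by move=> i; exact.
    by have [l lP _] := rp_restrict FF H FI k JI; exists l.
  by exists _, FI, k; apply/funext => a /=; rewrite kP.
- move=> J FJ k K FK l; split.
    move=> kl; have : F [set i | forall a,
        exists (Ji : J i) (Ki : K i), p Ji (k a) = p Ki (l a)].
      by apply: fA => a; apply/(rp_eq H); exact: (congr1 (@^~ a) kl).
    move=> e; apply: filterS (filterI (filterI FJ FK) e) => i [[Ji Ki] {}e].
    exists Ji, Ki; apply/funext => a /=; have [Ji' [Ki']] := e a.
    by rewrite (Prop_irrelevance Ji Ji') (Prop_irrelevance Ki Ki').
  move=> e; apply/funext => a; apply/(rp_eq H); apply: filterS e.
  by move=> i [Ji [Ki e]]; exists Ji, Ki; exact: (congr1 (@^~ a) e).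
Qed.

End OpLift.

Lemma rp_unit {FF : Filter F} : reduced_product
  (X := fun=> unit) (fun J (FJ : F J) i (Ji : J i) (k : unit) => tt) (N := unit)
  (fun J (FJ : F J) (k : unit) => tt).
Proof.
split.
- by move=> J FJ [] [].
- by move=> J FJ s; exists tt => i Ji; case: (s i Ji).
- by move=> []; exists setT, filterT, tt.
- move=> J FJ k K FK l; split=> // _.
  by apply: filterS (filterI FJ FK) => i [Ji Ki]; exists Ji, Ki.
Qed.

End ReducedProducts.

(** Test objects replace elements: maps from [unit] into a product detect its sections, and maps
    from the colimit into [Prop] detect which germs exist and which of them coincide. *)
Lemma sets_reduced_product (T : Type) (F : set_system T) (M : T -> Sets)
    (U : @fproduct Sets T F M) : Filter F ->
  reduced_product (fp_proj U) (fp_in U).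
Proof.
move=> FF.
have inj J (FJ : F J) k l :
    (forall i (Ji : J i), fp_proj U FJ Ji k = fp_proj U FJ Ji l) -> k = l.
  move=> kl; have := @product_hom_eq Sets _ _ _ _ _ unit (fun=> k) (fun=> l)
    (fp_prodP U FJ).
  move=> /(_ _)/(congr1 (@^~ tt)); apply => i Ji.
  by apply/funext => -[] /=.
have sec J (FJ : F J) (s : forall i, J i -> M i) :
    exists k, forall i (Ji : J i), fp_proj U FJ Ji k = s i Ji.
  have [h [hP _]] := fp_prodP U FJ (X := unit : Sets) (fun i Ji _ => s i Ji).
  by exists (h tt) => i Ji; exact: (congr1 (@^~ tt) (hP i Ji)).
have agree J (FJ : F J) k K (FK : F K) l :
    F [set i | exists (Ji : J i) (Ki : K i),
         fp_proj U FJ Ji k = fp_proj U FK Ki l] ->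
    fp_in U FJ k = fp_in U FK l.
  (* Both sections have the same restriction to the set [A] where they agree, and the cocone law
     identifies the germ of each with the germ of that restriction. *)
  set A := [set i | _] => FA.
  have AJ : A `<=` J by move=> i [].
  have AK : A `<=` K by move=> i [? []].
  have [f [fP _]] := fp_prodP U FA (fun i Ai => fp_proj U FJ (AJ i Ai)).
  have [g [gP _]] := fp_prodP U FA (fun i Ai => fp_proj U FK (AK i Ai)).
  rewrite -((fp_colimP U).1 _ _ FJ FA AJ f fP)
    -((fp_colimP U).1 _ _ FK FA AK g gP).
  rewrite /=; congr (fp_in U FA _); apply: inj => i Ai.
  have /= -> := congr1 (@^~ k) (fP i Ai); have /= -> := congr1 (@^~ l)
    (gP i Ai).
  have [Ji [Ki]] := Ai.
  by rewrite (Prop_irrelevance (AJ i Ai) Ji) (Prop_irrelevance (AK i Ai) Ki).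
split=> //.
- move=> y.
  (* Two maps to Prop that agree along the colimit cocone are equal. *)
  have e : (fun y => exists J (FJ : F J) k, fp_in U FJ k = y) = (fun=> True).
    apply: (@colimit_hom_eq Sets _ _ _ _ _ _ _ (Prop : Sets) _ _ (fp_colimP U)).
    move=> J FJ; apply/funext => k /=.
    by apply/propext; split=> // _; exists J, FJ, k.
  by move: (congr1 (@^~ y) e) => /= ->.
- move=> J FJ k K FK l; split; last exact: agree.
  (* "Eventually equal to k" is a cocone with values in Prop. *)
  pose nu L (FL : F L) (m : fp_prod U FL) : Prop :=
    F [set i | exists (Ji : J i) (Li : L i),
         fp_proj U FJ Ji k = fp_proj U FL Li m].
  have nuc : @is_cocone Sets T F M _ (fp_proj U) (Prop : Sets) nu.
    move=> L L' FL FL' LL h hc; apply/funext => m /=; apply/propext.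
    split; rewrite /nu => e; apply: filterS (filterI e FL').
      move=> i [[Ji [L'i ki]] _]; exists Ji, (LL i L'i); rewrite ki.
      exact: (congr1 (@^~ m) (hc i L'i)).
    move=> i [[Ji [Li ki]] L'i]; exists Ji, L'i.
    rewrite ki (Prop_irrelevance Li (LL i L'i)).
    exact: (esym (congr1 (@^~ m) (hc i L'i))).
  have [h [hP _]] := (fp_colimP U).2 _ _ nuc.
  move=> kl; have /= hk := congr1 (@^~ k) (hP J FJ).
  have /= hl := congr1 (@^~ l) (hP K FK).
  have : nu J FJ k by apply: (filterS _ FJ) => i Ji; exists Ji, Ji.
  by rewrite -hk kl hl.
Qed.

Lemma reduced_product_is_fproduct (T : Type) (F : set_system T)
    (X : T -> Type) (XJ : forall J : set T, F J -> Type)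
    (p : forall (J : set T) (FJ : F J) i, J i -> XJ J FJ -> X i)
    (N : Type) (mu : forall (J : set T) (FJ : F J), XJ J FJ -> N) : Filter F ->
  reduced_product p mu -> @is_fproduct Sets T F X XJ p N mu.
Proof.
move=> FF H; have pP J (FJ : F J) : @is_product Sets T J X (XJ J FJ) (p J FJ).
  move=> Y q; have [h hP] := choice (fun y => rp_section H FJ (fun i Ji => q i
    Ji y)).
  exists h; split=> [i Ji|h' h'P]; first by apply/funext => y; exact: hP.
  apply/funext => y; apply: (rp_inj H) => i Ji; rewrite hP.
  exact: (esym (congr1 (@^~ y) (h'P i Ji))).
split=> //; split=> [J K FJ FK KJ h hc|Y nu nuc].
  apply/funext => k /=; apply/(rp_eq H).
  apply: (filterS _ FK) => i Ki; exists Ki, (KJ i Ki).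
  exact: (congr1 (@^~ k) (hc i Ki)).
have ex y : exists z, forall J (FJ : F J) k, mu J FJ k = y -> nu J FJ k = z.
  have [J [FJ [k <-]]] := rp_surj H y; exists (nu J FJ k) => K FK l /(rp_eq H).
  set A := [set i | _] => FA.
  have AJ : A `<=` J by move=> i [? []].
  have AK : A `<=` K by move=> i [].
  have [f [fP _]] := pP A FA (XJ J FJ) (fun i Ai => p J FJ i (AJ i Ai)).
  have [g [gP _]] := pP A FA (XJ K FK) (fun i Ai => p K FK i (AK i Ai)).
  rewrite -(nuc _ _ FJ FA AJ f fP) -(nuc _ _ FK FA AK g gP) /=.
  congr (nu A FA _); apply: (rp_inj H) => i Ai.
  have /= -> := congr1 (@^~ k) (fP i Ai); have /= -> := congr1 (@^~ l)
    (gP i Ai).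
  have [Ki [Ji]] := Ai.
  by rewrite (Prop_irrelevance (AJ i Ai) Ji) (Prop_irrelevance (AK i Ai) Ki).
have [h hP] := choice ex.
exists h; split=> [J FJ|h' h'P]; first by apply/funext => k /=; rewrite
  -(hP _ J FJ k).
apply/funext => y; have [J [FJ [k <-]]] := rp_surj H y.
rewrite -(hP _ J FJ k) //; exact: (esym (congr1 (@^~ k) (h'P J FJ))).
Qed.

Lemma sets_has_fproducts : has_fproducts Sets.
Proof.
move=> T F FF M.
pose XJ J (FJ : F J) : Type := forall i, J i -> M i.
pose p J (FJ : F J) i (Ji : J i) (k : XJ J FJ) : M i := k i Ji.
pose pre := {J : set T & {FJ : F J & XJ J FJ}}.
pose mk J (FJ : F J) k : pre := existT _ J (existT _ FJ k).
pose sim (x y : pre) : Prop := F [set i | exists (Ji : tag x i) (Ki : tag y i),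
  tagged (tagged x) i Ji = tagged (tagged y) i Ki].
have sim_refl x : sim x x.
  by case: x => J [FJ k]; apply: (filterS _ FJ) => i Ji; exists Ji, Ji.
have sim_sym x y : sim x y -> sim y x.
  by apply: filterS => i [Ji [Ki e]]; exists Ki, Ji.
have sim_trans x y z : sim x y -> sim y z -> sim x z.
  move=> xy yz; apply: filterS (filterI xy yz) => i [[a [b ab]] [b' [c bc]]].
  by exists a, c; rewrite ab (Prop_irrelevance b b').
(* The quotient by [sim] is the type of its classes, so that equality of germs is obtained by
   extensionality. *)
pose N := {c : set pre | exists x, c = sim x}.
pose mu J (FJ : F J) k : N := exist _ (sim (mk J FJ k)) (ex_intro _ _ erefl).
have H : reduced_product p mu.
  split.
  - by move=> J FJ k l kl; apply: functional_extensionality_dep => i;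
    apply/funext => Ji; exact: kl.
  - by move=> J FJ s; exists s.
  - move=> [c [[J [FJ k]] e]]; exists J, FJ, k; apply: eq_exist.
    by rewrite e.
  - move=> J FJ k K FK l; split=> [/(congr1 sval)/= e|e].
      have : sim (mk J FJ k) (mk K FK l) by rewrite e; exact: sim_refl.
      by [].
    apply: eq_exist; apply/funext => x; apply/propext; split.
      by apply: sim_trans; exact: sim_sym.
    exact: sim_trans.
have [HP HC] := reduced_product_is_fproduct FF H.
exact: (inhabits (FProduct HP HC)).
Qed.

(** The elementwise counterpart of preserving F-products. In this form it passes directly to pairs
    and finite powers of functors, which are the domains of operations and relations. *)
Definition concrete (C : category) (G : functor C Sets) : Prop :=
  forall (T : Type) (F : set_system T), Filter F ->
  forall (M : T -> C) (U : fproduct F M),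
    reduced_product (fun J FJ i Ji => fmap G (@fp_proj _ _ _ _ U J FJ i Ji))
                    (fun J FJ => fmap G (fp_in U FJ)).

Lemma concrete_preserves (C : category) (G : functor C Sets) :
  preserves_fproducts G -> concrete G.
Proof.
move=> Gp T F FF M U.
exact: (sets_reduced_product (fproduct_image (Gp T F FF M U)) FF).
Qed.

(** * F-products of models *)

Lemma fproductP (C : category) (T : Type) (F : set_system T) (M : T -> C)
    (U : fproduct F M) : is_fproduct (fp_proj U) (fp_in U).
Proof. by split; [exact: fp_prodP|exact: fp_colimP]. Qed.

(** * Pairs and powers of set-valued functors, and relations on them *)

Section SetFunctors.
Context (C : category).
Implicit Types G H : functor C Sets.

Lemma pair_functor1 G H A :
  (fun x : G A * H A => (fmap G (idm A) x.1, fmap H (idm A) x.2)) = id.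
Proof. by apply/funext => -[x y]; rewrite !fmap1. Qed.

Lemma pair_functorM G H A B D (f : hom A B) (g : hom B D) :
  (fun x : G A * H A => (fmap G (cmp f g) x.1, fmap H (cmp f g) x.2)) =
  (fun x : G B * H B => (fmap G g x.1, fmap H g x.2)) \o
  (fun x : G A * H A => (fmap G f x.1, fmap H f x.2)).
Proof. by apply/funext => -[x y]; rewrite !fmapM. Qed.

Definition pair_functor G H : functor C Sets :=
  @Functor C Sets (fun A => G A * H A)%type
    (fun A B f x => (fmap G f x.1, fmap H f x.2))
    (pair_functor1 G H) (@pair_functorM G H).

Lemma power_functor1 (X : Type) G A :
  (fun x : X -> G A => fmap G (idm A) \o x) = id.
Proof. by apply/funext => x; rewrite fmap1. Qed.

Lemma power_functorM (X : Type) G A B D (f : hom A B) (g : hom B D) :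
  (fun x : X -> G A => fmap G (cmp f g) \o x) =
  (fun x : X -> G B => fmap G g \o x) \o (fun x : X -> G A => fmap G f \o x).
Proof. by apply/funext => x; rewrite fmapM. Qed.

Definition power_functor (X : Type) G : functor C Sets :=
  @Functor C Sets (fun A => X -> G A) (fun A B f x => fmap G f \o x)
    (@power_functor1 X G) (@power_functorM X G).

(** With satisfaction of a sentence for [R] this is the condition in the definition of preservation.
    Atomic relations are further instances, with pairs and powers of carriers for [G]. *)
Definition satisfied_on_factors G (R : forall A : C, set (G A)) T
    (F : set_system T) (M : T -> C) (U : fproduct F M) (y : G (fp_obj U)) :
    Prop :=
  exists J (FJ : F J) k, fmap G (fp_in U FJ) k = y /\
    forall j (Jj : J j), R (M j) (fmap G (fp_proj U FJ Jj) k).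

Definition determined_by_factors G (R : forall A : C, set (G A)) : Prop :=
  forall T (F : set_system T), Filter F ->
  forall (M : T -> C) (U : fproduct F M) y,
    R (fp_obj U) y <-> satisfied_on_factors R y.

Lemma pair_functor_concrete G H :
  concrete G -> concrete H -> concrete (pair_functor G H).
Proof. by move=> cG cH T F FF M U; apply: (rp_pair FF (cG _ _ FF _ U) (cH _ _ FF
  _ U)). Qed.

Lemma power_functor_concrete G (X : finType) :
  concrete G -> concrete (power_functor X G).
Proof.
move=> cG T F FF M U.
by have := rp_power FF (cG _ _ FF _ U) (@filter_finite_finType _ F FF X).
Qed.

(** The isomorphism with a well chosen F-product moves [R] in both directions because arrows
    preserve [R], as they do for atomic relations. *)
Lemma determined_of_some_fproduct G (R : forall A : C, set (G A)) :
  (forall A B (h : hom A B) x, R A x -> R B (fmap G h x)) ->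
  (forall T (F : set_system T), Filter F -> forall M : T -> C,
     exists U : fproduct F M, forall y,
       R (fp_obj U) y <-> satisfied_on_factors R y) ->
  determined_by_factors R.
Proof.
move=> hR H T F FF M U y; have [V RV] := H T F FF M.
have [fJ [f [gJ [g [fJP fP fgJ fg gf]]]]] := fproduct_iso U V.
have gJP J (FJ : F J) i (Ji : J i) :
    cmp (gJ J FJ) (fp_proj U FJ Ji) = fp_proj V FJ Ji.
  by rewrite -fJP cmpA (fgJ J FJ).2 cmp1m.
have gP J (FJ : F J) : cmp (fp_in V FJ) g = cmp (gJ J FJ) (fp_in U FJ).
  rewrite -[fp_in U FJ]cmpm1 -fg [cmp (fp_in U FJ) _]cmpA fP !cmpA.
  by rewrite (fgJ J FJ).2 cmp1m.
have gfK x : fmap G g (fmap G f x) = x.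
  by move: (congr1 (@^~ x) (fmapM G f g)); rewrite fg fmap1 => /esym.
split=> [/(hR _ _ f)/RV[J [FJ [k [kP Rk]]]]|[J [FJ [k [<- Rk]]]]].
  exists J, FJ, (fmap G (gJ J FJ) k); split.
    have := congr1 (@^~ k) (congr1 (fmap G) (gP J FJ)); rewrite !fmapM /= => <-.
    by rewrite kP gfK.
  move=> j Jj; have := congr1 (@^~ k) (congr1 (fmap G) (gJP J FJ j Jj)).
  by rewrite !fmapM /= => ->; exact: Rk.
rewrite -[fmap G _ k]gfK; apply: hR; apply/RV.
exists J, FJ, (fmap G (fJ J FJ) k); split.
  by have := congr1 (@^~ k) (congr1 (fmap G) (fP J FJ)); rewrite !fmapM.
move=> j Jj; have := congr1 (@^~ k) (congr1 (fmap G) (fJP J FJ j Jj)).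
by rewrite !fmapM /= => ->; exact: Rk.
Qed.

Lemma has_fproducts_of_ex (Q : forall T (F : set_system T) (M : T -> C),
    fproduct F M -> Prop) :
  (forall T (F : set_system T), Filter F -> forall M : T -> C,
     exists U : fproduct F M, Q T F M U) -> has_fproducts C.
Proof. by move=> H T F FF M; have [U _] := H T F FF M; exists. Qed.

End SetFunctors.

Definition concrete_fproducts (K : stratified_category) : Prop :=
  has_fproducts K /\ concrete (states K).

(** * Kripke frames *)

Section KFrames.

Definition acc_pair (A : kframes) :
  set (pair_functor (states kframes) (states kframes) A) :=
  fun y => kacc A y.1 y.2.

Lemma kframes_fproduct T (F : set_system T) : Filter F ->
  forall M : T -> kframes, exists U : fproduct F M,
    is_fproduct (fun J FJ i Ji => fmap (states kframes)
      (@fp_proj _ _ _ _ U J FJ i Ji))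
                (fun J FJ => fmap (states kframes) (fp_in U FJ)) /\
    forall y, acc_pair (A := fp_obj U) y <-> satisfied_on_factors acc_pair y.
Proof.
move=> FF M; have [V] := sets_has_fproducts FF (fun i => kworld (M i)).
(* Accessibility is initial on the products and final on the germs; the four side conditions of the
   lifting check just this. *)
pose A J (FJ : F J) : kframe := @KFrame (fp_prod V FJ) (fun k l =>
  forall i (Ji : J i), kacc (M i) (fp_proj V FJ Ji k) (fp_proj V FJ Ji l)).
pose N : kframe := @KFrame (fp_obj V) (fun x y =>
  exists J (FJ : F J) k l, [/\ fp_in V FJ k = x, fp_in V FJ l = y &
    @kacc (A J FJ) k l]).
unshelve refine (ex_intro _ (@structured_fproduct Sets kframe kworld kframe_hom
  kframe_hom1 kframe_homM T F M A (fun J FJ i Ji => fp_proj V FJ Ji) N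
  (fun J FJ => fp_in V FJ) (fproductP V) _ _ _ _) _).
- by move=> J FJ i Ji k l; exact.
- by move=> J FJ X h hP x y xy i Ji; exact: hP.
- by move=> J FJ k l kl; exists J, FJ, k, l.
- by move=> X h hP x y [J [FJ [k [l [<- <- kl]]]]]; exact: (hP J FJ).
split; first exact: fproductP.
move=> y; split=> [[J [FJ [k [l [kx ly kl]]]]]|[J [FJ [kl [<- klP]]]]].
  by exists J, FJ, (k, l); split=> //; rewrite [RHS]surjective_pairing -kx -ly.
by exists J, FJ, kl.1, kl.2.
Qed.

Lemma kframes_concrete : concrete_fproducts kframes.
Proof.
split; first exact: (has_fproducts_of_ex kframes_fproduct).
apply/concrete_preserves/preserves_of_some_fproduct => T F FF M.
by have [U []] := kframes_fproduct FF M; exists U.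
Qed.

Lemma acc_determined : determined_by_factors acc_pair.
Proof.
apply: determined_of_some_fproduct => [A B h x|T F FF M].
  exact: (svalP h).
by have [U []] := kframes_fproduct FF M; exists U.
Qed.

End KFrames.

(** * Frames with polyadic modalities *)

Section PFrames.
Context (L : nat -> Type).

Definition prel_tuple n (lam : L n) (A : pframes L) :
  set (power_functor 'I_n (states (pframes L)) A) := fun y => prel A lam y.

Lemma pframes_fproduct T (F : set_system T) : Filter F ->
  forall M : T -> pframes L, exists U : fproduct F M,
    is_fproduct (fun J FJ i Ji => fmap (states (pframes L))
      (@fp_proj _ _ _ _ U J FJ i Ji))
                (fun J FJ => fmap (states (pframes L)) (fp_in U FJ)) /\
    forall n (lam : L n) y, prel_tuple lam (A := fp_obj U) y <->
      satisfied_on_factors (prel_tuple lam) y.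
Proof.
move=> FF M; have [V] := sets_has_fproducts FF (fun i => pworld (M i)).
pose A J (FJ : F J) : pframe L := @PFrame L (fp_prod V FJ) (fun n lam k =>
  forall i (Ji : J i), prel (M i) lam (fp_proj V FJ Ji \o k)).
pose N : pframe L := @PFrame L (fp_obj V) (fun n lam y =>
  exists J (FJ : F J) k, fp_in V FJ \o k = y /\ prel (A J FJ) lam k).
unshelve refine (ex_intro _ (@structured_fproduct Sets (pframe L) (@pworld L)
  (@pframe_hom L)
  (@pframe_hom1 L) (@pframe_homM L) T F M A (fun J FJ i Ji => fp_proj V FJ Ji) N
  (fun J FJ => fp_in V FJ) (fproductP V) _ _ _ _) _).
- by move=> J FJ i Ji n lam k; exact.
- by move=> J FJ X h hP n lam x xR i Ji; exact: hP.
- by move=> J FJ n lam k kR; exists J, FJ, k.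
- by move=> X h hP n lam x [J [FJ [k [<- kR]]]]; exact: (hP J FJ).
by split; first exact: fproductP.
Qed.

Lemma pframes_concrete : concrete_fproducts (pframes L).
Proof.
split; first exact: (has_fproducts_of_ex pframes_fproduct).
apply/concrete_preserves/preserves_of_some_fproduct => T F FF M.
by have [U []] := pframes_fproduct FF M; exists U.
Qed.

Lemma prel_determined n (lam : L n) : determined_by_factors (prel_tuple lam).
Proof.
apply: determined_of_some_fproduct => [A B h x|T F FF M].
  exact: (svalP h).
by have [U []] := pframes_fproduct FF M; exists U.
Qed.

End PFrames.

(** * Frames with nominals *)

Section Nominateds.
Context (K : stratified_category) (Nom : Type).
Hypothesis cK : concrete_fproducts K.

Definition nom_forget : functor (nominateds K Nom) K := forget _ _.

Lemma nominateds_fproduct T (F : set_system T) : Filter F ->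
  forall M : T -> nominateds K Nom, exists U : fproduct F M,
    is_fproduct (fun J FJ i Ji => fmap nom_forget
      (@fp_proj _ _ _ _ U J FJ i Ji))
                (fun J FJ => fmap nom_forget (fp_in U FJ)).
Proof.
move=> FF M; have [V] := cK.1 T F FF (fun i => nframe (M i)).
have cV := cK.2 T F FF _ V.
have /choice [o oP] : forall c, exists o :
    (forall J (FJ : F J), state (fp_prod V FJ)) * state (fp_obj V),
    (forall J FJ i Ji, smap (fp_proj V FJ Ji) (o.1 J FJ) = nomi (M i) c) /\
    (forall J FJ, smap (fp_in V FJ) (o.1 J FJ) = o.2).
  (* A nominal is a nullary operation: lifted from [unit], it gives a section over each member of
     [F] together with their common germ. *)
  move=> c; have [oJ [oN [oJP oNP]]] := rp_op FF (@rp_unit _ F FF) cV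
    (fun i _ => nomi (M i) c).
  exists (fun J FJ => oJ J FJ tt, oN tt); split=> [J FJ i Ji|J FJ].
    exact: oJP.
  exact: oNP.
pose A J (FJ : F J) : nominated K Nom := @Nominated K Nom (fp_prod V FJ)
  (fun c => (o c).1 J FJ).
pose N : nominated K Nom := @Nominated K Nom (fp_obj V) (fun c => (o c).2).
unshelve refine (ex_intro _ (@structured_fproduct K (nominated K Nom)
  (@nframe K Nom) (@nominated_hom K Nom)
  (@nominated_hom1 K Nom) (@nominated_homM K Nom) T F M A
    (fun J FJ i Ji => fp_proj V FJ Ji) N
  (fun J FJ => fp_in V FJ) (fproductP V) _ _ _ _) _).
- by move=> J FJ i Ji c; exact: (oP c).1.
- move=> J FJ X h hP c; apply: (rp_inj cV) => i Ji.
  have e := hP i Ji c; rewrite /smap fmapM /= in e.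
  exact: (etrans e (esym ((oP c).1 J FJ i Ji))).
- by move=> J FJ c; exact: (oP c).2.
(* All these sections have the same germ, so a single member of [F] suffices; the whole index set is
   always available. *)
- move=> X h hP c; have e := hP setT (@filterT _ F FF) c.
  rewrite /smap fmapM /= in e; rewrite -[RHS]e.
  exact: (congr1 (smap h) (esym ((oP c).2 setT (@filterT _ F FF)))).
exact: fproductP.
Qed.

Lemma nom_forget_preserves : preserves_fproducts nom_forget.
Proof. exact: (preserves_of_some_fproduct nominateds_fproduct). Qed.

Lemma nominateds_concrete : concrete_fproducts (nominateds K Nom).
Proof.
split; first exact: (has_fproducts_of_ex nominateds_fproduct).
move=> T F FF M U.
exact: (cK.2 T F FF _ (fproduct_image (nom_forget_preserves FF U))).
Qed.

End Nominateds.

(** * Propositional valuations over frames *)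

Section PropModels.
Context (K : stratified_category) (P : Type).
Hypothesis cK : concrete_fproducts K.

Definition prop_forget : functor (prop_models K P) K := forget _ _.

Definition val_pred (pi : P) (A : prop_models K P) :
  set (states (prop_models K P) A) := fun w => pm_val A w pi.

Lemma prop_models_fproduct T (F : set_system T) : Filter F ->
  forall M : T -> prop_models K P, exists U : fproduct F M,
    is_fproduct (fun J FJ i Ji => fmap prop_forget
      (@fp_proj _ _ _ _ U J FJ i Ji))
                (fun J FJ => fmap prop_forget (fp_in U FJ)) /\
    forall pi y, val_pred pi (A := fp_obj U) y <-> satisfied_on_factors
      (val_pred pi) y.
Proof.
move=> FF M; have [V] := cK.1 T F FF (fun i => pm_frame (M i)).
pose A J (FJ : F J) : prop_model K P := @PropModel K P (fp_prod V FJ)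
  (fun k pi =>
  forall i (Ji : J i), pm_val (M i) (smap (fp_proj V FJ Ji) k) pi).
pose N : prop_model K P := @PropModel K P (fp_obj V) (fun y pi =>
  exists J (FJ : F J) k, smap (fp_in V FJ) k = y /\ pm_val (A J FJ) k pi).
unshelve refine (ex_intro _ (@structured_fproduct K (prop_model K P)
  (@pm_frame K P) (@prop_hom K P)
  (@prop_hom1 K P) (@prop_homM K P) T F M A (fun J FJ i Ji => fp_proj V FJ Ji) N
  (fun J FJ => fp_in V FJ) (fproductP V) _ _ _ _) _).
- by move=> J FJ i Ji k pi; exact.
- move=> J FJ X h hP k pi kpi i Ji; have := hP i Ji k pi kpi.
  by rewrite /smap fmapM.
- by move=> J FJ k pi kpi; exists J, FJ, k.
- move=> X h hP y pi [J [FJ [k [<- kpi]]]]; have := hP J FJ k pi kpi.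
  by rewrite /smap fmapM.
by split; first exact: fproductP.
Qed.

Lemma prop_forget_preserves : preserves_fproducts prop_forget.
Proof.
apply: preserves_of_some_fproduct => T F FF M.
by have [U []] := prop_models_fproduct FF M; exists U.
Qed.

Lemma prop_models_concrete : concrete_fproducts (prop_models K P).
Proof.
split; first exact: (has_fproducts_of_ex prop_models_fproduct).
move=> T F FF M U.
exact: (cK.2 T F FF _ (fproduct_image (prop_forget_preserves FF U))).
Qed.

Lemma val_determined pi : determined_by_factors (val_pred pi).
Proof.
apply: determined_of_some_fproduct => [A B h x|T F FF M].
  exact: (svalP h).
by have [U []] := prop_models_fproduct FF M; exists U.
Qed.

End PropModels.

(** * First order structures over frames *)

Section FoModels.
Context (K : stratified_category) (F P : nat -> Type).
Hypothesis cK : concrete_fproducts K.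

Definition fo_forget : functor (fo_models K F P) (prod_cat K Sets) := forget _
  _.

Definition fo_frame : functor (fo_models K F P) K :=
  functor_comp (fst_functor K Sets) fo_forget.

Definition fo_dom : functor (fo_models K F P) Sets :=
  functor_comp (snd_functor K Sets) fo_forget.

Definition fo_rel n (pi : P n) (A : fo_models K F P) :
  set (pair_functor (states (fo_models K F P)) (power_functor 'I_n fo_dom) A) :=
  fun y => rl (fm_str A y.1) pi y.2.

(** Worlds and individuals are two sorts with separate F-products [V] and [W]. A function symbol of
    arity [n] is an operation on pairs of a world and an [n]-tuple of individuals, and lifts through
    pairs and finite powers. *)
Lemma fo_models_fproduct T (S : set_system T) : Filter S ->
  forall M : T -> fo_models K F P, exists U : fproduct S M,
    is_fproduct (fun J FJ i Ji => fmap fo_forget (@fp_proj _ _ _ _ U J FJ i Ji))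
                (fun J FJ => fmap fo_forget (fp_in U FJ)) /\
    forall n (pi : P n) y, fo_rel pi (A := fp_obj U) y <->
      satisfied_on_factors (fo_rel pi) y.
Proof.
move=> FS M; have [V] := cK.1 T S FS (fun i => fm_frame (M i)).
have [W] := sets_has_fproducts FS (fun i => fm_dom (M i)).
have cV := cK.2 T S FS _ V; have cW := sets_reduced_product W FS.
pose argJ n J (FJ : S J) := (state (fp_prod V FJ) * ('I_n -> fp_prod W
  FJ))%type.
have exf n (f : F n) : exists o :
    (forall J (FJ : S J), argJ n J FJ -> fp_prod W FJ) *
    (state (fp_obj V) * ('I_n -> fp_obj W) -> fp_obj W),
    (forall J FJ k i (Ji : J i), fp_proj W FJ Ji (o.1 J FJ k) =
       fn (fm_str (M i) (smap (fp_proj V FJ Ji) k.1)) f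
         (fp_proj W FJ Ji \o k.2)) /\
    (forall J FJ k, fp_in W FJ (o.1 J FJ k) =
       o.2 (smap (fp_in V FJ) k.1, fp_in W FJ \o k.2)).
  have cG := rp_pair FS cV (rp_power FS cW (@filter_finite_finType _ S FS
    'I_n)).
  have [oJ [oN [oJP oNP]]] := rp_op FS cG cW
    (fun i (x : state (fm_frame (M i)) * ('I_n -> fm_dom (M i))) =>
       fn (fm_str (M i) x.1) f x.2).
  by exists (oJ, oN).
have exc (c : F 0) : exists o : (forall J (FJ : S J), fp_prod W FJ) * fp_obj W,
    (forall J FJ i (Ji : J i), fp_proj W FJ Ji (o.1 J FJ) = fm_cst (M i) c) /\
    (forall J FJ, fp_in W FJ (o.1 J FJ) = o.2).
  have [oJ [oN [oJP oNP]]] := rp_op FS (@rp_unit _ S FS) cW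
    (fun i _ => fm_cst (M i) c).
  exists (fun J FJ => oJ J FJ tt, oN tt); split=> [J FJ i Ji|J FJ]; first exact:
    oJP.
  exact: oNP.
pose o n f := projT1 (cid (exf n f)).
have oP n f J FJ k i (Ji : J i) : fp_proj W FJ Ji ((o n f).1 J FJ k) =
    fn (fm_str (M i) (smap (fp_proj V FJ Ji) k.1)) f (fp_proj W FJ Ji \o k.2).
  exact: ((projT2 (cid (exf n f))).1).
have oQ n f J FJ k : fp_in W FJ ((o n f).1 J FJ k) =
    (o n f).2 (smap (fp_in V FJ) k.1, fp_in W FJ \o k.2).
  exact: ((projT2 (cid (exf n f))).2).
pose d c := projT1 (cid (exc c)).
have dP c J FJ i (Ji : J i) : fp_proj W FJ Ji ((d c).1 J FJ) = fm_cst (M i) c.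
  exact: ((projT2 (cid (exc c))).1).
have dQ c J FJ : fp_in W FJ ((d c).1 J FJ) = (d c).2.
  exact: ((projT2 (cid (exc c))).2).
(* The operation lifted from a nullary symbol must agree with the constant lifted separately,
   whatever the world. On sections this is read off from the factors, and on germs it follows by
   surjectivity. *)
have csJ J (FJ : S J) (k : state (fp_prod V FJ)) c a :
    (o 0 c).1 J FJ (k, a) = (d c).1 J FJ.
  by apply: (rp_inj cW) => i Ji; rewrite oP dP fm_cstP.
have csN (w : state (fp_obj V)) c a : (o 0 c).2 (w, a) = (d c).2.
  have cG := rp_pair FS cV (rp_power FS cW (@filter_finite_finType _ S FS
    'I_0)).
  have [J [FJ [k <-]]] := rp_surj cG (w, a).
  by rewrite -[LHS](oQ 0 c J FJ k) -(dQ c J FJ) -(csJ J FJ k.1 c k.2)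
    -surjective_pairing.
pose strJ J (FJ : S J) (k : state (fp_prod V FJ)) : fo_str F P (fp_prod W FJ) :=
  FoStr (fun n f a => (o n f).1 J FJ (k, a))
    (fun n pi a => forall i (Ji : J i),
       rl (fm_str (M i) (smap (fp_proj V FJ Ji) k)) pi (fp_proj W FJ Ji \o a)).
pose strN (w : state (fp_obj V)) : fo_str F P (fp_obj W) :=
  FoStr (fun n f a => (o n f).2 (w, a))
    (fun n pi a => exists J (FJ : S J) k b,
       [/\ smap (fp_in V FJ) k = w, fp_in W FJ \o b = a & rl (strJ J FJ k) pi
         b]).
(* The relation of [strN] rephrased over pairs, the form that [satisfied_on_factors] takes for
   [fo_rel]. *)
have relN n (pi : P n) w a : rl (strN w) pi a <->
    exists J (FJ : S J) (k : argJ n J FJ),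
      (smap (fp_in V FJ) k.1, fp_in W FJ \o k.2) = (w, a) /\
      forall i (Ji : J i),
        rl (fm_str (M i) (smap (fp_proj V FJ Ji) k.1)) pi
          (fp_proj W FJ Ji \o k.2).
  split=> [[J [FJ [k [b [<- <- kb]]]]]|[J [FJ [[k b] [[<- <-] kb]]]]].
    by exists J, FJ, (k, b).
  by exists J, FJ, k, b.
pose A J (FJ : S J) : fo_model K F P :=
  @FoModel K F P (fp_prod V FJ) (fp_prod W FJ) (fun c => (d c).1 J FJ)
    (strJ J FJ)
    (@csJ J FJ).
pose N : fo_model K F P :=
  @FoModel K F P (fp_obj V) (fp_obj W) (fun c => (d c).2) strN csN.
unshelve refine (ex_intro _ (@structured_fproduct (prod_cat K Sets)
  (fo_model K F P)
  (@fm_base K F P) (@fm_hom K F P) (@fm_hom1 K F P) (@fm_homM K F P) T S M A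
  (fun J FJ i Ji => (fp_proj V FJ Ji, fp_proj W FJ Ji)) N
  (fun J FJ => (fp_in V FJ, fp_in W FJ))
  (@prod_cat_is_fproduct K Sets T S (fun i => fm_base (M i)) V W) _ _ _ _) _).
- move=> J FJ i Ji; split=> [c|k]; first exact: dP.
  by split=> [n f a|n pi a]; [exact: oP|exact].
- move=> J FJ X h hP; split=> [c|w].
    apply: (rp_inj cW) => i Ji; have [/(_ c) e _] := hP i Ji.
    exact: (etrans e (esym (dP c J FJ i Ji))).
  split=> [n f a|n pi a aR].
    apply: (rp_inj cW) => i Ji; have [_ /(_ w)[/(_ n f a) e _]] := hP i Ji.
    apply: (etrans e); rewrite [RHS]oP /smap fmapM; congr fn.
  move=> i Ji; have [_ /(_ w)[_ /(_ n pi a aR)]] := hP i Ji.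
  by rewrite /smap fmapM.
- move=> J FJ; split=> [c|k]; first exact: dQ.
  by split=> [n f a|n pi a aR]; [exact: oQ|exists J, FJ, k, a].
- move=> X h hP; split=> [c|w].
    have [/(_ c) e _] := hP setT (@filterT _ S FS).
    by rewrite -[RHS]e; exact: (congr1 h.2 (esym (dQ c _ _))).
  split=> [n f a|n pi a [J [FJ [k [b [<- <- kb]]]]]].
    have cG := rp_pair FS cV (rp_power FS cW (@filter_finite_finType _ S FS
      'I_n)).
    have [J [FJ [[k b] [<- <-]]]] := rp_surj cG (w, a).
    have [_ /(_ k)[/(_ n f b) e _]] := hP J FJ.
    rewrite /smap fmapM in e.
    exact: (etrans (congr1 h.2 (esym (oQ n f J FJ (k, b)))) e).
  have [_ /(_ k)[_ /(_ n pi b kb)]] := hP J FJ.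
  by rewrite /smap fmapM.
split; first exact: prod_cat_is_fproduct.
move=> n pi [w a]; exact: (relN n pi w a).
Qed.

Lemma fo_forget_preserves : preserves_fproducts fo_forget.
Proof.
apply: preserves_of_some_fproduct => T S FS M.
by have [U []] := fo_models_fproduct FS M; exists U.
Qed.

Lemma fo_frame_preserves : preserves_fproducts fo_frame.
Proof.
apply: (preserves_fproducts_comp _ fo_forget_preserves).
exact: (fst_preserves_fproducts cK.1 sets_has_fproducts).
Qed.

Lemma fo_dom_concrete : concrete fo_dom.
Proof.
apply/concrete_preserves/(preserves_fproducts_comp _ fo_forget_preserves).
exact: (snd_preserves_fproducts cK.1 sets_has_fproducts).
Qed.

Lemma fo_models_concrete : concrete_fproducts (fo_models K F P).
Proof.
split; first exact: (has_fproducts_of_ex fo_models_fproduct).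
move=> T S FS M U.
exact: (cK.2 T S FS _ (fproduct_image (fo_frame_preserves FS U))).
Qed.

Lemma fo_rel_determined n (pi : P n) : determined_by_factors (fo_rel pi).
Proof.
apply: determined_of_some_fproduct => [A B h x|T S FS M].
  by case: h => h [h1 h2]; exact: (h2 x.1).2.
by have [U []] := fo_models_fproduct FS M; exists U.
Qed.

End FoModels.

(** * Models of double hybrid logic *)

Section HHPLModels.
Context (Nom0 Nom1 P : Type).

Let K : stratified_category := nominateds kframes Nom1.

Definition hh_forget : functor (hhpl_models Nom0 Nom1 P) (prod_cat K Sets) :=
  forget _ _.

Definition hh_frameF : functor (hhpl_models Nom0 Nom1 P) K :=
  functor_comp (fst_functor K Sets) hh_forget.

Definition hh_lowF : functor (hhpl_models Nom0 Nom1 P) Sets :=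
  functor_comp (snd_functor K Sets) hh_forget.

Definition hh_acc_rel (A : hhpl_models Nom0 Nom1 P) :
  set (pair_functor (states (hhpl_models Nom0 Nom1 P))
         (pair_functor hh_lowF hh_lowF) A) :=
  fun y => hh_acc A y.1 y.2.1 y.2.2.

Definition hh_val_rel (pi : P) (A : hhpl_models Nom0 Nom1 P) :
  set (pair_functor (states (hhpl_models Nom0 Nom1 P)) hh_lowF A) :=
  fun y => hh_val A y.1 y.2 pi.

(** [hh_hom] asks at each upper world for an arrow of hybrid models over a given function, that is,
    for proofs nested in subtypes. Unpacked, lower accessibility and valuation become relations
    between upper and lower worlds, and the construction for first order structures can be
    repeated. *)
Lemma hh_homP (M N : hhpl_model Nom0 Nom1 P) (h : hom (hh_base M) (hh_base N)) :
  hh_hom h <->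
  [/\ forall i, h.2 (hh_nom0 M i) = hh_nom0 N i,
      forall w v v', hh_acc M w v v' -> hh_acc N (smap h.1 w) (h.2 v) (h.2 v') &
      forall w v, hh_val M w v `<=` hh_val N (smap h.1 w) (h.2 v)].
Proof.
split=> [[h0 hw]|[h0 ha hv]]; split=> //.
- by move=> w v v'; have [f <-] := hw w; exact: (svalP (sval (sval f))).
- by move=> w v; have [f <-] := hw w; exact: (svalP f).
move=> w.
pose f0 : @hom kframes (KFrame (hh_acc M w)) (KFrame (hh_acc N (smap h.1 w))) :=
  exist _ h.2 (ha w).
pose f1 : @hom (nominateds kframes Nom0) (pm_frame (hh_at w))
  (pm_frame (hh_at (smap h.1 w))) := exist _ f0 h0.
by exists (exist _ f1 (hv w)).
Qed.

Lemma hhpl_models_fproduct T (S : set_system T) : Filter S ->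
  forall M : T -> hhpl_models Nom0 Nom1 P, exists U : fproduct S M,
    [/\ is_fproduct (fun J FJ i Ji => fmap hh_forget
      (@fp_proj _ _ _ _ U J FJ i Ji))
          (fun J FJ => fmap hh_forget (fp_in U FJ)),
        forall y, hh_acc_rel (A := fp_obj U) y <-> satisfied_on_factors
          hh_acc_rel y &
        forall pi y, hh_val_rel pi (A := fp_obj U) y <->
          satisfied_on_factors (hh_val_rel pi) y].
Proof.
have cK : concrete_fproducts K := nominateds_concrete Nom1 kframes_concrete.
move=> FS M; have [V] := cK.1 T S FS (fun i => hh_frame (M i)).
have [W] := sets_has_fproducts FS (fun i => hh_low (M i)).
have cV := cK.2 T S FS _ V; have cW := sets_reduced_product W FS.
have exc (c : Nom0) : exists o : (forall J (FJ : S J), fp_prod W FJ) * fp_obj W,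
    (forall J FJ i (Ji : J i), fp_proj W FJ Ji (o.1 J FJ) = hh_nom0 (M i) c) /\
    (forall J FJ, fp_in W FJ (o.1 J FJ) = o.2).
  have [oJ [oN [oJP oNP]]] := rp_op FS (@rp_unit _ S FS) cW
    (fun i _ => hh_nom0 (M i) c).
  exists (fun J FJ => oJ J FJ tt, oN tt); split=> [J FJ i Ji|J FJ]; first exact:
    oJP.
  exact: oNP.
pose d c := projT1 (cid (exc c)).
have dP c J FJ i (Ji : J i) : fp_proj W FJ Ji ((d c).1 J FJ) = hh_nom0 (M i) c.
  exact: ((projT2 (cid (exc c))).1).
have dQ c J FJ : fp_in W FJ ((d c).1 J FJ) = (d c).2.
  exact: ((projT2 (cid (exc c))).2).
pose accJ J (FJ : S J) (k : state (fp_prod V FJ)) (v v' : fp_prod W FJ) : Prop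
  :=
  forall i (Ji : J i), hh_acc (M i) (smap (fp_proj V FJ Ji) k)
    (fp_proj W FJ Ji v) (fp_proj W FJ Ji v').
pose valJ J (FJ : S J) (k : state (fp_prod V FJ)) (v : fp_prod W FJ) : set P :=
  fun pi => forall i (Ji : J i), hh_val (M i) (smap (fp_proj V FJ Ji) k)
    (fp_proj W FJ Ji v) pi.
pose accN (w : state (fp_obj V)) (x x' : fp_obj W) : Prop :=
  exists J (FJ : S J) (k : state (fp_prod V FJ) *
    (fp_prod W FJ * fp_prod W FJ)),
    (smap (fp_in V FJ) k.1, (fp_in W FJ k.2.1, fp_in W FJ k.2.2)) = (w, (x, x'))
      /\
    accJ J FJ k.1 k.2.1 k.2.2.
pose valN (w : state (fp_obj V)) (x : fp_obj W) : set P := fun pi =>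
  exists J (FJ : S J) (k : state (fp_prod V FJ) * fp_prod W FJ),
    (smap (fp_in V FJ) k.1, fp_in W FJ k.2) = (w, x) /\ valJ J FJ k.1 k.2 pi.
have relA w x x' : accN w x x' <-> exists J (FJ : S J)
    (k : state (fp_prod V FJ) * (fp_prod W FJ * fp_prod W FJ)),
    (smap (fp_in V FJ) k.1, (fp_in W FJ k.2.1, fp_in W FJ k.2.2)) = (w, (x, x'))
      /\
    forall i (Ji : J i), hh_acc (M i) (smap (fp_proj V FJ Ji) k.1)
      (fp_proj W FJ Ji k.2.1) (fp_proj W FJ Ji k.2.2) by [].
have relV pi w x : valN w x pi <-> exists J (FJ : S J)
    (k : state (fp_prod V FJ) * fp_prod W FJ),
    (smap (fp_in V FJ) k.1, fp_in W FJ k.2) = (w, x) /\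
    forall i (Ji : J i), hh_val (M i) (smap (fp_proj V FJ Ji) k.1)
      (fp_proj W FJ Ji k.2) pi by [].
pose A J (FJ : S J) : hhpl_model Nom0 Nom1 P :=
  @HHPLModel Nom0 Nom1 P (fp_prod V FJ) (fp_prod W FJ) (fun c => (d c).1 J FJ)
    (accJ J FJ) (valJ J FJ).
pose N : hhpl_model Nom0 Nom1 P :=
  @HHPLModel Nom0 Nom1 P (fp_obj V) (fp_obj W) (fun c => (d c).2) accN valN.
pose q J (FJ : S J) i (Ji : J i) :
  @hom (prod_cat K Sets) (hh_base (A J FJ)) (hh_base (M i)) :=
  (fp_proj V FJ Ji, fp_proj W FJ Ji).
pose m J (FJ : S J) : @hom (prod_cat K Sets) (hh_base (A J FJ)) (hh_base N) :=
  (fp_in V FJ, fp_in W FJ).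
have Pp J (FJ : S J) i (Ji : J i) :
    hh_hom (q J FJ i Ji).
  apply/hh_homP; split=> [c|k v v'|k v pi]; first exact: dP.
      exact.
    exact.
have Pini J (FJ : S J) X (h : @hom (prod_cat K Sets) (hh_base X)
  (hh_base (A J FJ))) :
    (forall i (Ji : J i), hh_hom (cmp h (q J FJ i Ji))) ->
    hh_hom h.
  move=> hP; apply/hh_homP; split=> [c|w v v' vv'|w v pi wv].
    - apply: (rp_inj cW) => i Ji; have /hh_homP[/(_ c) e _ _] := hP i Ji.
      exact: (etrans e (esym (dP c J FJ i Ji))).
    - move=> i Ji; have /hh_homP[_ /(_ w v v' vv') e _] := hP i Ji.
      by rewrite /smap fmapM in e.
    - move=> i Ji; have /hh_homP[_ _ /(_ w v pi wv) e] := hP i Ji.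
      by rewrite /smap fmapM in e.
have Pmu J (FJ : S J) :
    hh_hom (m J FJ).
  apply/hh_homP; split=> [c|k v v' vv'|k v pi kv]; first exact: dQ.
      by exists J, FJ, (k, (v, v')).
    by exists J, FJ, (k, v).
have Pfin X (h : @hom (prod_cat K Sets) (hh_base N) (hh_base X)) :
    (forall J (FJ : S J), hh_hom (cmp (m J FJ) h)) ->
    hh_hom h.
  move=> hP; apply/hh_homP.
    split=> [c|_ _ _ [J [FJ [[k [v v']] [[<- <- <-] vv']]]]|_ _ pi
      [J [FJ [[k v] [[<- <-] kv]]]]].
    - have /hh_homP[/(_ c) e _ _] := hP setT (@filterT _ S FS).
      by rewrite -[RHS]e; exact: (congr1 h.2 (esym (dQ c _ _))).
    - have /hh_homP[_ /(_ k v v' vv') e _] := hP J FJ.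
      by rewrite /smap fmapM in e.
    - have /hh_homP[_ _ /(_ k v pi kv) e] := hP J FJ.
      by rewrite /smap fmapM in e.
exists (@structured_fproduct (prod_cat K Sets)
  (hhpl_model Nom0 Nom1 P) (@hh_base Nom0 Nom1 P) (@hh_hom Nom0 Nom1 P)
  (@hh_hom1 Nom0 Nom1 P) (@hh_homM Nom0 Nom1 P) T S M A q N m
  (@prod_cat_is_fproduct K Sets T S (fun i => hh_base (M i)) V W)
  Pp Pini Pmu Pfin).
split; first exact: prod_cat_is_fproduct.
  by move=> [w [x x']]; exact: (relA w x x').
by move=> pi [w x]; exact: (relV pi w x).
Qed.

Let cK : concrete_fproducts K := nominateds_concrete Nom1 kframes_concrete.

Lemma hh_forget_preserves : preserves_fproducts hh_forget.
Proof.
apply: preserves_of_some_fproduct => T S FS M.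
by have [U []] := hhpl_models_fproduct FS M; exists U.
Qed.

Lemma hh_frameF_preserves : preserves_fproducts hh_frameF.
Proof.
apply: (preserves_fproducts_comp _ hh_forget_preserves).
exact: (fst_preserves_fproducts cK.1 sets_has_fproducts).
Qed.

Lemma hh_lowF_concrete : concrete hh_lowF.
Proof.
apply/concrete_preserves/(preserves_fproducts_comp _ hh_forget_preserves).
exact: (snd_preserves_fproducts cK.1 sets_has_fproducts).
Qed.

Lemma hhpl_models_concrete : concrete_fproducts (hhpl_models Nom0 Nom1 P).
Proof.
split=> [T S FS M|T S FS M U]; first by have [U] := hhpl_models_fproduct FS M;
  exists.
exact: (cK.2 T S FS _ (fproduct_image (hh_frameF_preserves FS U))).
Qed.

Lemma hh_acc_determined : determined_by_factors hh_acc_rel.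
Proof.
apply: determined_of_some_fproduct => [A B h x|T S FS M].
  by have /hh_homP[_ ha _] := svalP h; exact: ha.
by have [U []] := hhpl_models_fproduct FS M; exists U.
Qed.

Lemma hh_val_determined pi : determined_by_factors (hh_val_rel pi).
Proof.
apply: determined_of_some_fproduct => [A B h x|T S FS M].
  by have /hh_homP[_ _ hv] := svalP h; exact: hv.
by have [U []] := hhpl_models_fproduct FS M; exists U.
Qed.

End HHPLModels.

(** * First order structures and valuations of finitely many variables *)

Section FolModels.
Context (F P : nat -> Type).

Definition fol_domF : functor (fol_cat F P) Sets := forget _ _.

Definition fol_rel n (pi : P n) (A : fol_cat F P) :
  set (power_functor 'I_n fol_domF A) := fun a => rl (fol_str A) pi a.

Lemma fol_fproduct T (S : set_system T) : Filter S ->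
  forall M : T -> fol_cat F P, exists U : fproduct S M,
    is_fproduct (fun J FJ i Ji => fmap fol_domF (@fp_proj _ _ _ _ U J FJ i Ji))
                (fun J FJ => fmap fol_domF (fp_in U FJ)) /\
    forall n (pi : P n) y, fol_rel pi (A := fp_obj U) y <->
      satisfied_on_factors (fol_rel pi) y.
Proof.
move=> FS M; have [W] := sets_has_fproducts FS (fun i => fol_dom (M i)).
have cW := sets_reduced_product W FS.
have exf n (f : F n) : exists o :
    (forall J (FJ : S J), ('I_n -> fp_prod W FJ) -> fp_prod W FJ) *
    (('I_n -> fp_obj W) -> fp_obj W),
    (forall J FJ k i (Ji : J i), fp_proj W FJ Ji (o.1 J FJ k) =
       fn (fol_str (M i)) f (fp_proj W FJ Ji \o k)) /\
    (forall J FJ k, fp_in W FJ (o.1 J FJ k) = o.2 (fp_in W FJ \o k)).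
  have cG := rp_power FS cW (@filter_finite_finType _ S FS 'I_n).
  have [oJ [oN [oJP oNP]]] := rp_op FS cG cW
    (fun i (x : 'I_n -> fol_dom (M i)) => fn (fol_str (M i)) f x).
  by exists (oJ, oN).
pose o n f := projT1 (cid (exf n f)).
have oP n f J FJ k i (Ji : J i) : fp_proj W FJ Ji ((o n f).1 J FJ k) =
    fn (fol_str (M i)) f (fp_proj W FJ Ji \o k).
  exact: ((projT2 (cid (exf n f))).1).
have oQ n f J FJ k : fp_in W FJ ((o n f).1 J FJ k) = (o n f).2
  (fp_in W FJ \o k).
  exact: ((projT2 (cid (exf n f))).2).
pose A J (FJ : S J) : fol_model F P :=
  FOLModel (FoStr (fun n f a => (o n f).1 J FJ a)
    (fun n pi a => forall i (Ji : J i), rl (fol_str (M i)) pi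
      (fp_proj W FJ Ji \o a))).
pose N : fol_model F P :=
  FOLModel (FoStr (fun n f a => (o n f).2 a)
    (fun n pi a => exists J (FJ : S J) b,
       fp_in W FJ \o b = a /\ rl (fol_str (A J FJ)) pi b)).
unshelve refine (ex_intro _ (@structured_fproduct Sets (fol_model F P)
  (@fol_dom F P) (@fol_hom F P) (fun M => fo_hom1 (fol_str M))
  (fun _ _ _ _ _ => @fo_homM _ _ _ _ _ _ _ _ _ _) T S M A
  (fun J FJ i Ji => fp_proj W FJ Ji) N (fun J FJ => fp_in W FJ)
  (fproductP W) _ _ _ _) _).
- by move=> J FJ i Ji; split=> [n f a|n pi a]; [exact: oP|exact].
- move=> J FJ X h hP; split=> [n f a|n pi a aR].
    apply: (rp_inj cW) => i Ji; have [/(_ n f a) e _] := hP i Ji.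
    exact: (etrans e (esym (oP n f J FJ (h \o a) i Ji))).
  by move=> i Ji; have [_ /(_ n pi a aR)] := hP i Ji.
- by move=> J FJ; split=> [n f a|n pi a aR]; [exact: oQ|exists J, FJ, a].
- move=> X h hP; split=> [n f a|n pi a [J [FJ [b [<- kb]]]]].
    have cG := rp_power FS cW (@filter_finite_finType _ S FS 'I_n).
    have [J [FJ [b <-]]] := rp_surj cG a.
    have [/(_ n f b) e _] := hP J FJ.
    exact: (etrans (congr1 h (esym (oQ n f J FJ b))) e).
  by have [_ /(_ n pi b kb)] := hP J FJ.
by split; first exact: fproductP.
Qed.

Lemma fol_domF_concrete : concrete fol_domF.
Proof.
apply/concrete_preserves/preserves_of_some_fproduct => T S FS M.
by have [U []] := fol_fproduct FS M; exists U.
Qed.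

Lemma open_models_concrete (X : finType) : concrete_fproducts
  (open_models F P X).
Proof.
split; first exact: (has_fproducts_of_ex fol_fproduct).
exact: (power_functor_concrete X fol_domF_concrete).
Qed.

Lemma fol_rel_determined n (pi : P n) : determined_by_factors (fol_rel pi).
Proof.
apply: determined_of_some_fproduct => [A B [h [h1 h2]] x|T S FS M].
  exact: h2.
by have [U []] := fol_fproduct FS M; exists U.
Qed.

End FolModels.

(** * Los's theorem for represented germs *)

Section Germs.
Context (T : Type) (F : set_system T).

(** Total representatives detached from any F-product. [germs_inj] serves equalities, [germs_choice]
    serves existential quantifiers and modalities. Only carriers occur, so an expansion of the
    models keeps the same [r]. *)
Record germs (X : T -> Type) (Y : Type) (r : Y -> forall i, X i) : Prop := Germs
  {
  germs_inj : forall y z, F [set i | r y i = r z i] -> y = z;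
  germs_choice : forall A : (forall i, set (X i)),
    F [set i | exists x, A i x] -> exists y, F [set i | A i (r y i)]
}.

Definition acc_germs (V : T -> kframe) (W : kframe)
    (r : kworld W -> forall i, kworld (V i)) : Prop :=
  forall w w', kacc W w w' <-> F [set i | kacc (V i) (r w i) (r w' i)].

Definition prel_germs (L : nat -> Type) (V : T -> pframe L) (W : pframe L)
    (r : pworld W -> forall i, pworld (V i)) : Prop :=
  forall n (lam : L n) a,
    prel W lam a <-> F [set i | prel (V i) lam (fun k => r (a k) i)].

Definition nom_germs (K : stratified_category) (Nom : Type)
    (V : T -> nominated K Nom) (W : nominated K Nom)
    (r : state (nframe W) -> forall i, state (nframe (V i))) : Prop :=
  forall c, F [set i | r (nomi W c) i = nomi (V i) c].

Definition val_germs (K : stratified_category) (P : Type)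
    (M : T -> prop_model K P) (N : prop_model K P)
    (r : state (pm_frame N) -> forall i, state (pm_frame (M i))) : Prop :=
  forall w pi, pm_val N w pi <-> F [set i | pm_val (M i) (r w i) pi].

Definition str_germs (Fn P : nat -> Type) (D : T -> Type) (E : Type)
    (M : forall i, fo_str Fn P (D i)) (N : fo_str Fn P E)
    (r : E -> forall i, D i) : Prop :=
  (forall n (f : Fn n) a,
     F [set i | r (fn N f a) i = fn (M i) f (fun k => r (a k) i)]) /\
  (forall n (pi : P n) a,
     rl N pi a <-> F [set i | rl (M i) pi (fun k => r (a k) i)]).

End Germs.

(** * Connectives, quantifiers, modalities and atoms under an ultrafilter *)

Section Los.
Context (T : Type) (F : set_system T) {UF : UltraFilter F}.

Let fin_ord n : filter_finite F 'I_n := @filter_finite_finType _ F _ 'I_n.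

Lemma los_congr (A : Prop) (a b : T -> Prop) :
  F [set i | a i <-> b i] -> (A <-> F [set i | a i]) -> (A <-> F [set i | b i]).
Proof.
move=> ab ->; split=> [Fa|Fb].
  by apply: filterS (filterI ab Fa) => i [/= [+ _]]; exact.
by apply: filterS (filterI ab Fb) => i [/= [_ +]]; exact.
Qed.

Lemma los_and (A B : Prop) (a b : T -> Prop) :
  (A <-> F [set i | a i]) -> (B <-> F [set i | b i]) ->
  (A /\ B <-> F [set i | a i /\ b i]).
Proof.
move=> -> ->; split=> [[Fa Fb]|Fab]; first exact: (filterI Fa Fb).
by split; apply: filterS Fab => i [].
Qed.

(** One direction needs that [F] contains a set or its complement, the other that [F] is proper. *)
Lemma los_not (A : Prop) (a : T -> Prop) :
  (A <-> F [set i | a i]) -> (~ A <-> F [set i | ~ a i]).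
Proof.
move=> ->; split=> [nFa|Fna Fa].
  by have [] := in_ultra_setVsetC [set i | a i] UF.
by have [i []] := filter_ex (filterI Fna Fa).
Qed.

Lemma los_ex (X : T -> Type) (Y : Type) (r : Y -> forall i, X i)
    (A : Y -> Prop) (a : forall i, X i -> Prop) : germs F r ->
  (forall y, A y <-> F [set i | a i (r y i)]) ->
  ((exists y, A y) <-> F [set i | exists x, a i x]).
Proof.
move=> rG Aa; split=> [[y /Aa]|/(germs_choice rG)[y ay]].
  by apply: filterS => i ay; exists (r y i).
by exists y; apply/Aa.
Qed.

(** Infinitely many instances cannot be handled by intersecting members of [F], so the quantifier is
    treated as a negated existential one. It is needed for truth at all lower worlds in double
    hybrid logic. *)
Lemma los_all (X : T -> Type) (Y : Type) (r : Y -> forall i, X i)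
    (A : Y -> Prop) (a : forall i, X i -> Prop) : germs F r ->
  (forall y, A y <-> F [set i | a i (r y i)]) ->
  ((forall y, A y) <-> F [set i | forall x, a i x]).
Proof.
move=> rG Aa.
have := los_not (los_ex (a := fun i x => ~ a i x) rG (fun y => los_not (Aa y))).
have nE B (Q : B -> Prop) : ~ (exists y, ~ Q y) <-> forall y, Q y.
  split=> [nQ y|Qy [y]]; last by apply.
  by apply: contrapT => nQy; apply: nQ; exists y.
rewrite nE => ->; split; apply: filterS => i; by rewrite /= nE.
Qed.

Lemma los_eq (X : T -> Type) (Y : Type) (r : Y -> forall i, X i) y z :
  germs F r -> (y = z <-> F [set i | r y i = r z i]).
Proof.
move=> rG; split=> [->|]; last exact: (germs_inj rG).
exact: filterE.
Qed.

Lemma los_forall (B : Type) (A : B -> Prop) (a : B -> T -> Prop) :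
  filter_finite F B -> (forall b, A b <-> F [set i | a b i]) ->
  ((forall b, A b) <-> F [set i | forall b, a b i]).
Proof.
move=> fB Aa; split=> [Ab|Fab b]; first by apply: fB => b; exact/Aa.
by apply/Aa; apply: filterS Fab => i; exact.
Qed.

(** For the choice clause one witness tuple is fixed at each index and its coordinates are
    represented separately; being finitely many, they match the witness simultaneously on a member
    of [F]. *)
Lemma germs_power (B : Type) (X : T -> Type) (Y : Type) (r : Y -> forall i, X i)
  :
  filter_finite F B -> germs F r ->
  germs F (fun (y : B -> Y) i b => r (y b) i).
Proof.
move=> fB rG; split=> [y z yz|A FA].
  apply/funext => b; apply: (germs_inj rG).
  by apply: filterS yz => i e; exact: (congr1 (@^~ b) e).
pose x i (e : exists x, A i x) := projT1 (cid e).
(* Quantifying over the proofs [e] makes the condition vacuous where [A i] is empty; elsewhere it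
   pins [r z i] to coordinate [b] of the witness. *)
have /choice [y yP] b : exists z, F [set i | forall e, r z i = x i e b].
  have [|z zP] := germs_choice rG (A := fun i z => forall e, z = x i e b).
    apply: filterS FA => i e; exists (x i e b) => e'.
    by rewrite (Prop_irrelevance e e').
  by exists z.
exists y; apply: filterS (filterI FA (fB _ yP)) => i [e yi] /=.
have -> : (fun b => r (y b) i) = x i e by apply/funext => b; exact: yi.
exact: (projT2 (cid e)).
Qed.

(** The arguments of a polyadic modality are chosen jointly, as a single element of a finite
    power. *)
Lemma los_tuple_ex (n : nat) (X : T -> Type) (Y : Type) (r : Y -> forall i, X i)
    (A : ('I_n -> Y) -> Prop) (a : forall i, ('I_n -> X i) -> Prop)
    (B : 'I_n -> Y -> Prop) (b : 'I_n -> forall i, X i -> Prop) :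
  germs F r ->
  (forall ys, A ys <-> F [set i | a i (fun k => r (ys k) i)]) ->
  (forall k y, B k y <-> F [set i | b k i (r y i)]) ->
  ((exists ys, A ys /\ forall k, B k (ys k)) <->
   F [set i | exists xs, a i xs /\ forall k, b k i (xs k)]).
Proof.
move=> rG Aa Bb; apply: (@los_ex (fun i => 'I_n -> X i) ('I_n -> Y)
  (fun ys i k => r (ys k) i)
  (fun ys => A ys /\ forall k, B k (ys k))
  (fun i xs => a i xs /\ forall k, b k i (xs k)) (germs_power (@fin_ord n) rG))
    => ys.
by apply: los_and => //; exact: (los_forall (@fin_ord n)).
Qed.

Lemma tconsE (X Y : Type) (g : X -> Y) n (x : X) (t : 'I_n -> X) :
  (fun k => g (tcons x t k)) = tcons (g x) (fun k => g (t k)).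
Proof. by apply/funext => k; rewrite /tcons; case: (unlift ord0 k). Qed.

Section Frames.
Context (V : T -> kframe) (W : kframe) (r : kworld W -> forall i, kworld (V i)).
Hypothesis rG : germs F r.
Hypothesis rA : acc_germs F r.

Lemma los_dia w (B : kworld W -> Prop) (b : forall i, kworld (V i) -> Prop) :
  (forall y, B y <-> F [set i | b i (r y i)]) ->
  ((exists w', kacc W w w' /\ B w') <->
   F [set i | exists w', kacc (V i) (r w i) w' /\ b i w']).
Proof. by move=> Bb; apply: (los_ex rG) => w'; exact: los_and. Qed.

End Frames.

Section PFrames.
Context (L : nat -> Type) (V : T -> pframe L) (W : pframe L).
Context (r : pworld W -> forall i, pworld (V i)).
Hypothesis rG : germs F r.
Hypothesis rL : prel_germs F r.

Lemma los_mod n (lam : L n.+1) w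
    (B : 'I_n -> pworld W -> Prop) (b : 'I_n -> forall i, pworld (V i) -> Prop)
      :
  (forall k y, B k y <-> F [set i | b k i (r y i)]) ->
  ((exists ws, prel W lam (tcons w ws) /\ forall k, B k (ws k)) <->
   F [set i | exists ws, prel (V i) lam (tcons (r w i) ws) /\
                         forall k, b k i (ws k)]).
Proof.
apply: (los_tuple_ex (a := fun i ws => prel (V i) lam (tcons (r w i) ws)) rG).
move=> ws; apply: (los_congr _ (rL lam (tcons w ws))).
apply: filterE => i /=.
by have -> := tconsE (r^~ i) w ws.
Qed.

End PFrames.

Section Nominals.
Context (K : stratified_category) (Nom : Type).
Context (V : T -> nominated K Nom) (W : nominated K Nom).
Context (r : state (nframe W) -> forall i, state (nframe (V i))).
Hypothesis rG : germs F r.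
Hypothesis rN : nom_germs F r.

Lemma los_nom c w : nomi W c = w <-> F [set i | nomi (V i) c = r w i].
Proof.
apply: (los_congr _ (los_eq (nomi W c) w rG)).
by apply: filterS (rN c) => i /= ->.
Qed.

Lemma los_at c (B : state (nframe W) -> Prop)
    (b : forall i, state (nframe (V i)) -> Prop) :
  (forall y, B y <-> F [set i | b i (r y i)]) ->
  (B (nomi W c) <-> F [set i | b i (nomi (V i) c)]).
Proof.
move=> Bb; apply: (los_congr _ (Bb (nomi W c))).
by apply: filterS (rN c) => i /= ->.
Qed.

(** The new nominal denotes [v] in [W] and the representative [r v i] in the factors, so its clause
    holds at every index while [r] stays the same. *)
Lemma nom_germs_expand v :
  nom_germs F (V := fun i => nom_expand (r v i)) (W := nom_expand v) r.
Proof.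
by move=> [c|] /=; [exact: rN|exact: filterE].
Qed.

End Nominals.

Section Structures.
Context (Fn P : nat -> Type) (D : T -> Type) (E : Type).
Context (M : forall i, fo_str Fn P (D i)) (N : fo_str Fn P E).
Context (r : E -> forall i, D i).
Hypothesis rS : str_germs F M N r.

(** Representatives commute with a function symbol only almost everywhere; arities are finite, so
    the exceptional sets of the arguments can be discarded together. *)
Lemma los_eval t : F [set i | r (eval N t) i = eval (M i) t].
Proof.
elim: t => n f args IH /=.
have IH' := fin_ord IH.
apply: filterS (filterI (rS.1 n f (fun k => eval N (args k))) IH') => i
  [/= -> e].
by congr fn; apply/funext => k; exact: e.
Qed.

Lemma los_atom n (pi : P n) t :
  sat_atom N pi t <-> F [set i | sat_atom (M i) pi t].
Proof.
apply: (los_congr _ (rS.2 n pi (fun k => eval N (t k)))).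
have := fin_ord (fun k => los_eval (t k)).
apply: filterS => i e /=; rewrite /sat_atom.
by have -> : (fun k => r (eval N (t k)) i) = fun k => eval (M i) (t k)
  by apply/funext => k; exact: e.
Qed.

Lemma str_germs_expand (X : Type) (v : X -> E) :
  str_germs F (fun i => fo_expand (M i) (fun x => r (v x) i)) (fo_expand N v) r.
Proof.
split=> [[|n] f a|n pi a]; last exact: rS.2.
  by case: f => [f|x] /=; [exact: rS.1|exact: filterE].
exact: rS.1.
Qed.

End Structures.

(** * Los's theorem by induction on sentences, logic by logic *)

Lemma los_mpl (P : Type) (M : T -> prop_model kframes P)
    (N : prop_model kframes P)
    (r : state (pm_frame N) -> forall i, state (pm_frame (M i))) :
  germs F r -> acc_germs F r -> val_germs F r ->
  forall rho w, mpl_sat w rho <-> F [set i | mpl_sat (r w i) rho].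
Proof.
move=> rG rA rV; elim=> [pi|rho1 IH1 rho2 IH2|rho IH|rho IH] w /=.
- exact: rV.
- exact: los_and.
- exact: los_not.
- exact: (los_dia rG rA).
Qed.

Lemma los_mmpl (L : nat -> Type) (P : Type) (M : T -> prop_model (pframes L) P)
    (N : prop_model (pframes L) P)
    (r : state (pm_frame N) -> forall i, state (pm_frame (M i))) :
  germs F r -> prel_germs F r -> val_germs F r ->
  forall rho w, mmpl_sat w rho <-> F [set i | mmpl_sat (r w i) rho].
Proof.
move=> rG rL rV; elim=> [pi|rho1 IH1 rho2 IH2|rho IH|n lam rho IH] w /=.
- exact: rV.
- exact: los_and.
- exact: los_not.
- exact: (los_mod rG rL lam w (B := fun k v => mmpl_sat v (rho k))
    (b := fun k i v => mmpl_sat v (rho k)) IH).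
Qed.

(** The models and [r] are generalised before the induction because a nominal quantifier moves to
    the signature with [option Nom]; there the hypothesis is applied to expanded models along the
    same [r]. *)
Lemma los_hpl (Nom P : Type) (rho : hpl_sen Nom P)
    (M : T -> prop_model (nominateds kframes Nom) P)
    (N : prop_model (nominateds kframes Nom) P)
    (r : state (pm_frame N) -> forall i, state (pm_frame (M i))) :
  germs F r -> acc_germs F r -> nom_germs F r -> val_germs F r ->
  forall w, hpl_sat w rho <-> F [set i | hpl_sat (r w i) rho].
Proof.
elim: rho M N r => {Nom P} [Nom P pi|Nom P rho1 IH1 rho2 IH2|Nom P rho IH
  |Nom P rho IH|Nom P c|Nom P c rho IH|Nom P rho IH] M N r rG rA rN rV w /=.
- exact: rV.
- by apply: los_and; [exact: IH1|exact: IH2].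
- exact/los_not/IH.
- by apply: (los_dia rG rA); exact: IH.
- exact: (los_nom rG rN).
- by apply: (los_at rN c (B := fun v => hpl_sat v rho)
    (b := fun i v => @hpl_sat _ _ (M i) v rho)); exact: IH.
- apply: (los_ex (a := fun i v => @hpl_sat _ _ (prop_nom_expand v) (r w i) rho)
  rG).
  move=> v; apply: (IH (fun i => prop_nom_expand (r v i)) (prop_nom_expand v) r)
    => //.
  exact: nom_germs_expand.
Qed.

Lemma los_mhpl (L : nat -> Type) (Nom P : Type) (rho : mhpl_sen L Nom P)
    (M : T -> prop_model (nominateds (pframes L) Nom) P)
    (N : prop_model (nominateds (pframes L) Nom) P)
    (r : state (pm_frame N) -> forall i, state (pm_frame (M i))) :
  germs F r -> prel_germs F r -> nom_germs F r -> val_germs F r ->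
  forall w, mhpl_sat w rho <-> F [set i | mhpl_sat (r w i) rho].
Proof.
elim: rho M N r => {Nom P} [Nom P pi|Nom P rho1 IH1 rho2 IH2|Nom P rho IH
  |Nom P n lam rho IH|Nom P c|Nom P c rho IH|Nom P rho IH]
  M N r rG rL rN rV w /=.
- exact: rV.
- by apply: los_and; [exact: IH1|exact: IH2].
- exact/los_not/IH.
- apply: (los_mod rG rL lam w (B := fun k v => mhpl_sat v (rho k))
    (b := fun k i v => @mhpl_sat _ _ _ (M i) v (rho k))) => k.
  exact: IH.
- exact: (los_nom rG rN).
- by apply: (los_at rN c (B := fun v => mhpl_sat v rho)
    (b := fun i v => @mhpl_sat _ _ _ (M i) v rho)); exact: IH.
- apply: (los_ex (a := fun i v => @mhpl_sat _ _ _ (prop_nom_expand v) (r w i)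
  rho) rG).
  move=> v; apply: (IH (fun i => prop_nom_expand (r v i)) (prop_nom_expand v) r)
    => //.
  exact: nom_germs_expand.
Qed.

Definition fo_germs (K : stratified_category) (Fn P : nat -> Type)
    (M : T -> fo_model K Fn P) (N : fo_model K Fn P)
    (r0 : state (fm_frame N) -> forall i, state (fm_frame (M i)))
    (r1 : fm_dom N -> forall i, fm_dom (M i)) : Prop :=
  forall w, str_germs F (fun i => fm_str (M i) (r0 w i)) (fm_str N w) r1.

Lemma fo_germs_expand (K : stratified_category) (Fn P : nat -> Type)
    (M : T -> fo_model K Fn P) (N : fo_model K Fn P)
    (r0 : state (fm_frame N) -> forall i, state (fm_frame (M i)))
    (r1 : fm_dom N -> forall i, fm_dom (M i)) d :
  fo_germs r0 r1 ->
  @fo_germs K (add_var Fn) P (fun i => fm_expand (r1 d i)) (fm_expand d) r0 r1.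
Proof. by move=> rS w; exact: (str_germs_expand (rS w) (fun=> d)). Qed.

Lemma los_mfol (Fn P : nat -> Type) (rho : mfol_sen Fn P)
    (M : T -> fo_model kframes Fn P) (N : fo_model kframes Fn P)
    (r0 : state (fm_frame N) -> forall i, state (fm_frame (M i)))
    (r1 : fm_dom N -> forall i, fm_dom (M i)) :
  germs F r0 -> germs F r1 -> acc_germs F r0 -> fo_germs r0 r1 ->
  forall w, mfol_sat w rho <-> F [set i | mfol_sat (r0 w i) rho].
Proof.
elim: rho M N r0 r1 => {Fn P} [Fn P n pi t|Fn P rho1 IH1 rho2 IH2|Fn P rho IH
  |Fn P rho IH|Fn P rho IH] M N r0 r1 G0 G1 rA rS w /=.
- exact: (los_atom (rS w)).
- by apply: los_and; [exact: (IH1 _ _ r0 r1)|exact: (IH2 _ _ r0 r1)].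
- exact/los_not/(IH _ _ r0 r1).
- apply: (los_ex (a := fun i d => @mfol_sat _ _ (fm_expand d) (r0 w i) rho) G1)
  => d.
  exact: (IH (fun i => fm_expand (r1 d i)) (fm_expand d) r0 r1 G0 G1 rA
    (fo_germs_expand (d := d) rS)).
- by apply: (los_dia G0 rA w); exact: (IH _ _ r0 r1).
Qed.

Lemma los_hfol (Nom : Type) (Fn P : nat -> Type) (rho : hfol_sen Nom Fn P)
    (M : T -> fo_model (nominateds kframes Nom) Fn P)
    (N : fo_model (nominateds kframes Nom) Fn P)
    (r0 : state (fm_frame N) -> forall i, state (fm_frame (M i)))
    (r1 : fm_dom N -> forall i, fm_dom (M i)) :
  germs F r0 -> germs F r1 -> acc_germs F r0 -> nom_germs F r0 -> fo_germs r0 r1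
    ->
  forall w, hfol_sat w rho <-> F [set i | hfol_sat (r0 w i) rho].
Proof.
elim: rho M N r0 r1 => {Nom Fn P} [Nom Fn P n pi t|Nom Fn P rho1 IH1 rho2 IH2
  |Nom Fn P rho IH|Nom Fn P rho IH|Nom Fn P rho IH|Nom Fn P c|Nom Fn P c rho IH
  |Nom Fn P rho IH] M N r0 r1 G0 G1 rA rN rS w /=.
- exact: (los_atom (rS w)).
- by apply: los_and; [exact: (IH1 _ _ r0 r1)|exact: (IH2 _ _ r0 r1)].
- exact/los_not/(IH _ _ r0 r1).
- apply: (los_ex (a := fun i d => @hfol_sat _ _ _ (fm_expand d) (r0 w i) rho)
  G1) => d.
  exact: (IH (fun i => fm_expand (r1 d i)) (fm_expand d) r0 r1 G0 G1 rA rN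
    (fo_germs_expand (d := d) rS)).
- by apply: (los_dia G0 rA w); exact: (IH _ _ r0 r1).
- exact: (los_nom G0 rN).
- by apply: (los_at rN c (B := fun v => hfol_sat v rho)
    (b := fun i v => @hfol_sat _ _ _ (M i) v rho)); exact: (IH _ _ r0 r1).
- apply: (los_ex (a := fun i v => @hfol_sat _ _ _ (fm_nom_expand v) (r0 w i)
  rho) G0) => v.
  exact: (IH (fun i => fm_nom_expand (r0 v i)) (fm_nom_expand v) r0 r1 G0 G1 rA
    (nom_germs_expand rN v) rS).
Qed.

Lemma los_mmfol (L Fn P : nat -> Type) (rho : mmfol_sen L Fn P)
    (M : T -> fo_model (pframes L) Fn P) (N : fo_model (pframes L) Fn P)
    (r0 : state (fm_frame N) -> forall i, state (fm_frame (M i)))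
    (r1 : fm_dom N -> forall i, fm_dom (M i)) :
  germs F r0 -> germs F r1 -> prel_germs F r0 -> fo_germs r0 r1 ->
  forall w, mmfol_sat w rho <-> F [set i | mmfol_sat (r0 w i) rho].
Proof.
elim: rho M N r0 r1 => {Fn P} [Fn P n pi t|Fn P rho1 IH1 rho2 IH2
  |Fn P rho IH|Fn P rho IH|Fn P n lam rho IH] M N r0 r1 G0 G1 rL rS w /=.
- exact: (los_atom (rS w)).
- by apply: los_and; [exact: (IH1 _ _ r0 r1)|exact: (IH2 _ _ r0 r1)].
- exact/los_not/(IH _ _ r0 r1).
- apply: (los_ex (a := fun i d => @mmfol_sat _ _ _ (fm_expand d) (r0 w i) rho)
  G1) => d.
  exact: (IH (fun i => fm_expand (r1 d i)) (fm_expand d) r0 r1 G0 G1 rL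
    (fo_germs_expand (d := d) rS)).
- apply: (los_mod G0 rL lam w (B := fun k v => mmfol_sat v (rho k))
    (b := fun k i v => @mmfol_sat _ _ _ (M i) v (rho k))) => k.
  exact: (IH k _ _ r0 r1).
Qed.

Lemma los_mhfol (L : nat -> Type) (Nom : Type) (Fn P : nat -> Type)
    (rho : mhfol_sen L Nom Fn P)
    (M : T -> fo_model (nominateds (pframes L) Nom) Fn P)
    (N : fo_model (nominateds (pframes L) Nom) Fn P)
    (r0 : state (fm_frame N) -> forall i, state (fm_frame (M i)))
    (r1 : fm_dom N -> forall i, fm_dom (M i)) :
  germs F r0 -> germs F r1 -> prel_germs F r0 -> nom_germs F r0 -> fo_germs r0
    r1 ->
  forall w, mhfol_sat w rho <-> F [set i | mhfol_sat (r0 w i) rho].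
Proof.
elim: rho M N r0 r1 => {Nom Fn P} [Nom Fn P n pi t
  |Nom Fn P rho1 IH1 rho2 IH2|Nom Fn P rho IH|Nom Fn P rho IH
  |Nom Fn P n lam rho IH|Nom Fn P c|Nom Fn P c rho IH|Nom Fn P rho IH]
  M N r0 r1 G0 G1 rL rN rS w /=.
- exact: (los_atom (rS w)).
- by apply: los_and; [exact: (IH1 _ _ r0 r1)|exact: (IH2 _ _ r0 r1)].
- exact/los_not/(IH _ _ r0 r1).
- apply: (los_ex (a := fun i d => @mhfol_sat _ _ _ _ (fm_expand d) (r0 w i) rho)
  G1) => d.
  exact: (IH (fun i => fm_expand (r1 d i)) (fm_expand d) r0 r1 G0 G1 rL rN
    (fo_germs_expand (d := d) rS)).
- apply: (los_mod G0 rL lam w (B := fun k v => mhfol_sat v (rho k))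
    (b := fun k i v => @mhfol_sat _ _ _ _ (M i) v (rho k))) => k.
  exact: (IH k _ _ r0 r1).
- exact: (los_nom G0 rN).
- by apply: (los_at rN c (B := fun v => mhfol_sat v rho)
    (b := fun i v => @mhfol_sat _ _ _ _ (M i) v rho)); exact: (IH _ _ r0 r1).
- apply: (los_ex (a := fun i v => @mhfol_sat _ _ _ _ (fm_nom_expand v) (r0 w i)
  rho) G0) => v.
  exact: (IH (fun i => fm_nom_expand (r0 v i)) (fm_nom_expand v) r0 r1 G0 G1 rL
    (nom_germs_expand rN v) rS).
Qed.

Lemma los_hhpl (Nom0 Nom1 P : Type) (rho : hhpl_sen Nom0 Nom1 P)
    (M : T -> hhpl_model Nom0 Nom1 P) (N : hhpl_model Nom0 Nom1 P)
    (r0 : state (hh_frame N) -> forall i, state (hh_frame (M i)))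
    (r1 : hh_low N -> forall i, hh_low (M i)) :
  germs F r0 -> germs F r1 -> acc_germs F r0 -> nom_germs F r0 ->
  (forall c, F [set i | r1 (hh_nom0 N c) i = hh_nom0 (M i) c]) ->
  (forall w v v', hh_acc N w v v' <->
     F [set i | hh_acc (M i) (r0 w i) (r1 v i) (r1 v' i)]) ->
  (forall w v pi, hh_val N w v pi <->
     F [set i | hh_val (M i) (r0 w i) (r1 v i) pi]) ->
  forall w, hhpl_sat w rho <-> F [set i | hhpl_sat (r0 w i) rho].
Proof.
elim: rho M N r0 r1 => {Nom0 Nom1 P} [Nom0 Nom1 P rho|Nom0 Nom1 P c
  |Nom0 Nom1 P rho1 IH1 rho2 IH2|Nom0 Nom1 P rho IH|Nom0 Nom1 P rho IH
  |Nom0 Nom1 P c rho IH|Nom0 Nom1 P rho IH|Nom0 Nom1 P rho IH]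
  M N r0 r1 G0 G1 rA rN rN0 rA0 rV w /=.
(* A base sentence is global on lower worlds, which are represented by [r1]. At a fixed upper world
   the lower models again form a family with representatives, to which the hybrid case applies. *)
- apply: (los_all (a := fun i v => @hpl_sat Nom0 P (hh_at (r0 w i)) v rho) G1)
  => v.
  exact: (@los_hpl _ _ rho (fun i => hh_at (r0 w i)) (hh_at w) r1 G1 (rA0 w) rN0
    (rV w)).
- exact: (los_nom G0 rN).
- by apply: los_and; [exact: (IH1 _ _ r0 r1)|exact: (IH2 _ _ r0 r1)].
- exact/los_not/(IH _ _ r0 r1).
- by apply: (los_dia G0 rA w); exact: (IH _ _ r0 r1).
- by apply: (los_at rN c (B := fun v => hhpl_sat v rho)
    (b := fun i v => @hhpl_sat _ _ _ (M i) v rho)); exact: (IH _ _ r0 r1).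
- apply: (los_ex (a := fun i v => @hhpl_sat _ _ _ (hh_expand0 v) (r0 w i) rho)
  G1) => v.
  apply: (IH (fun i => hh_expand0 (r1 v i)) (hh_expand0 v) r0 r1 G0 G1 rA rN) =>
    //.
  by case=> [c|] /=; [exact: rN0|exact: filterE].
- apply: (los_ex (a := fun i v => @hhpl_sat _ _ _ (hh_expand1 v) (r0 w i) rho)
  G0) => v.
  exact: (IH (fun i => hh_expand1 (r0 v i)) (hh_expand1 v) r0 r1 G0 G1 rA
    (nom_germs_expand rN v)).
Qed.

Lemma los_fol (Fn P : nat -> Type) (rho : fol_sen Fn P) (D : T -> Type)
  (E : Type)
    (M : forall i, fo_str Fn P (D i)) (N : fo_str Fn P E)
      (r : E -> forall i, D i) :
  germs F r -> str_germs F M N r ->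
  fol_sat N rho <-> F [set i | fol_sat (M i) rho].
Proof.
elim: rho M N => {Fn P} [Fn P n pi t|Fn P rho1 IH1 rho2 IH2|Fn P rho IH
  |Fn P rho IH] M N rG rS /=.
- exact: (los_atom rS).
- by apply: los_and; [exact: IH1|exact: IH2].
- exact/los_not/IH.
- apply: (los_ex (a := fun i d => fol_sat (expand_var (M i) d) rho) rG) => d.
  exact: (IH (fun i => expand_var (M i) (r d i)) _ rG
    (str_germs_expand rS (fun=> d))).
Qed.

(** * States that are valuations of variables *)

Section OpenFormulas.
Context (X : Type) (fX : filter_finite F X).
Context (Fn P : nat -> Type) (D : T -> Type) (E : Type)
  (r : E -> forall i, D i).
Hypothesis rG : germs F r.

Let rX (w : X -> E) i x := r (w x) i.

(** The extended valuation is one element of the power indexed by [option X]; that it extends [w] is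
    a conjunction of equalities indexed by [X], settled by [los_eq] and [fX]. *)
Lemma los_oex (w : X -> E) (B : (option X -> E) -> Prop)
    (b : forall i, (option X -> D i) -> Prop) :
  (forall w', B w' <-> F [set i | b i (fun x => r (w' x) i)]) ->
  ((exists w', (forall x, w' (Some x) = w x) /\ B w') <->
   F [set i | exists w', (forall x, w' (Some x) = r (w x) i) /\ b i w']).
Proof.
move=> Bb; apply: (@los_ex (fun i => option X -> D i) (option X -> E)
  (fun w' i x => r (w' x) i) (fun w' => (forall x, w' (Some x) = w x) /\ B w')
  (fun i w' => (forall x, w' (Some x) = r (w x) i) /\ b i w')
  (germs_power (filter_finite_option fX) rG)) => w'.
apply: los_and => //; apply: (los_forall fX) => x; exact: (los_eq _ _ rG).
Qed.

Context (M : forall i, fo_str Fn P (D i)) (N : fo_str Fn P E).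
Hypothesis rS : str_germs F M N r.

Lemma los_omod n (pi : P n.+1) (w : X -> E) (B : 'I_n -> (X -> E) -> Prop)
    (b : 'I_n -> forall i, (X -> D i) -> Prop) :
  (forall k w, B k w <-> F [set i | b k i (rX w i)]) ->
  ((exists ws, rl (fo_power N X) pi (tcons w ws) /\ forall k, B k (ws k)) <->
   F [set i | exists ws, rl (fo_power (M i) X) pi (tcons (rX w i) ws) /\
                         forall k, b k i (ws k)]).
Proof.
apply: (los_tuple_ex (A := fun ws => rl (fo_power N X) pi (tcons w ws))
  (a := fun i ws => rl (fo_power (M i) X) pi (tcons (rX w i) ws))
    (germs_power fX rG)).
move=> ws; apply: (los_forall fX) => x.
apply: (los_congr _ (rS.2 _ pi (fun k => tcons w ws k x))).
apply: filterE => i /=.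
have -> : (fun k => r (tcons w ws k x) i) =
    (fun k => tcons (rX w i) (fun k => rX (ws k) i) k x) => //.
by apply/funext => k; rewrite /tcons; case: (unlift ord0 k).
Qed.

Lemma power_const_germs c :
  F [set i | rX (power_const N c) i = power_const (M i) c].
Proof.
have := fX (fun x : X => rS.1 0 c (fun k => @tup0 (X -> E) k x)).
apply: filterS => i e; apply/funext => x; rewrite /rX [LHS]e /power_const /=.
(* The two argument tuples are functions on the empty type ['I_0]. *)
by congr fn; apply/funext => -[].
Qed.

Lemma los_onom c w :
  power_const N c = w <-> F [set i | power_const (M i) c = rX w i].
Proof.
apply: (los_congr _ (los_eq (power_const N c) w (germs_power fX rG))).
by apply: filterS (power_const_germs c) => i; rewrite /rX /= => ->.
Qed.

Lemma los_oat c (B : (X -> E) -> Prop) (b : forall i, (X -> D i) -> Prop) :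
  (forall w, B w <-> F [set i | b i (rX w i)]) ->
  (B (power_const N c) <-> F [set i | b i (power_const (M i) c)]).
Proof.
move=> Bb; apply: (los_congr _ (Bb (power_const N c))).
by apply: filterS (power_const_germs c) => i /= ->.
Qed.

Lemma los_oatom n (pi : P n) t w :
  sat_atom (fo_expand N w) pi t <->
  F [set i | sat_atom (fo_expand (M i) (rX w i)) pi t].
Proof. exact: (los_atom (str_germs_expand rS w)). Qed.

End OpenFormulas.

Lemma los_mofol (Fn P : nat -> Type) (X : Type) (rho : mofol_sen Fn P X)
    (D : T -> Type) (E : Type)
    (M : forall i, fo_str Fn P (D i)) (N : fo_str Fn P E)
      (r : E -> forall i, D i) :
  filter_finite F X -> germs F r -> str_germs F M N r -> forall w,
  mofol_sat N w rho <-> F [set i | mofol_sat (M i) (fun x => r (w x) i) rho].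
Proof.
elim: rho M N => {X} [X n pi t|X rho1 IH1 rho2 IH2|X rho IH
  |X rho IH|X n pi rho IH] M N fX rG rS w /=.
- exact: los_oatom.
- by apply: los_and; [exact: IH1|exact: IH2].
- exact/los_not/IH.
- apply: (los_oex fX rG w (b := fun i w' => mofol_sat (M i) w' rho)) => w'.
  exact: (IH M N (filter_finite_option fX) rG rS).
- apply: (los_omod fX rG rS pi w (B := fun k v => mofol_sat N v (rho k))
    (b := fun k i v => mofol_sat (M i) v (rho k))) => k v.
  exact: IH.
Qed.

Lemma los_hofol (Fn P : nat -> Type) (X : Type) (rho : hofol_sen Fn P X)
    (D : T -> Type) (E : Type)
    (M : forall i, fo_str Fn P (D i)) (N : fo_str Fn P E)
      (r : E -> forall i, D i) :
  filter_finite F X -> germs F r -> str_germs F M N r -> forall w,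
  hofol_sat N w rho <-> F [set i | hofol_sat (M i) (fun x => r (w x) i) rho].
Proof.
elim: rho M N => {Fn P X} [Fn P X n pi t|Fn P X rho1 IH1 rho2 IH2|Fn P X rho IH
  |Fn P X rho IH|Fn P X c|Fn P X c rho IH|Fn P X rho IH] M N fX rG rS w /=.
- exact: los_oatom.
- by apply: los_and; [exact: IH1|exact: IH2].
- exact/los_not/IH.
- apply: (los_oex fX rG w (b := fun i w' => hofol_sat (M i) w' rho)) => w'.
  exact: (IH M N (filter_finite_option fX) rG rS).
- exact: los_onom.
- by apply: (los_oat fX rS c (B := fun v => hofol_sat N v rho)
    (b := fun i v => hofol_sat (M i) v rho)); exact: IH.
- apply: (los_ex (a := fun i d =>
    hofol_sat (expand_var (M i) d) (fun x => r (w x) i) rho) rG) => d.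
  exact: (IH (fun i => expand_var (M i) (r d i)) _ fX rG
    (str_germs_expand rS (fun=> d))).
Qed.

Lemma los_hmofol (Fn P : nat -> Type) (X : Type) (rho : hmofol_sen Fn P X)
    (D : T -> Type) (E : Type)
    (M : forall i, fo_str Fn P (D i)) (N : fo_str Fn P E)
      (r : E -> forall i, D i) :
  filter_finite F X -> germs F r -> str_germs F M N r -> forall w,
  hmofol_sat N w rho <-> F [set i | hmofol_sat (M i) (fun x => r (w x) i) rho].
Proof.
elim: rho M N => {Fn P X} [Fn P X n pi t|Fn P X rho1 IH1 rho2 IH2|Fn P X rho IH
  |Fn P X rho IH|Fn P X n pi rho IH|Fn P X c|Fn P X c rho IH|Fn P X rho IH]
  M N fX rG rS w /=.
- exact: los_oatom.
- by apply: los_and; [exact: IH1|exact: IH2].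
- exact/los_not/IH.
- apply: (los_oex fX rG w (b := fun i w' => hmofol_sat (M i) w' rho)) => w'.
  exact: (IH M N (filter_finite_option fX) rG rS).
- apply: (los_omod fX rG rS pi w (B := fun k v => hmofol_sat N v (rho k))
    (b := fun k i v => hmofol_sat (M i) v (rho k))) => k v.
  exact: IH.
- exact: los_onom.
- by apply: (los_oat fX rS c (B := fun v => hmofol_sat N v rho)
    (b := fun i v => hmofol_sat (M i) v rho)); exact: IH.
- apply: (los_ex (a := fun i d =>
    hmofol_sat (expand_var (M i) d) (fun x => r (w x) i) rho) rG) => d.
  exact: (IH (fun i => expand_var (M i) (r d i)) _ fX rG
    (str_germs_expand rS (fun=> d))).
Qed.

End Los.

(** * Representatives of germs in an ultraproduct *)

Section Trace.
Context (T : Type) (F : set_system T) {UF : UltraFilter F} (J0 : set T).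

(** The restriction of [F] to [J0]. It lives on the subtype because representatives are defined only
    at indices in [J0]. *)
Definition trace : set_system {i | J0 i} :=
  [set A | F [set i | exists Ji : J0 i, A (exist _ i Ji)]].

Lemma traceS A B : A `<=` B -> trace A -> trace B.
Proof. by move=> AB; apply: (@filterS T F) => i [Ji /AB]; exists Ji. Qed.

Lemma traceI A B : trace A -> trace B -> trace (A `&` B).
Proof.
move=> FA FB; refine (@filterS T F _ _ _ _ (@filterI T F _ _ _ FA FB)).
move=> i [[Ji Ai] [Ji' Bi]].
by exists Ji; split=> //; rewrite (Prop_irrelevance Ji Ji').
Qed.

Lemma trace_restrict (A : set T) : F A -> F J0 -> trace [set i | A (sval i)].
Proof.
move=> FA FJ0; refine (@filterS T F _ _ _ _ (@filterI T F _ _ _ FA FJ0)).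
by move=> i [Ai Ji]; exists Ji.
Qed.

Lemma trace_base (A : set T) : trace [set i | A (sval i)] -> F A.
Proof. by apply: (@filterS T F) => i [Ji]. Qed.

Lemma trace_ultra : F J0 -> UltraFilter trace.
Proof.
move=> FJ0.
have FT : Filter trace.
  split.
  - by apply: (@filterS T F _ J0) => // i Ji; exists Ji.
  - exact: traceI.
  - exact: traceS.
have PT : ProperFilter trace.
  apply: Build_ProperFilter_ex FT => A FA.
  by have [i [Ji Ai]] := @filter_ex T F _ _ FA; exists (exist _ i Ji).
split=> // G GP FG; apply/seteqP; split=> [A GA|]; last exact: FG.
(* If [A] were missing from the trace, the trace and hence [G] would contain its complement, against
   the properness of [G]. *)
have [//|FnA] := in_ultra_setVsetC [set i | exists Ji : J0 i, A (exist _ i Ji)]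
  UF.
have : G (~` A).
  apply: FG; apply: filterS (filterI FJ0 FnA) => i [Ji nAi].
  by exists Ji => Ai; apply: nAi; exists Ji.
by move=> /(filterI GA)/filter_ex[i []].
Qed.

End Trace.

Section Representatives.
Context (C : category) (T : Type) (F : set_system T) {UF : UltraFilter F}.
Context (M : T -> C) (U : fproduct F M) (J0 : set T) (FJ0 : F J0).

(* r chooses, for each element of the ultraproduct, a section over all of J0
   that has it as its germ. *)
Definition represents (G : functor C Sets)
    (r : G (fp_obj U) -> forall i : {i | J0 i}, G (M (sval i))) : Prop :=
  forall K (FK : F K) k, trace F
    [set i : {i | J0 i} | exists Ki : K (sval i),
       r (fmap G (fp_in U FK) k) i = fmap G (fp_proj U FK Ki) k].

Let FF : Filter F := @filter_filter _ _ (@ultra_proper _ _ UF).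
Let UT : UltraFilter (@trace T F J0) := trace_ultra FJ0.
Let FT : Filter (@trace T F J0) := @filter_filter _ _ (@ultra_proper _ _ UT).

(** A germ comes from a section over some member of [F], which has to be filled up to all of [J0].
    If the factors over [J0] are inhabited, arbitrary values will do; if they are empty, the
    ultraproduct has no element to represent. *)
Lemma represents_ex (G : functor C Sets) : concrete G ->
  (forall i, J0 i -> inhabited (G (M i))) \/
  (forall i, J0 i -> ~ inhabited (G (M i))) ->
  exists r, @represents G r.
Proof.
move=> cG J0G; have H := cG T F FF M U.
have [r0] : inhabited (G (fp_obj U) -> forall i : {i | J0 i}, G (M (sval i))).
  case: J0G => J0G.
    split=> y [i Ji]; apply: (projT1 (cid (_ : exists x : G (M i), True))).
    by have [x] := J0G i Ji; exists x.
  split=> y; exfalso.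
  have [J [FJ [k _]]] := rp_surj H y.
  have [i [Ji J0i]] := filter_ex (filterI FJ FJ0).
  by apply: (J0G i J0i); split; exact: (fmap G (fp_proj U FJ Ji) k).
have ex y : exists s : (forall i : {i | J0 i}, G (M (sval i))),
    forall K (FK : F K) k, fmap G (fp_in U FK) k = y -> trace F
    [set i : {i | J0 i} | exists Ki : K (sval i), s i = fmap G (fp_proj U FK Ki)
      k].
  have [J [FJ [k kP]]] := rp_surj H y.
  exists (fun i => if pselect (J (sval i)) is left Ji
                   then fmap G (fp_proj U FJ Ji) k else r0 y i).
  move=> K FK l lP; have /(rp_eq H) : fmap G (fp_in U FJ) k = fmap G
    (fp_in U FK) l.
    by rewrite kP lP.
  move=> kl; refine (@filterS T F _ _ _ _ (@filterI T F _ _ _ kl FJ0)).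
  move=> i [[Ji [Ki e]] J0i].
  exists J0i, Ki => /=; case: pselect => // Ji'.
  by rewrite (Prop_irrelevance Ji' Ji).
have [r rP] := choice ex.
by exists r => K FK k; exact: rP.
Qed.

(** For the choice clause, witnesses taken on the member of [F] where they exist form a section, and
    the germ of that section is the required element. *)
Lemma represents_germs (G : functor C Sets) r :
  concrete G -> @represents G r -> germs (@trace T F J0) r.
Proof.
move=> cG rP; have H := cG T F FF M U; split=> [y z yz|A FA].
  have [J [FJ [k kP]]] := rp_surj H y; have [K [FK [l lP]]] := rp_surj H z.
  rewrite -kP -lP; apply/(rp_eq H).
  have := rP J FJ k; have := rP K FK l; rewrite kP lP => rl rk.
  have : trace F [set i : {i | J0 i} | exists (Ji : J (sval i))
    (Ki : K (sval i)),
      fmap G (fp_proj U FJ Ji) k = fmap G (fp_proj U FK Ki) l].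
    apply: traceS (traceI yz (traceI rk rl)) => i [/= e [[Ji ek] [Ki el]]].
    by exists Ji, Ki; rewrite -ek -el.
  exact: trace_base.
(* The witness is made independent of the proof of membership in [J0]. *)
have ex i : (exists Ji : J0 i, exists x, A (exist _ i Ji) x) ->
    exists x : G (M i), forall Ji : J0 i, A (exist _ i Ji) x.
  by move=> [Ji [x Ax]]; exists x => Ji'; rewrite (Prop_irrelevance Ji' Ji).
have [k kP] := rp_section H FA (fun i Ai => projT1 (cid (ex i Ai))).
exists (fmap G (fp_in U FA) k).
apply: traceS (rP _ FA k) => -[i Ji] [Ai /= ->].
rewrite kP; exact: (projT2 (cid (ex i Ai))).
Qed.

(** The bridge between the definition of preservation, which asks for some section satisfying [R] on
    its whole domain, and Los's theorem, which speaks of the chosen representatives. From the second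
    to the first, any section with germ [y] is restricted to the indices where [R] holds. *)
Lemma represents_factors (G : functor C Sets) r (R : forall A : C, set (G A)) y
  :
  concrete G -> @represents G r ->
  (satisfied_on_factors R y <-> trace F [set i | R (M (sval i)) (r y i)]).
Proof.
move=> cG rP; have H := cG T F FF M U; split=> [[J [FJ [k [<- Rk]]]]|Ry].
  by apply: traceS (rP J FJ k) => i [Ji /= ->]; exact: Rk.
have [J [FJ [k kP]]] := rp_surj H y.
have FK : F [set i | exists Ji : J i, R (M i) (fmap G (fp_proj U FJ Ji) k)].
  have := rP J FJ k; rewrite kP => rk.
  have : trace F [set i : {i | J0 i} | exists Ji : J (sval i),
      R (M (sval i)) (fmap G (fp_proj U FJ Ji) k)].
    by apply: traceS (traceI Ry rk) => i [/= Ri [Ji e]]; exists Ji; rewrite -e.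
  exact: trace_base.
have KJ : [set i | exists Ji : J i, R (M i) (fmap G (fp_proj U FJ Ji) k)] `<=`
  J.
  by move=> i [].
have [l lk lP] := rp_restrict FF H FK k KJ.
exists _, FK, l; split=> [|i Ki]; first by rewrite lk.
by have [Ji] := Ki; rewrite (lP i Ki Ji).
Qed.

Lemma represents_determined (G : functor C Sets) r (R : forall A : C, set (G A))
  y :
  concrete G -> @represents G r -> determined_by_factors R ->
  (R (fp_obj U) y <-> trace F [set i | R (M (sval i)) (r y i)]).
Proof. by move=> cG rP dR; rewrite (dR _ _ _ _ U y); exact: represents_factors.
  Qed.

(** A natural operation commutes with projections and injections, so its value at a germ is
    represented by its values at the representatives. Function symbols are natural because arrows
    are homomorphisms. *)
Lemma represents_op (G H : functor C Sets) rG rH (o : forall A, G A -> H A) y :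
  (forall A B (h : hom A B) x, o B (fmap G h x) = fmap H h (o A x)) ->
  concrete G -> @represents G rG -> @represents H rH ->
  trace F [set i | rH (o _ y) i = o (M (sval i)) (rG y i)].
Proof.
move=> oN cG rGP rHP; have [J [FJ [k <-]]] := rp_surj (cG T F FF M U) y.
rewrite oN; apply: traceS (traceI (rGP J FJ k) (rHP J FJ (o _ k))).
move=> i [[Ji /= ->] [Ji' ->]].
by rewrite oN (Prop_irrelevance Ji Ji').
Qed.

Lemma represents_pair (G H : functor C Sets) rG rH :
  @represents G rG -> @represents H rH ->
  @represents (pair_functor G H) (fun y i => (rG y.1 i, rH y.2 i)).
Proof.
move=> rGP rHP J FJ [k l].
apply: traceS (traceI (rGP J FJ k) (rHP J FJ l)) => i [[Ji /= ->] [Ji' ->]].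
by exists Ji; rewrite (Prop_irrelevance Ji Ji').
Qed.

Lemma represents_power (X : finType) (G : functor C Sets) r :
  @represents G r -> @represents (power_functor X G) (fun y i x => r (y x) i).
Proof.
move=> rP J FJ k.
have e := @filter_finite_finType _ _ FT X _ (fun x => rP J FJ (k x)).
apply: traceS (traceI (trace_restrict FJ FJ0) e) => i [Ji {}e]; exists Ji.
apply/funext => x /=; have [Ji' ->] := e x.
by rewrite (Prop_irrelevance Ji Ji').
Qed.

End Representatives.

Lemma ultra_dichotomy (T : Type) (F : set_system T) (X : T -> Type) :
  UltraFilter F -> exists2 J, F J &
    (forall i, J i -> inhabited (X i)) \/ (forall i, J i -> ~ inhabited (X i)).
Proof.
move=> UF; have [FX|FX] := in_ultra_setVsetC [set i | inhabited (X i)] UF.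
  by exists [set i | inhabited (X i)] => //; left.
by exists (~` [set i | inhabited (X i)]) => //; right.
Qed.

(** Two carriers must be represented over the same [J0], since atomic relations mix worlds with
    individuals or with lower worlds. Intersecting the two members of [F] keeps both
    alternatives. *)
Lemma representatives2 (C : category) (T : Type) (F : set_system T)
    (M : T -> C) (U : fproduct F M) (G H : functor C Sets) : UltraFilter F ->
  concrete G -> concrete H ->
  exists (J0 : set T) (r : G (fp_obj U) -> forall i : {i | J0 i}, G
    (M (sval i)))
         (s : H (fp_obj U) -> forall i : {i | J0 i}, H (M (sval i))),
    [/\ F J0, represents r & represents s].
Proof.
move=> UF cG cH.
have [J FJ dJ] := ultra_dichotomy (fun i => G (M i)) UF.
have [K FK dK] := ultra_dichotomy (fun i => H (M i)) UF.
have FJK : F (J `&` K) by exact: filterI.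
have [|r rP] := @represents_ex C T F UF M U (J `&` K) FJK G cG.
- by case: dJ => dJ; [left|right] => i [Ji _]; exact: dJ.
have [|s sP] := @represents_ex C T F UF M U (J `&` K) FJK H cH.
- by case: dK => dK; [left|right] => i [_ Ki]; exact: dK.
by exists (J `&` K), r, s.
Qed.

(** Moves atomic relations from frames to models: a forgetful functor sends an F-product of models
    to an F-product of frames. *)
Lemma determined_comp (C D : category) (G : functor D Sets) (H : functor C D)
    (R : forall A : D, set (G A)) :
  determined_by_factors R -> preserves_fproducts H ->
  determined_by_factors (G := functor_comp G H) (fun A => R (H A)).
Proof.
move=> dR pH T F FF M U y.
exact: (dR T F FF _ (fproduct_image (pH T F FF M U)) y).
Qed.

(** * Compatibility of representatives with frames and nominals *)

Section ModalGerms.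
Context (C : category) (T : Type) (F : set_system T) {UF : UltraFilter F}.
Context (M : T -> C) (U : fproduct F M) (J0 : set T) (FJ0 : F J0).

Lemma acc_germs_of (H : functor C kframes)
    (r : kworld (H (fp_obj U)) -> forall i : {i | J0 i}, kworld
      (H (M (sval i)))) :
  preserves_fproducts H ->
  represents (G := functor_comp (states kframes) H) r ->
  acc_germs (@trace T F J0) (V := fun i => H (M (sval i))) (W := H (fp_obj U))
    r.
Proof.
move=> pH rP w w'.
have cS : concrete (functor_comp (states kframes) H).
  move=> T' F' FF M' U'.
  exact: (kframes_concrete.2 _ _ FF _ (fproduct_image (pH _ _ FF _ U'))).
exact: (@represents_determined C T F UF M U J0
  (pair_functor (functor_comp (states kframes) H)
    (functor_comp (states kframes) H))
  _ (fun A => @acc_pair (H A)) (w, w')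
  (pair_functor_concrete cS cS) (represents_pair rP rP)
  (determined_comp acc_determined pH)).
Qed.

Lemma prel_germs_of (L : nat -> Type) (H : functor C (pframes L))
    (r : pworld (H (fp_obj U)) -> forall i : {i | J0 i}, pworld
      (H (M (sval i)))) :
  preserves_fproducts H ->
  represents (G := functor_comp (states (pframes L)) H) r ->
  prel_germs (@trace T F J0) (V := fun i => H (M (sval i))) (W := H (fp_obj U))
    r.
Proof.
move=> pH rP n lam a.
have cS : concrete (functor_comp (states (pframes L)) H).
  move=> T' F' FF M' U'.
  exact: ((pframes_concrete L).2 _ _ FF _ (fproduct_image (pH _ _ FF _ U'))).
exact: (@represents_determined C T F UF M U J0
  (power_functor 'I_n (functor_comp (states (pframes L)) H))
  _ (fun A => @prel_tuple L n lam (H A)) a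
  (power_functor_concrete 'I_n cS) (represents_power FJ0 rP)
  (determined_comp (prel_determined lam) pH)).
Qed.

Lemma nom_germs_of (K : stratified_category) (Nom : Type)
    (H : functor C (nominateds K Nom))
    (r : state (H (fp_obj U)) -> forall i : {i | J0 i}, state (H (M (sval i))))
      :
  represents (G := functor_comp (states (nominateds K Nom)) H) r ->
  nom_germs (@trace T F J0) (V := fun i => H (M (sval i))) (W := H (fp_obj U))
    r.
Proof.
(* The nominal is followed from the product over the whole index set: arrows preserve nominals, so
   the injection sends it to the nominal of the ultraproduct and the projections send it to those of
   the factors. *)
move=> rP c; have FT : F setT by exact: filterT.
have := rP _ FT (nomi (H (fp_prod U FT)) c).
have e := svalP (fmap H (fp_in U FT)) c; rewrite /smap in e; rewrite /= e.
apply: traceS => i [Ti /= ->].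
exact: (svalP (fmap H (fp_proj U FT Ti)) c).
Qed.

End ModalGerms.

(** * Compactness from ultraproducts *)

Section Compactness.
Context (I : stratified_institution).
Hypothesis cI : forall S : ssig I, concrete_fproducts (smod S).
Hypothesis los : forall (S : ssig I) (rho : ssen S) T (F : set_system T),
  UltraFilter F -> forall (M : T -> smod S) (U : fproduct F M) w,
    ssat (fp_obj U) w rho <-> satisfied_by_factors rho w.

Section Signature.
Context (S : ssig I).

(** The cones of finite subsets above a given one are closed under intersection up to inclusion, by
    taking unions, so they generate a proper filter. The cone above the singleton of [rho] gives the
    second clause. *)
Lemma finite_subset_ultrafilter (E : set (ssen S)) :
  exists F : set_system {E0 : set (ssen S) | finite_set E0 /\ E0 `<=` E},
    UltraFilter F /\ forall rho, E rho -> F [set E0 | sval E0 rho].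
Proof.
pose T := {E0 : set (ssen S) | finite_set E0 /\ E0 `<=` E}.
pose G : set_system T := [set A | exists E0 : T, forall E1 : T,
  sval E0 `<=` sval E1 -> A E1].
have T0 : T by exists set0; split; [exact: finite_set0|exact: sub0set].
have GF : ProperFilter G.
  apply: Build_ProperFilter_ex => [A [E0 E0A]|]; first by exists E0; exact: E0A.
  split=> [|A B [E0 E0A] [E1 E1B]|A B AB [E0 E0A]]; first by exists T0.
    have E01 : finite_set (sval E0 `|` sval E1) /\ sval E0 `|` sval E1 `<=` E.
      case: (svalP E0) => f0 s0; case: (svalP E1) => f1 s1.
      by split; [rewrite finite_setU|rewrite subUset].
    exists (exist _ (sval E0 `|` sval E1) E01) => E2 /= E2s; split.
      by apply: E0A => x ?; apply: E2s; left.
    by apply: E1B => x ?; apply: E2s; right.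
  by exists E0 => E1 /E0A/AB.
have [F [UF GsF]] := ultraFilterLemma GF.
exists F; split=> // rho Erho; apply: GsF.
have E1 : finite_set [set rho] /\ [set rho] `<=` E by split=> // _ ->.
by exists (exist _ [set rho] E1) => E2; exact.
Qed.

(** Preservation wants truth on the whole domain of a section; restricting the section to the
    indices where [rho] holds does not change its germ. *)
Lemma sat_of_factors T (F : set_system T) (M : T -> smod S) (U : fproduct F M)
    J (FJ : F J) (k : state (fp_prod U FJ)) rho : UltraFilter F ->
  F [set i | forall Ji : J i, ssat (M i) (smap (fp_proj U FJ Ji) k) rho] ->
  ssat (fp_obj U) (smap (fp_in U FJ) k) rho.
Proof.
move=> UF FA; have FF : Filter F by exact: filter_filter.
apply/los.
have H := (cI S).2 T F FF M U.
have FK : F (J `&` [set i | forall Ji : J i,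
    ssat (M i) (smap (fp_proj U FJ Ji) k) rho]) by exact: filterI.
have [l lk lP] := rp_restrict FF H FK k (@subIsetl _ _ _).
rewrite /satisfied_by_factors; exists _, FK, l; split=> // i Ki.
by have [Ji Ri] := Ki; rewrite /smap (lP i Ki Ji); exact: Ri.
Qed.

Lemma factors_of_sat T (F : set_system T) (M : T -> smod S) (U : fproduct F M)
    J (FJ : F J) (k : state (fp_prod U FJ)) rho : UltraFilter F ->
  ssat (fp_obj U) (smap (fp_in U FJ) k) rho ->
  F [set i | exists Ji : J i, ssat (M i) (smap (fp_proj U FJ Ji) k) rho].
Proof.
move=> UF /los[K [FK [l [lk lR]]]]; have FF : Filter F by exact: filter_filter.
have H := (cI S).2 T F FF M U.
move: lk => /(rp_eq H); apply: filterS => i [Ki [Ji e]].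
by exists Ji; rewrite /smap -e; exact: lR.
Qed.

(** No F-product of pointed models is formed: the points [w] are a section over the whole index set,
    and its germ serves as the point of the ultraproduct. *)
Lemma pointed_ultraproduct T (F : set_system T) (M : T -> smod S)
    (w : forall i, state (M i)) : UltraFilter F ->
  exists (N : smod S) (v : state N), forall rho,
    ssat N v rho <-> F [set i | ssat (M i) (w i) rho].
Proof.
move=> UF; have FF : Filter F by exact: filter_filter.
have [U] := (cI S).1 T F FF M.
have H := (cI S).2 T F FF M U; have FT : F setT by exact: filterT.
have [k kP] := rp_section H FT (fun i _ => w i).
exists (fp_obj U), (smap (fp_in U FT) k) => rho; split=> [Uk|Fw].
  by have := factors_of_sat UF Uk; apply: filterS => i [Ti]; rewrite /smap kP.
by apply: sat_of_factors; apply: filterS Fw => i Ri Ti; rewrite /smap kP.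
Qed.

End Signature.

Lemma local_m_compact : m_compact (local_institution I).
Proof.
move=> S E; split=> [[M ME] E0 _ E0E|H]; first by exists M => rho /E0E/ME.
have [F [UF FE]] := finite_subset_ultrafilter E.
have /choice [M MP] (E0 : {E0 : set (ssen S) | finite_set E0 /\ E0 `<=` E}) :
    exists M : imod (i := local_institution I) S, satisfies M (sval E0).
  by apply: H; have [] := svalP E0.
have [N [v Nv]] := pointed_ultraproduct (fun i => tagged (M i)) UF.
exists (existT _ N v) => rho Erho; apply/Nv.
by apply: filterS (FE rho Erho) => i; exact: MP.
Qed.

Lemma global_m_compact : m_compact (global_institution I).
Proof.
move=> S E; split=> [[M ME] E0 _ E0E|H]; first by exists M => rho /E0E/ME.
have [F [UF FE]] := finite_subset_ultrafilter E.
have /choice [M MP] (E0 : {E0 : set (ssen S) | finite_set E0 /\ E0 `<=` E}) :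
    exists M : imod (i := global_institution I) S, satisfies M (sval E0).
  by apply: H; have [] := svalP E0.
have FF : Filter F by exact: filter_filter.
have [U] := (cI S).1 _ F FF M.
exists (fp_obj U) => rho Erho w.
(* Every state is the germ of some section, and almost all factors satisfy [rho] at all their
   states, in particular along that section. *)
have [J [FJ [k <-]]] := rp_surj ((cI S).2 _ F FF M U) w.
apply: sat_of_factors; apply: filterS (FE rho Erho) => i irho Ji.
exact: (MP i rho irho).
Qed.

Lemma local_compact : compact (local_institution I).
Proof.
move=> S E rho Erho; apply: contrapT => nE.
have [F [UF FE]] := finite_subset_ultrafilter E.
have /choice [M MP] (E0 : {E0 : set (ssen S) | finite_set E0 /\ E0 `<=` E}) :
    exists M : imod (i := local_institution I) S,
      satisfies M (sval E0) /\ ~ isat M rho.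
  have [fE0 sE0] := svalP E0; apply: contrapT => nM; apply: nE.
  exists (sval E0); split=> // M ME0; apply: contrapT => nMrho.
  by apply: nM; exists M.
have [N [v Nv]] := pointed_ultraproduct (fun i => tagged (M i)) UF.
(* The ultraproduct of counterexamples satisfies [E], hence [rho]; then [rho] holds in some factor,
   where it was chosen to fail. *)
have : isat (i := local_institution I) (existT _ N v) rho.
  apply: Erho => r Er; apply/Nv.
  by apply: filterS (FE r Er) => i; exact: (MP i).1.
by move=> /Nv/filter_ex[i]; exact: (MP i).2.
Qed.

End Compactness.

(** * The thirteen logics *)

Section Logics.
Context (T : Type) (F : set_system T) {UF : UltraFilter F}.

Lemma representatives (C : category) (M : T -> C) (U : fproduct F M)
    (G : functor C Sets) : concrete G ->
  exists (J0 : set T) (r : G (fp_obj U) -> forall i : {i | J0 i}, G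
    (M (sval i))),
    F J0 /\ represents r.
Proof.
move=> cG; have [J0 [r [_ [FJ0 rP _]]]] := representatives2 U UF cG cG.
by exists J0, r.
Qed.

(** The common part of the four propositional logics over a single frame: representatives of worlds
    and their compatibility with valuations. Frame conditions differ between the logics and are left
    to the premise. *)
Lemma prop_los (K : stratified_category) (P : Type) (sen : Type)
    (sat : forall M : prop_models K P, state M -> sen -> Prop) :
  concrete_fproducts K ->
  (forall (M : T -> prop_models K P) (U : fproduct F M) (J0 : set T)
      (r : state (fp_obj U) -> forall i : {i | J0 i}, state (M (sval i))) rho w,
    F J0 -> represents r -> germs (@trace T F J0) r ->
    val_germs (@trace T F J0) (M := fun i => M (sval i)) (N := fp_obj U) r ->
    sat (fp_obj U) w rho <-> @trace T F J0
      [set i | sat (M (sval i)) (r w i) rho]) ->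
  forall (M : T -> prop_models K P) (U : fproduct F M) rho w,
    sat (fp_obj U) w rho <->
    satisfied_on_factors (G := states (prop_models K P))
      (fun A v => sat A v rho) w.
Proof.
move=> cK H M U rho w; have cP := prop_models_concrete P cK.
have [J0 [r [FJ0 rP]]] := representatives U cP.2.
rewrite (represents_factors (fun A v => sat A v rho) w cP.2 rP).
apply: H => //; first exact: (represents_germs cP.2 rP).
move=> v pi.
exact: (@represents_determined _ _ _ _ _ U J0 (states (prop_models K P)) r
  (@val_pred K P pi) v cP.2 rP (val_determined cK pi)).
Qed.

(** The same reduction for the first order modal logics, with worlds and individuals represented
    over one [J0]. Symbols act on pairs of a world and a tuple, whence the functor in [rPn] and
    [cGn]. *)
Lemma fo_los (K : stratified_category) (Fn P : nat -> Type) (sen : Type)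
    (sat : forall M : fo_models K Fn P, state M -> sen -> Prop) :
  concrete_fproducts K ->
  (forall (M : T -> fo_models K Fn P) (U : fproduct F M) (J0 : set T)
      (r0 : state (fp_obj U) -> forall i : {i | J0 i}, state (M (sval i)))
      (r1 : fm_dom (fp_obj U) -> forall i : {i | J0 i}, fm_dom (M (sval i))) rho
        w,
    F J0 -> represents r0 -> germs (@trace T F J0) r0 -> germs (@trace T F J0)
      r1 ->
    fo_germs (@trace T F J0) (M := fun i => M (sval i)) (N := fp_obj U) r0 r1 ->
    sat (fp_obj U) w rho <-> @trace T F J0
      [set i | sat (M (sval i)) (r0 w i) rho]) ->
  forall (M : T -> fo_models K Fn P) (U : fproduct F M) rho w,
    sat (fp_obj U) w rho <->
    satisfied_on_factors (G := states (fo_models K Fn P))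
      (fun A v => sat A v rho) w.
Proof.
move=> cK H M U rho w; have cS := fo_models_concrete Fn P cK.
have cD := @fo_dom_concrete K Fn P cK.
have [J0 [r0 [r1 [FJ0 rP0 rP1]]]] := representatives2 U UF cS.2 cD.
rewrite (represents_factors (fun A v => sat A v rho) w cS.2 rP0).
have G0 : germs (@trace T F J0) r0 by exact: (represents_germs cS.2 rP0).
have G1 : germs (@trace T F J0) r1 by exact: (represents_germs cD rP1).
refine (H M U J0 r0 r1 rho w FJ0 rP0 G0 G1 _); move=> v.
have rPn n : represents (G := pair_functor (states (fo_models K Fn P))
    (power_functor 'I_n (fo_dom K Fn P)))
      (fun y i => (r0 y.1 i, fun x => r1 (y.2 x) i)).
  exact: (represents_pair rP0 (represents_power FJ0 (X := 'I_n) rP1)).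
have cGn n := pair_functor_concrete cS.2 (power_functor_concrete 'I_n cD).
split=> [n f a|n pi a].
  pose o (A : fo_models K Fn P) (x : state A * ('I_n -> fm_dom A)) := fn
    (fm_str A x.1) f x.2.
  refine (@represents_op _ _ _ _ _ U J0 (pair_functor (states (fo_models K Fn
    P))
    (power_functor 'I_n (fo_dom K Fn P))) (fo_dom K Fn P) _ r1 o (v, a) _
      (cGn n) (rPn n) rP1).
  by move=> A B h x; exact: (esym (((svalP h).2 x.1).1 n f x.2)).
exact: (@represents_determined _ _ _ _ _ U J0
  (pair_functor (states (fo_models K Fn P))
  (power_functor 'I_n (fo_dom K Fn P))) _ (@fo_rel K Fn P n pi) (v, a) (cGn n)
    (rPn n)
  (fo_rel_determined cK pi)).
Qed.

End Logics.

(** * Los's theorem for ultraproducts in each logic *)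

Section LogicsLos.
Context (T : Type) (F : set_system T) {UF : UltraFilter F}.

(* The two composites agree on objects and arrows but differ in the proofs of
   their functor laws. *)
Lemma represents_compA (C D E : category) (G : functor E Sets)
    (H : functor D E) (H' : functor C D) (M : T -> C) (U : fproduct F M)
      (J0 : set T)
    (r : G (H (H' (fp_obj U))) -> forall i : {i | J0 i}, G
      (H (H' (M (sval i))))) :
  represents (G := functor_comp (functor_comp G H) H') r ->
  represents (G := functor_comp G (functor_comp H H')) r.
Proof. by []. Qed.

Lemma prop_nom_represents (K : stratified_category) (Nom P : Type)
    (M : T -> prop_models (nominateds K Nom) P) (U : fproduct F M) (J0 : set T)
    (r : state (fp_obj U) -> forall i : {i | J0 i}, state (M (sval i))) :
  represents (G := states (prop_models (nominateds K Nom) P)) r ->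
  represents (G := functor_comp (states K)
    (functor_comp (nom_forget K Nom) (prop_forget (nominateds K Nom) P))) r.
Proof. exact: represents_compA. Qed.

Lemma fo_nom_represents (K : stratified_category) (Nom : Type)
  (Fn P : nat -> Type)
    (M : T -> fo_models (nominateds K Nom) Fn P) (U : fproduct F M) (J0 : set T)
    (r : state (fp_obj U) -> forall i : {i | J0 i}, state (M (sval i))) :
  represents (G := states (fo_models (nominateds K Nom) Fn P)) r ->
  represents (G := functor_comp (states K)
    (functor_comp (nom_forget K Nom) (fo_frame (nominateds K Nom) Fn P))) r.
Proof. exact: represents_compA. Qed.

Lemma mpl_los (P : Type) (M : T -> prop_models kframes P)
    (U : fproduct F M) (rho : mpl_sen P) w :
  @mpl_sat P (fp_obj U) w rho <-> satisfied_on_factors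
    (G := states (prop_models kframes P)) (fun A v => @mpl_sat P A v rho) w.
Proof.
have cL := kframes_concrete.
apply: (prop_los (sat := @mpl_sat P) cL).
move=> {}M {}U J0 r {}rho {}w FJ0 rP rG rV.
have UT : UltraFilter (@trace T F J0) by exact: trace_ultra.
have rA := @acc_germs_of _ _ _ UF _ _ _ (prop_forget kframes P) r
  (prop_forget_preserves (P := P) cL) rP.
exact (@los_mpl _ _ UT _ (fun i => M (sval i)) (fp_obj U) r rG rA rV rho w).
Qed.

Lemma hpl_los (Nom : Type) (P : Type) (M : T -> prop_models (nominateds kframes
  Nom) P)
    (U : fproduct F M) (rho : hpl_sen Nom P) w :
  @hpl_sat Nom P (fp_obj U) w rho <-> satisfied_on_factors
    (G := states (prop_models (nominateds kframes Nom) P))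
      (fun A v => @hpl_sat Nom P A v rho) w.
Proof.
have cL := kframes_concrete.
have cK := nominateds_concrete Nom cL.
apply: (prop_los (sat := @hpl_sat Nom P) cK).
move=> {}M {}U J0 r {}rho {}w FJ0 rP rG rV.
have UT : UltraFilter (@trace T F J0) by exact: trace_ultra.
have rA := @acc_germs_of _ _ _ UF _ _ _ (functor_comp (nom_forget kframes Nom)
  (prop_forget (nominateds kframes Nom) P)) r
  (preserves_fproducts_comp (nom_forget_preserves (Nom := Nom) cL)
    (prop_forget_preserves (P := P) cK)) (prop_nom_represents rP).
have rN := @nom_germs_of _ _ _ UF _ _ _ _ _
  (prop_forget (nominateds kframes Nom) P) r rP.
exact (@los_hpl _ _ UT _ _ rho (fun i => M (sval i)) (fp_obj U) r rG rA rN rV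
  w).
Qed.

Lemma mmpl_los (L : nat -> Type) (P : Type) (M : T -> prop_models (pframes L) P)
    (U : fproduct F M) (rho : mmpl_sen L P) w :
  @mmpl_sat L P (fp_obj U) w rho <-> satisfied_on_factors
    (G := states (prop_models (pframes L) P)) (fun A v => @mmpl_sat L P A v rho)
      w.
Proof.
have cL := pframes_concrete L.
apply: (prop_los (sat := @mmpl_sat L P) cL).
move=> {}M {}U J0 r {}rho {}w FJ0 rP rG rV.
have UT : UltraFilter (@trace T F J0) by exact: trace_ultra.
have rA := @prel_germs_of _ _ _ UF _ _ _ FJ0 _ (prop_forget (pframes L) P) r
  (prop_forget_preserves (P := P) cL) rP.
exact (@los_mmpl _ _ UT _ _ (fun i => M (sval i)) (fp_obj U) r rG rA rV rho w).
Qed.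

Lemma mhpl_los (L : nat -> Type) (Nom : Type) (P : Type)
  (M : T -> prop_models (nominateds (pframes L) Nom) P)
    (U : fproduct F M) (rho : mhpl_sen L Nom P) w :
  @mhpl_sat L Nom P (fp_obj U) w rho <-> satisfied_on_factors
    (G := states (prop_models (nominateds (pframes L) Nom) P))
      (fun A v => @mhpl_sat L Nom P A v rho) w.
Proof.
have cL := pframes_concrete L.
have cK := nominateds_concrete Nom cL.
apply: (prop_los (sat := @mhpl_sat L Nom P) cK).
move=> {}M {}U J0 r {}rho {}w FJ0 rP rG rV.
have UT : UltraFilter (@trace T F J0) by exact: trace_ultra.
have rA := @prel_germs_of _ _ _ UF _ _ _ FJ0 _
  (functor_comp (nom_forget (pframes L) Nom)
  (prop_forget (nominateds (pframes L) Nom) P)) r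
  (preserves_fproducts_comp (nom_forget_preserves (Nom := Nom) cL)
    (prop_forget_preserves (P := P) cK)) (prop_nom_represents rP).
have rN := @nom_germs_of _ _ _ UF _ _ _ _ _ (prop_forget (nominateds (pframes L)
  Nom) P) r rP.
exact (@los_mhpl _ _ UT _ _ _ rho (fun i => M (sval i)) (fp_obj U) r rG rA rN rV
  w).
Qed.

Lemma mfol_los (Fn P : nat -> Type) (M : T -> fo_models kframes Fn P)
    (U : fproduct F M) (rho : mfol_sen Fn P) w :
  @mfol_sat Fn P (fp_obj U) w rho <-> satisfied_on_factors
    (G := states (fo_models kframes Fn P)) (fun A v => @mfol_sat Fn P A v rho)
      w.
Proof.
have cL := kframes_concrete.
apply: (fo_los (sat := @mfol_sat Fn P) cL).
move=> {}M {}U J0 r r1 {}rho {}w FJ0 rP rG rG1 rS.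
have UT : UltraFilter (@trace T F J0) by exact: trace_ultra.
have rA := @acc_germs_of _ _ _ UF _ _ _ (fo_frame kframes Fn P) r
  (fo_frame_preserves (F := Fn) (P := P) cL) rP.
exact (@los_mfol _ _ UT _ _ rho (fun i => M (sval i)) (fp_obj U) r r1 rG rG1 rA
  rS w).
Qed.

Lemma hfol_los (Nom : Type) (Fn P : nat -> Type)
  (M : T -> fo_models (nominateds kframes Nom) Fn P)
    (U : fproduct F M) (rho : hfol_sen Nom Fn P) w :
  @hfol_sat Nom Fn P (fp_obj U) w rho <-> satisfied_on_factors
    (G := states (fo_models (nominateds kframes Nom) Fn P))
      (fun A v => @hfol_sat Nom Fn P A v rho) w.
Proof.
have cL := kframes_concrete.
have cK := nominateds_concrete Nom cL.
apply: (fo_los (sat := @hfol_sat Nom Fn P) cK).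
move=> {}M {}U J0 r r1 {}rho {}w FJ0 rP rG rG1 rS.
have UT : UltraFilter (@trace T F J0) by exact: trace_ultra.
have rA := @acc_germs_of _ _ _ UF _ _ _ (functor_comp (nom_forget kframes Nom)
  (fo_frame (nominateds kframes Nom) Fn P)) r
  (preserves_fproducts_comp (nom_forget_preserves (Nom := Nom) cL)
    (fo_frame_preserves (F := Fn) (P := P) cK)) (fo_nom_represents rP).
have rN := @nom_germs_of _ _ _ UF _ _ _ _ _
  (fo_frame (nominateds kframes Nom) Fn P) r rP.
exact (@los_hfol _ _ UT _ _ _ rho (fun i => M (sval i)) (fp_obj U) r r1 rG rG1
  rA rN rS w).
Qed.

Lemma mmfol_los (L Fn P : nat -> Type) (M : T -> fo_models (pframes L) Fn P)
    (U : fproduct F M) (rho : mmfol_sen L Fn P) w :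
  @mmfol_sat L Fn P (fp_obj U) w rho <-> satisfied_on_factors
    (G := states (fo_models (pframes L) Fn P))
      (fun A v => @mmfol_sat L Fn P A v rho) w.
Proof.
have cL := pframes_concrete L.
apply: (fo_los (sat := @mmfol_sat L Fn P) cL).
move=> {}M {}U J0 r r1 {}rho {}w FJ0 rP rG rG1 rS.
have UT : UltraFilter (@trace T F J0) by exact: trace_ultra.
have rA := @prel_germs_of _ _ _ UF _ _ _ FJ0 _ (fo_frame (pframes L) Fn P) r
  (fo_frame_preserves (F := Fn) (P := P) cL) rP.
exact (@los_mmfol _ _ UT _ _ _ rho (fun i => M (sval i)) (fp_obj U) r r1 rG rG1
  rA rS w).
Qed.

Lemma mhfol_los (L Fn P : nat -> Type) (Nom : Type)
  (M : T -> fo_models (nominateds (pframes L) Nom) Fn P)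
    (U : fproduct F M) (rho : mhfol_sen L Nom Fn P) w :
  @mhfol_sat L Nom Fn P (fp_obj U) w rho <-> satisfied_on_factors
    (G := states (fo_models (nominateds (pframes L) Nom) Fn P))
      (fun A v => @mhfol_sat L Nom Fn P A v rho) w.
Proof.
have cL := pframes_concrete L.
have cK := nominateds_concrete Nom cL.
apply: (fo_los (sat := @mhfol_sat L Nom Fn P) cK).
move=> {}M {}U J0 r r1 {}rho {}w FJ0 rP rG rG1 rS.
have UT : UltraFilter (@trace T F J0) by exact: trace_ultra.
have rA := @prel_germs_of _ _ _ UF _ _ _ FJ0 _
  (functor_comp (nom_forget (pframes L) Nom)
  (fo_frame (nominateds (pframes L) Nom) Fn P)) r
  (preserves_fproducts_comp (nom_forget_preserves (Nom := Nom) cL)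
    (fo_frame_preserves (F := Fn) (P := P) cK)) (fo_nom_represents rP).
have rN := @nom_germs_of _ _ _ UF _ _ _ _ _
  (fo_frame (nominateds (pframes L) Nom) Fn P) r rP.
exact (@los_mhfol _ _ UT _ _ _ _ rho (fun i => M (sval i)) (fp_obj U) r r1 rG
  rG1 rA rN rS w).
Qed.

Lemma hhpl_los (N0 N1 P : Type) (M : T -> hhpl_models N0 N1 P)
    (U : fproduct F M) (rho : hhpl_sen N0 N1 P) w :
  @hhpl_sat N0 N1 P (fp_obj U) w rho <-> satisfied_on_factors
    (G := states (hhpl_models N0 N1 P)) (fun A v => @hhpl_sat N0 N1 P A v rho)
      w.
Proof.
have cS := hhpl_models_concrete N0 N1 P; have cD := @hh_lowF_concrete N0 N1 P.
have [J0 [r0 [r1 [FJ0 rP0 rP1]]]] := representatives2 U UF cS.2 cD.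
have G0 : germs (@trace T F J0) r0 by exact: (represents_germs cS.2 rP0).
have G1 : germs (@trace T F J0) r1 by exact: (represents_germs cD rP1).
have UT : UltraFilter (@trace T F J0) by exact: trace_ultra.
rewrite (@represents_factors _ _ _ _ _ U J0 (states (hhpl_models N0 N1 P)) r0
  (fun (A : hhpl_models N0 N1 P) v => @hhpl_sat N0 N1 P A v rho) w cS.2 rP0).
pose H := hh_frameF N0 N1 P.
refine (@los_hhpl _ _ UT _ _ _ rho (fun i => M (sval i)) (fp_obj U) r0 r1
  G0 G1 _ _ _ _ _ w).
- exact: (@acc_germs_of _ _ _ UF _ _ _ (functor_comp (nom_forget kframes N1) H)
  r0
    (preserves_fproducts_comp
      (nom_forget_preserves (Nom := N1) kframes_concrete)
      (@hh_frameF_preserves N0 N1 P))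
    (represents_compA (G := states kframes) (H := nom_forget kframes N1)
      (H' := H) rP0)).
- exact: (@nom_germs_of _ _ _ UF _ _ _ _ _ H r0 rP0).
(* Lower nominals are common to all upper worlds and are handled like the upper ones, through the
   product over the whole index set. *)
- move=> c; have FT : F setT by exact: filterT.
  have := rP1 _ FT (hh_nom0 (fp_prod U FT) c).
  have e : fmap (hh_lowF N0 N1 P) (fp_in U FT) (hh_nom0 (fp_prod U FT) c) =
      hh_nom0 (fp_obj U) c by exact: ((svalP (fp_in U FT)).1 c).
  rewrite e.
  apply: traceS => i [Ti ri].
  exact: (etrans ri ((svalP (fp_proj U FT Ti)).1 c)).
- move=> v x x'; exact: (@represents_determined _ _ _ _ _ U J0 _ _
    (@hh_acc_rel N0 N1 P) (v, (x, x'))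
    (pair_functor_concrete cS.2 (pair_functor_concrete cD cD))
    (represents_pair rP0 (represents_pair rP1 rP1))
      (@hh_acc_determined N0 N1 P)).
- move=> v x pi; exact: (@represents_determined _ _ _ _ _ U J0 _ _
    (@hh_val_rel N0 N1 P pi) (v, x)
    (pair_functor_concrete cS.2 cD) (represents_pair rP0 rP1)
    (@hh_val_determined N0 N1 P pi)).
Qed.

(** Only the carrier needs representatives: a state is an [X]-tuple of individuals, and finiteness
    of [X] lets it be represented coordinatewise. *)
Lemma open_los (Fn P : nat -> Type) (X : finType) (sen : Type)
    (sat : forall A : fol_cat Fn P, (X -> fol_dom A) -> sen -> Prop) :
  (forall (M : T -> fol_cat Fn P) (N : fol_cat Fn P) (J0 : set T)
      (r : fol_dom N -> forall i : {i | J0 i}, fol_dom (M (sval i))) rho w,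
    F J0 -> germs (@trace T F J0) r ->
    str_germs (@trace T F J0) (fun i => fol_str (M (sval i))) (fol_str N) r ->
    sat N w rho <->
    @trace T F J0 [set i | sat (M (sval i)) (fun x => r (w x) i) rho]) ->
  forall (M : T -> open_models Fn P X) (U : fproduct F M) rho w,
    sat (fp_obj U) w rho <->
    satisfied_on_factors (G := states (open_models Fn P X))
      (fun A v => sat A v rho) w.
Proof.
move=> H M U rho w; have cD := @fol_domF_concrete Fn P.
have [J0 [r [FJ0 rP]]] := representatives U cD.
have G0 : germs (@trace T F J0) r by exact: (represents_germs cD rP).
have rX (Y : finType) : represents (U := U) (J0 := J0)
    (G := power_functor Y (fol_domF Fn P)) (fun y i x => r (y x) i).
  exact: (represents_power FJ0 (X := Y) rP).
apply: (iff_trans _ (iff_sym (@represents_factors _ _ _ _ _ U J0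
  (power_functor X (fol_domF Fn P)) _ (fun A v => sat A v rho) w
  (power_functor_concrete X cD) (rX X)))).
refine (H M (fp_obj U) J0 r rho w FJ0 G0 _); split=> [n f a|n pi a].
  pose o (A : fol_cat Fn P) (x : 'I_n -> fol_dom A) := fn (fol_str A) f x.
  refine (@represents_op _ _ _ _ _ U J0 (power_functor 'I_n (fol_domF Fn P))
    (fol_domF Fn P) _ r o a _ (power_functor_concrete 'I_n cD) (rX 'I_n) rP).
  by move=> A B h x; exact: (esym ((svalP h).1 n f x)).
exact: (@represents_determined _ _ _ _ _ U J0
  (power_functor 'I_n (fol_domF Fn P)) _
  (@fol_rel Fn P n pi) a (power_functor_concrete 'I_n cD) (rX 'I_n)
  (fol_rel_determined pi)).
Qed.

Lemma ofol_los (S : ssig OFOL) (M : T -> smod S) (U : fproduct F M)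
  (rho : ssen S) w :
  ssat (fp_obj U) w rho <-> satisfied_by_factors rho w.
Proof.
apply: (open_los (sat := fun A v => fol_sat (fo_expand (fol_str A) v))).
move=> M' N J0 r rho' w' FJ0 rG rS; have UT : UltraFilter (@trace T F J0) by
  exact: trace_ultra.
exact: (los_fol rho' rG (str_germs_expand rS w')).
Qed.

Lemma mofol_los (S : ssig MOFOL) (M : T -> smod S) (U : fproduct F M)
  (rho : ssen S) w :
  ssat (fp_obj U) w rho <-> satisfied_by_factors rho w.
Proof.
apply: (open_los (sat := fun A v => mofol_sat (fol_str A) v)).
move=> M' N J0 r rho' w' FJ0 rG rS; have UT : UltraFilter (@trace T F J0) by
  exact: trace_ultra.
by apply: los_mofol => //; exact: filter_finite_finType.
Qed.

Lemma hofol_los (S : ssig HOFOL) (M : T -> smod S) (U : fproduct F M)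
  (rho : ssen S) w :
  ssat (fp_obj U) w rho <-> satisfied_by_factors rho w.
Proof.
apply: (open_los (sat := fun A v => hofol_sat (fol_str A) v)).
move=> M' N J0 r rho' w' FJ0 rG rS; have UT : UltraFilter (@trace T F J0) by
  exact: trace_ultra.
by apply: los_hofol => //; exact: filter_finite_finType.
Qed.

Lemma hmofol_los (S : ssig HMOFOL) (M : T -> smod S) (U : fproduct F M)
  (rho : ssen S) w :
  ssat (fp_obj U) w rho <-> satisfied_by_factors rho w.
Proof.
apply: (open_los (sat := fun A v => hmofol_sat (fol_str A) v)).
move=> M' N J0 r rho' w' FJ0 rG rS; have UT : UltraFilter (@trace T F J0) by
  exact: trace_ultra.
by apply: los_hmofol => //; exact: filter_finite_finType.
Qed.

End LogicsLos.

Lemma logic_concrete (l : logic) (S : ssig (institution_of l)) :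
  concrete_fproducts (smod S).
Proof.
case: l S => S /=.
- exact: (prop_models_concrete _ kframes_concrete).
- exact: (fo_models_concrete _ _ kframes_concrete).
- exact: (prop_models_concrete _ (nominateds_concrete _ kframes_concrete)).
- exact: (fo_models_concrete _ _ (nominateds_concrete _ kframes_concrete)).
- exact: (prop_models_concrete _ (pframes_concrete _)).
- exact: (prop_models_concrete _ (nominateds_concrete _ (pframes_concrete _))).
- exact: (fo_models_concrete _ _ (pframes_concrete _)).
- exact: (fo_models_concrete _ _ (nominateds_concrete _ (pframes_concrete _))).
- exact: hhpl_models_concrete.
- exact: open_models_concrete.
- exact: open_models_concrete.
- exact: open_models_concrete.
- exact: open_models_concrete.
Qed.

Lemma logic_los (l : logic) (S : ssig (institution_of l)) (rho : ssen S) T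
    (F : set_system T) : UltraFilter F ->
  forall (M : T -> smod S) (U : fproduct F M) w,
    ssat (fp_obj U) w rho <-> satisfied_by_factors rho w.
Proof.
case: l S rho => S rho UF M U w.
- exact: mpl_los.
- exact: mfol_los.
- exact: hpl_los.
- exact: hfol_los.
- exact: mmpl_los.
- exact: mhpl_los.
- exact: mmfol_los.
- exact: mhfol_los.
- exact: hhpl_los.
- exact: ofol_los.
- exact: mofol_los.
- exact: hofol_los.
- exact: hmofol_los.
Qed.

Theorem corollary5p5 (l : logic) :
  let I := institution_of l in
  (forall (S : ssig I) (rho : ssen S),
     preserved_by_ultraproducts rho /\ preserved_by_ultrafactors rho) /\
  m_compact (local_institution I) /\
  m_compact (global_institution I) /\
  compact (local_institution I).
Proof.
move=> I; have cI := @logic_concrete l; have los := @logic_los l.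
split=> [S rho|].
  by split=> T F UF M U w; have [sf fs] := los S rho T F UF M U w.
split; [|split].
- exact: local_m_compact cI los.
- exact: global_m_compact cI los.
- exact: local_compact cI los.
Qed.
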